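(* Let $\Theta=(\theta_m)_{m\ge 1}$ be a sequence of non-negative real numbers and let $b\in\mathbb{N}$ be fixed. (i) For all real $s_1,\dots,s_b$, as formal power series in $t$, $$\sum_{n=0}^\infty h_n\,\mathbb{E}_\Theta\Big[\exp\Big(i\sum_{m=1}^b s_m C_m^{(n)}\Big)\Big]t^n=\exp\Big(\sum_{m=1}^b\frac{\theta_m}{m}(e^{is_m}-1)t^m\Big)\,G_\Theta(t).$$ (ii) If $g_\Theta$ is of class $\mathcal{F}(r,\theta)$, then, as $n\to\infty$, $$\mathbb{E}_\Theta\Big[\exp\Big(i\sum_{m=1}^b s_m C_m^{(n)}\Big)\Big]=\exp\Big(\sum_{m=1}^b\frac{\theta_m}{m}(e^{is_m}-1)r^m\Big)+O\Big(\frac1n\Big).$$ (iii) If $g_\Theta$ is of class $e\mathcal{F}(r,\theta,\gamma)$, then, as $n\to\infty$, $$\mathbb{E}_\Theta\Big[\exp\Big(i\sum_{m=1}^b s_m C_m^{(n)}\Big)\Big]=\exp\Big(\sum_{m=1}^b\frac{\theta_m}{m}(e^{is_m}-1)r^m\Big)+O\Big(\frac{\log n}{n^\gamma}\Big).$$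
   Context: For $\sigma$ in the symmetric group $S_n$, $C_m^{(n)}(\sigma)$ is the number of cycles of length $m$ in the disjoint cycle decomposition of $\sigma$ (zero if $m>n$). The weighted measure on $S_n$ is $\mathbb{P}_\Theta[\sigma]=\frac{1}{h_n n!}\prod_{m=1}^n\theta_m^{C_m^{(n)}(\sigma)}$, with normalization $h_n=\frac1{n!}\sum_{\sigma\in S_n}\prod_{m=1}^n\theta_m^{C_m^{(n)}(\sigma)}$ and $h_0=1$; $\mathbb{E}_\Theta$ is expectation under $\mathbb{P}_\Theta$ (when $h_n=0$, the product $h_n\mathbb{E}_\Theta[u]$ is read as $\frac1{n!}\sum_\sigma u(\sigma)\prod_m\theta_m^{C_m^{(n)}(\sigma)}=0$; for $n=0$ the expectation is $1$). Put $g_\Theta(t)=\sum_{k\ge1}\frac{\theta_k}{k}t^k$ and $G_\Theta(t)=\exp(g_\Theta(t))$. For $0<r<R$ and $0<\phi<\pi/2$ let $\Delta_0(r,R,\phi)=\{z\in\mathbb{C}: |z|<R,\ z\ne r,\ |\arg(z-r)|>\phi\}$. For $r>0$ and $\theta\ge0$, a function $g$ is of class $\mathcal{F}(r,\theta)$ if there are $R>r$ and $0<\phi<\pi/2$ such that $g$ is holomorphic in $\Delta_0(r,R,\phi)$, and there is a constant $K$ with $g(t)=\theta\log\frac{1}{1-t/r}+K+O(t-r)$ as $t\to r$. For $r>0$, $\theta\ge0$ and $0<\gamma\le1$, a function $g$ is of class $e\mathcal{F}(r,\theta,\gamma)$ if $g(t)=\theta\log\frac{1}{1-t/r}+g_0(t)$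 with $g_0$ analytic in $\{|t|<r\}$ and $[t^n]g_0=O(r^{-n}n^{-1-\gamma})$, where $[t^n]g_0$ is the coefficient of $t^n$. For the formal power series $g_\Theta$, being of such a class means that it converges near $0$ and its sum (analytically continued if necessary) has the stated properties.
   Formalization: Parts (ii) and (iii) are stated for θ > 0 instead of θ ≥ 0; at θ = 0 they fail, e.g. for θ_1 = 1 and θ_m = 0 for m ≥ 2, where g(t) = t and the expectation with b = 1 equals e^{i n s_1}, which does not converge. *)

(* Defs.v *)
From HB Require Import structures.
From mathcomp Require Import all_boot all_order all_algebra all_fingroup.
From mathcomp Require Import all_classical all_reals all_analysis.
From mathcomp Require Export complex.

Set Implicit Arguments.
Unset Strict Implicit.
Unset Printing Implicit Defensive.

Import Order.TTheory GRing.Theory Num.Theory.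
Import numFieldTopology.Exports numFieldNormedType.Exports.

Local Open Scope classical_set_scope.
Local Open Scope ring_scope.
Local Open Scope complex_scope.

Section FormalPowerSeries.
Variable F : fieldType.

(* A formal power series is the sequence of its coefficients. *)
Definition fps := nat -> F.

Definition fps_one : fps := fun n => (n == 0%N)%:R.

Definition fps_mul (a c : fps) : fps :=
  fun n => \sum_(k < n.+1) a k * c (n - k)%N.

Definition fps_pow (a : fps) (k : nat) : fps := iter k (fps_mul a) fps_one.

(* exp a = \sum_k a^k / k!, for a series a with a 0 = 0: then a^k has no term
   of degree < k, so only k <= n contributes to the coefficient of t^n.
   Only meant for such series, over a field of characteristic 0. *)
Definition fps_exp (a : fps) : fps :=
  fun n => \sum_(k < n.+1) (k`!%:R)^-1 * fps_pow a k n.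

End FormalPowerSeries.

Section ComplexFunctions.
Variable R : realType.

(* R[i] at its numFieldType structure, so that its topology and its structure
   of normed space over itself are those of an abstract numFieldType. *)
Definition CC : numFieldType := R[i].

Definition RtoC (x : R) : CC := x%:C.
Definition ImUnit : CC := 0 +i* 1.
Definition ReC (z : CC) : R := complex.Re z.
Definition ImC (z : CC) : R := complex.Im z.

(* The norm `|z| of CC has its values in CC; this is its real value. *)
Definition cmod (z : CC) : R := ReC `|z|.

Definition cexp (z : CC) : CC :=
  RtoC (expR (ReC z)) * (RtoC (cos (ImC z)) + ImUnit * RtoC (sin (ImC z))).

(* Principal argument, in ]-pi, pi]; the value at 0 is irrelevant. *)
Definition carg (z : CC) : R :=
  if 0 <= ImC z then acos (ReC z / cmod z) else - acos (ReC z / cmod z).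

(* Principal branch of the logarithm. *)
Definition clog (z : CC) : CC := RtoC (ln (cmod z)) + ImUnit * RtoC (carg z).

(* derivable f z 1 is taken over the field CC: complex differentiability. *)
Definition holomorphic_on (D : set CC) (f : CC -> CC) : Prop :=
  forall z, D z -> derivable f z 1.

Definition pseries_cvg (a : nat -> CC) (t l : CC) : Prop :=
  series (fun k => a k * t ^+ k) @ \oo --> l.

Definition Delta0 (r Rad phi : R) : set CC :=
  [set z | [/\ cmod z < Rad, z != RtoC r & phi < `|carg (z - RtoC r)| ]].

Definition log_sing (r theta : R) (t : CC) : CC :=
  RtoC theta * clog (1 / (1 - t / RtoC r)).

(* O(t - r) is taken for t -> r inside the domain where g is holomorphic. *)
Definition class_F (r theta : R) (g : CC -> CC) : Prop :=
  [/\ 0 < r, 0 <= theta &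
   exists Rad phi : R,
     [/\ r < Rad, 0 < phi < pi / 2,
         holomorphic_on (Delta0 r Rad phi) g &
         exists (K : CC) (M : R),
           \forall t \near RtoC r, Delta0 r Rad phi t ->
             cmod (g t - (log_sing r theta t + K)) <= M * cmod (t - RtoC r)]].

(* a is the sequence of Taylor coefficients at 0 of g0. *)
Definition class_eF (r theta gamma : R) (g : CC -> CC) : Prop :=
  [/\ 0 < r, 0 <= theta, 0 < gamma <= 1 &
   exists (g0 : CC -> CC) (a : nat -> CC),
     [/\ forall t, cmod t < r -> g t = log_sing r theta t + g0 t,
         forall t, cmod t < r -> pseries_cvg a t (g0 t) &
         a =O_\oo (fun n : nat => RtoC (r ^- n * n%:R `^ (- 1 - gamma)))]].

(* The formal series a converges near 0, and its sum extends to a function g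
   satisfying P.  Used with P := class_F _ _ or class_eF _ _ _, which make g
   holomorphic on a connected open set containing 0, so that g is there the
   analytic continuation of the sum. *)
Definition fps_of_class (P : (CC -> CC) -> Prop) (a : fps CC) : Prop :=
  exists g : CC -> CC,
    (\forall t \near (0 : CC), pseries_cvg a t (g t)) /\ P g.

End ComplexFunctions.

Section WeightedPermutations.
Variable R : realType.

(* Number of cycles of length m of s, fixed points being the cycles of
   length 1. *)
Definition ncycles (n m : nat) (s : 'S_n) : nat :=
  #|[set c in porbits s | #|c| == m]%SET|.

(* Sequences indexed by m >= 1 are functions on nat whose value at 0 is never
   used. *)
Variable Theta : nat -> R.

Definition cycle_weight (n : nat) (s : 'S_n) : R :=
  \prod_(1 <= m < n.+1) Theta m ^+ ncycles m s.

Definition hnorm (n : nat) : R :=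
  (n`!%:R)^-1 * \sum_(s : 'S_n) cycle_weight s.

Definition PTheta (n : nat) (s : 'S_n) : R :=
  (hnorm n * n`!%:R)^-1 * cycle_weight s.

(* For non-negative Theta, if hnorm n = 0 then all the weights of 'S_n vanish,
   and so does ETheta n u. *)
Definition ETheta (n : nat) (u : 'S_n -> CC R) : CC R :=
  \sum_(s : 'S_n) RtoC (PTheta s) * u s.

Definition gTheta : fps (CC R) :=
  fun k => if k == 0%N then 0 else RtoC (Theta k / k%:R).

Definition GTheta : fps (CC R) := fps_exp gTheta.

(* The expectation of exp (i \sum_(m = 1)^b s_m C_m). *)
Definition char_fun (b : nat) (s : nat -> R) (n : nat) : CC R :=
  ETheta (fun sigma : 'S_n =>
    cexp (ImUnit R * RtoC (\sum_(1 <= m < b.+1) s m * (ncycles m sigma)%:R))).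

(* (theta_m / m) (e^(i s_m) - 1) *)
Definition shift_coef (s : nat -> R) (m : nat) : CC R :=
  RtoC (Theta m / m%:R) * (cexp (ImUnit R * RtoC (s m)) - 1).

(* The polynomial \sum_(m = 1)^b shift_coef s m * t^m, as a formal series. *)
Definition shift_fps (b : nat) (s : nat -> R) : fps (CC R) :=
  fun m => if (1 <= m <= b)%N then shift_coef s m else 0.

Definition char_limit (b : nat) (s : nat -> R) (r : R) : CC R :=
  cexp (\sum_(1 <= m < b.+1) shift_coef s m * RtoC r ^+ m).

End WeightedPermutations.

(* Main.v *)
(* Inserting a new point into a permutation, as a fixed point or before another
   point, gives n c_n = \sum_k theta_k c_(n-k) for c_n = h_n and for the tilted
   sums h_n E[exp(i ...)]; such a recursion characterizes the exponential of a
   power series, whence (i).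

   For (ii) and (iii) put u_n = h_n r^n and alpha_k = theta_k r^k, so that
   n u_n = \sum_(k >= 1) alpha_k u_(n-k).  If alpha_k tends to theta > 0 at a
   rate, then u_n is comparable to the mean of u_0, ..., u_(n-1), and comparing
   the recursion at n and n + 1 gives |u_(n+1) - u_n| <= C e_n u_n, with
   e_n = ln n / n^gamma if alpha_k - theta = O(k^-gamma), and e_n = 1 / n if
   moreover alpha_(k+1) - alpha_k = O(k^-2).  By (i), h_n E[exp(i ...)] is the
   convolution of h with the coefficients of an entire function, and dividing by
   h_n costs an error O(e_n).  So only the coefficients of g itself have to be
   estimated, not those of exp g.

   In class eF this is immediate.  In class F, let g0 = g - theta log(...) - K.
   With t = r e^w, the coefficients of g0 are integrals over two rays from
   w = -1/n with directions pi (kappa + i) and pi (kappa - i): they form a closed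
   curve around 0 in the t-plane since their ends differ by 2 pi i.  There
   |t - r| is O((1 + n s) / n) at parameter s while |t^-n| decays exponentially in
   n s, so that [t^n] g0 = O(r^-n n^-2); the same argument for the function
   n g0 - (n - 1) (t / r) g0 controls the differences alpha_(k+1) - alpha_k. *)

From HB Require Import structures.
Require Import Defs.
From mathcomp Require Import all_boot all_order all_algebra all_fingroup.
From mathcomp Require Import all_classical all_reals all_analysis.
From mathcomp Require Import ring lra zify.
Set Implicit Arguments.
Unset Strict Implicit.
Unset Printing Implicit Defensive.
Import Order.TTheory GRing.Theory Num.Theory.
Import numFieldTopology.Exports numFieldNormedType.Exports.
Local Open Scope ring_scope.

(** * Cycle counts and the insertion recursion *)

(** Positivity of theta is essential: n u_n is close to theta times u_0 + ... + u_(n-1), and only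
    division by theta bounds that sum by n u_n. For Theta = 0 the function g = 0 is of class F(r,
    0), but h_n = 0 for n >= 1, so [char_fun] is 0 while its limit is 1.

    The convolution with the entire factor is harmless because |u_(n-k) - u_n| <= D k^2 e_n u_n is
    only polynomial in k, whereas the coefficients of that factor, multiplied by r^k, are O(4^-k).

    The bound alpha_k - theta = O(1/k) alone gives ln n / n here: in the sum of u_(n-k) / k the
    small k produce a harmonic sum. The differences, of order k^-2, are summable; this is why class
    F needs two coefficient estimates.

    The exponential coordinate keeps the complex analysis elementary. Goursat's lemma on
    parallelograms and the period 2 pi i replace homotopy and winding numbers, and the residue is
    found by letting the common origin of the two rays tend to -infinity. The slope kappa < cos phi
    keeps the rays inside the domain of class F. *)

Lemma porbit_eq_set (T : finType) (s : {perm T}) (x : T) (A : {set T}) :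
  x \in A -> (forall y, y \in A -> s y \in A) ->
  (forall y, y \in A -> exists i, y = (s ^+ i)%g x) -> porbit s x = A.
Proof.
move=> xA sA Ax; apply/setP=> y; apply/porbitP/idP => [[i ->]|/Ax //].
elim: i => [|i IHi]; first by rewrite perm1.
by rewrite expgSr permM sA.
Qed.

Section CycleInsertion.
Variables (n : nat) (a : 'I_n.+1) (t : 'S_n).

Definition insert_fix : 'S_n.+1 := lift_perm a a t.

(** Products of permutations act from left to right, so the transposition acts last: the preimage of
    [j] is sent to [a], and [a] to [j]. *)
Definition insert_before (j : 'I_n) : 'S_n.+1 :=
  (lift_perm a a t * tperm a (lift a j))%g.

Lemma insert_fix_lift k : insert_fix (lift a k) = lift a (t k).
Proof. exact: lift_perm_lift. Qed.

Lemma insert_before_lift j k :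
  insert_before j (lift a k) = if t k == j then a else lift a (t k).
Proof.
rewrite permM lift_perm_lift; case: eqP => [->|/eqP tkj]; first by rewrite tpermR.
by rewrite tpermD ?neq_lift // (inj_eq (@lift_inj _ a)) eq_sym.
Qed.

Lemma insert_before_id j : insert_before j a = lift a j.
Proof. by rewrite permM lift_perm_id tpermL. Qed.

Lemma porbit_insert_fix_lift k :
  porbit insert_fix (lift a k) = lift a @: porbit t k.
Proof.
apply: porbit_eq_set.
- by rewrite imset_f ?porbit_id.
- move=> _ /imsetP[y yk ->]; rewrite insert_fix_lift imset_f //.
  by rewrite -eq_porbit_mem (porbit_perm t 1) eq_porbit_mem.
- move=> _ /imsetP[_ /porbitP[i ->] ->]; exists i; elim: i => [|i IHi].
    by rewrite !perm1.
  by rewrite !permX !iterS -!permX -IHi insert_fix_lift.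
Qed.

Lemma porbit_insert_fix_id : porbit insert_fix a = [set a].
Proof.
apply: porbit_eq_set; first exact: set11.
- by move=> y /set1P->; rewrite lift_perm_id set11.
- by move=> y /set1P->; exists 0%N; rewrite perm1.
Qed.

Lemma porbit_insert_before_lift j k : k \notin porbit t j ->
  porbit (insert_before j) (lift a k) = lift a @: porbit t k.
Proof.
move=> kj; have tk i : ((t ^+ i)%g k == j) = false.
  by apply: contraNF kj => /eqP <-; rewrite -eq_porbit_mem porbit_perm.
apply: porbit_eq_set.
- by rewrite imset_f ?porbit_id.
- move=> _ /imsetP[_ /porbitP[i ->] ->]; rewrite insert_before_lift.
  have := tk i.+1; rewrite expgSr permM => ->.
  by rewrite imset_f // -permM -expgSr mem_porbit.
- move=> _ /imsetP[_ /porbitP[i ->] ->]; exists i; elim: i => [|i IHi].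
    by rewrite !perm1.
  rewrite !permX !iterS -!permX -IHi insert_before_lift.
  by have := tk i.+1; rewrite permX iterS -permX => ->.
Qed.

Lemma porbit_insert_before_id j :
  porbit (insert_before j) a = a |: (lift a @: porbit t j).
Proof.
set p := #|porbit t j|.
have ret : iter p t j = j by exact: iter_porbit.
(* The redirection to [a] fires only when [t] returns to [j]; before [p] steps this does not happen,
   so the orbit of [a] runs through all of the cycle of [j] before closing. *)
have noret i : (0 < i < p)%N -> (iter i t j == j) = false.
  case/andP=> i0 ip; apply/negbTE/eqP => E.
  have := uniq_traject_porbit t j; rewrite -/p => U.
  have p0 : (0 < p)%N by apply: leq_trans ip.
  have : (nth j (traject t j p) 0 == nth j (traject t j p) i).
    by rewrite !nth_traject //= E.
  by rewrite nth_uniq ?size_traject //; case: i i0 {ip E}.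
have memi y : y \in porbit t j -> exists2 i, (i < p)%N & y = iter i t j.
  by rewrite porbit_traject => /trajectP[i ip ->]; exists i.
have stepi i : (i < p)%N -> (insert_before j ^+ i.+1)%g a = lift a (iter i t j).
  elim: i => [|i IHi] ip; first by rewrite expg1 insert_before_id.
  rewrite permX iterS -permX IHi ?(ltnW ip) // insert_before_lift.
  by have := noret i.+1; rewrite ip /= => ->.
apply: porbit_eq_set; first exact: setU11.
- move=> y /setU1P[->|/imsetP[z /memi[i ip ->] ->]].
    by rewrite insert_before_id setU1r ?imset_f ?porbit_id.
  rewrite insert_before_lift -iterS; case: ifP => _; first exact: setU11.
  by rewrite setU1r ?imset_f // -permX mem_porbit.
- move=> y /setU1P[->|/imsetP[z /memi[i ip ->] ->]].
    by exists 0%N; rewrite perm1.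
  by exists i.+1; rewrite stepi.
Qed.

Lemma porbits_insert_fix :
  porbits insert_fix :\ porbit insert_fix a
  = [set lift a @: (c : {set _}) | c in porbits t].
Proof.
apply/setP=> c; rewrite porbit_insert_fix_id !inE; apply/andP/imsetP.
- case=> + /imsetP[z _ zE]; rewrite {}zE => ca; move: ca.
  case: (unliftP a z) => [k ->|->]; last by rewrite porbit_insert_fix_id eqxx.
  by exists (porbit t k); rewrite ?imset_f ?porbit_insert_fix_lift.
- case=> _ /imsetP[k _ ->] ->; rewrite -porbit_insert_fix_lift; split.
    rewrite -porbit_insert_fix_id eq_porbit_mem porbit_insert_fix_id.
    by rewrite inE eq_sym neq_lift.
  by rewrite imset_f.
Qed.

Lemma porbits_insert_before j :
  porbits (insert_before j) :\ porbit (insert_before j) a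
  = [set lift a @: (c : {set _}) | c in porbits t :\ porbit t j].
Proof.
apply/setP=> c; rewrite !inE; apply/andP/imsetP.
- case=> + /imsetP[z _ zE]; rewrite {}zE => ca; move: ca.
  case: (unliftP a z) => [k ->|->]; last by rewrite eqxx.
  rewrite eq_porbit_mem porbit_insert_before_id !inE eq_sym (negPf (neq_lift _ _)) /=.
  rewrite (mem_imset _ _ (@lift_inj _ a)) => kj.
  exists (porbit t k); last by rewrite porbit_insert_before_lift.
  by rewrite !inE eq_porbit_mem kj imset_f.
- case=> d /setD1P[dj /imsetP[k _ dk]] ->.
  move: dj; rewrite {}dk eq_porbit_mem => kj.
  rewrite -(porbit_insert_before_lift kj); split; last by rewrite imset_f.
  rewrite eq_porbit_mem porbit_insert_before_id !inE eq_sym (negPf (neq_lift _ _)) /=.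
  by rewrite (mem_imset _ _ (@lift_inj _ a)).
Qed.

End CycleInsertion.

(** * Cycle index sums and the recursion obtained from one marked point *)

Section CycleIndex.
Variables (F : fieldType) (x : nat -> F).

Definition perm_weight n (s : 'S_n) : F := \prod_(c in porbits s) x #|c|.

Definition cycle_sum n : F := \sum_(s : 'S_n) perm_weight s.

(** The cycle through the marked point has its own weight sequence [y], which can be shifted in an
    induction while the other cycles keep [x]. *)
Definition marked_weight (y : nat -> F) n (a : 'I_n) (s : 'S_n) : F :=
  y #|porbit s a| * \prod_(c in porbits s :\ porbit s a) x #|c|.

Lemma card_lift_imset n (a : 'I_n.+1) (c : {set 'I_n}) :
  #|lift a @: c| = #|c|.
Proof. by rewrite card_imset //; apply: lift_inj. Qed.

Lemma prod_lift_imset n (a : 'I_n.+1) (B : {set {set 'I_n}}) :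
  \prod_(c in [set lift a @: (d : {set _}) | d in B]) x #|c| = \prod_(c in B) x #|c|.
Proof.
rewrite big_imset /=; last by move=> c d _ _; apply/imset_inj/lift_inj.
by apply: eq_bigr => c _; rewrite card_lift_imset.
Qed.

Lemma marked_weight_fix y n (a : 'I_n.+1) (t : 'S_n) :
  marked_weight y a (insert_fix a t) = y 1%N * perm_weight t.
Proof.
by rewrite /marked_weight porbits_insert_fix prod_lift_imset porbit_insert_fix_id cards1.
Qed.

Lemma marked_weight_before y n (a : 'I_n.+1) (t : 'S_n) j :
  marked_weight y a (insert_before a t j) = marked_weight (y \o succn) j t.
Proof.
rewrite /marked_weight porbits_insert_before prod_lift_imset.
rewrite porbit_insert_before_id cardsU1 card_lift_imset.
by case: imsetP => [[k _ /eqP]|_]; rewrite ?(negPf (neq_lift _ _)).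
Qed.

Lemma sum_perm_insert n (f : 'S_n.+1 -> F) (a : 'I_n.+1) :
  \sum_(s : 'S_n.+1) f s = \sum_(t : 'S_n) f (insert_fix a t)
     + \sum_(j < n) \sum_(t : 'S_n) f (insert_before a t j).
Proof.
(* Permutations are sorted by the image of [a]. If [s a = b], then [s * tperm a b] fixes [a] and so
   is a lifted permutation of the remaining points. *)
have reix b : \sum_(s : 'S_n.+1 | s a == b) f s
    = \sum_(t : 'S_n) f (lift_perm a a t * tperm a b)%g.
  pose g (s : 'S_n.+1) k := odflt k (unlift a ((s * tperm a b)%g (lift a k))).
  have gE (s : 'S_n.+1) k : s a = b -> lift a (g s k) = (s * tperm a b)%g (lift a k).
    move=> sab; rewrite /g; case: (unliftP a _) => [m //|E].
    have /perm_inj/eqP : (s * tperm a b)%g (lift a k) = (s * tperm a b)%g a.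
      by rewrite E permM sab tpermR.
    by rewrite eq_sym (negPf (neq_lift _ _)).
  have gs_inj (s : 'S_n.+1) : s a = b -> injective (g s).
    move=> sab k l E; apply: (@lift_inj _ a); apply: (@perm_inj _ (s * tperm a b)%g).
    by rewrite -!gE // E.
  pose h (s : 'S_n.+1) : 'S_n :=
    if @idP (injectiveb (g s)) is ReflectT H then perm (injectiveP _ H) else 1%g.
  have hE (s : 'S_n.+1) k : s a = b -> h s k = g s k.
    rewrite /h => /gs_inj /injectiveP; case: {-}_ / idP => // H _; exact: permE.
  rewrite (reindex_onto (fun t => lift_perm a a t * tperm a b)%g h) /=.
    apply: eq_bigl => t; rewrite permM lift_perm_id tpermL eqxx /=.
    apply/eqP/permP => k; apply: (@lift_inj _ a).
    have E : (lift_perm a a t * tperm a b)%g a = b by rewrite permM lift_perm_id tpermL.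
    by rewrite hE // gE // -mulgA tperm2 mulg1 lift_perm_lift.
  move=> s /eqP sab; apply/permP => y; rewrite permM.
  case: (unliftP a y) => [k ->|->]; last by rewrite lift_perm_id tpermL.
  by rewrite lift_perm_lift hE // gE // permM tpermK.
rewrite (partition_big (fun s : 'S_n.+1 => s a) predT) //=.
rewrite (bigD1_ord a) //= reix tperm1; congr (_ + _).
  by apply: eq_bigr => t _; rewrite mulg1.
by apply: eq_bigr => j _; rewrite reix.
Qed.

Lemma sum_marked_weight_insert n (y : nat -> F) (a : 'I_n.+1) :
  \sum_(s : 'S_n.+1) marked_weight y a s
  = y 1%N * cycle_sum n
    + \sum_(j < n) \sum_(t : 'S_n) marked_weight (y \o succn) j t.
Proof.
rewrite (sum_perm_insert (marked_weight y a) a) /cycle_sum big_distrr /=.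
congr (_ + _); first by apply: eq_bigr => t _; rewrite marked_weight_fix.
by apply: eq_bigr => j _; apply: eq_bigr => t _; rewrite marked_weight_before.
Qed.

(* Shifting the weight sequence y records the length of the cycle of a that
   has already been removed. *)
Lemma sum_marked_weight n (y : nat -> F) (a : 'I_n.+1) :
  \sum_(s : 'S_n.+1) marked_weight y a s
  = \sum_(k < n.+1) (n ^_ k)%:R * y k.+1 * cycle_sum (n - k).
Proof.
elim: n y a => [|n IHn] y a; rewrite sum_marked_weight_insert.
  by rewrite big_ord0 addr0 big_ord1 ffactn0 mul1r.
rewrite [RHS]big_ord_recl ffactn0 mul1r subn0; congr (_ + _).
under eq_bigr => j _ do rewrite IHn.
(* The inner sum does not depend on [j]; its n + 1 equal copies turn the falling factorial n^_k into
   (n+1)^_(k+1). *)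
rewrite sumr_const card_ord -mulr_natl big_distrr /=.
by apply: eq_bigr => k _; rewrite !mulrA -natrM ffactSS.
Qed.

(** Marks [ord0]: the falling factorial counts the ordered choices of the k other points on its
    cycle, and the remaining n - k points are permuted freely. *)
Lemma cycle_sum_rec n :
  cycle_sum n.+1 = \sum_(k < n.+1) (n ^_ k)%:R * x k.+1 * cycle_sum (n - k).
Proof.
rewrite -(sum_marked_weight x ord0); apply: eq_bigr => s _.
by rewrite /perm_weight (big_setD1 (porbit s ord0)) //= imset_f.
Qed.

End CycleIndex.

Local Open Scope classical_set_scope.
Local Open Scope ring_scope.

(** * Complex numbers and the exponential *)

Section ComplexModulus.
Variable R : realType.
Local Notation C := (CC R).
Implicit Types (x y : R) (z w : C).

HB.instance Definition _ := GRing.RMorphism.copy (@RtoC R) (real_complex R : R -> CC R).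

Lemma RtoCD x y : RtoC (x + y) = RtoC x + RtoC y. Proof. exact: rmorphD. Qed.
Lemma RtoCB x y : RtoC (x - y) = RtoC x - RtoC y. Proof. exact: rmorphB. Qed.
Lemma RtoCM x y : RtoC (x * y) = RtoC x * RtoC y. Proof. exact: rmorphM. Qed.
Lemma RtoCV x : RtoC x^-1 = (RtoC x)^-1. Proof. exact: fmorphV. Qed.
Lemma RtoCX x n : RtoC (x ^+ n) = RtoC x ^+ n. Proof. exact: rmorphXn. Qed.
Lemma RtoC1 : RtoC 1 = 1 :> C. Proof. exact: rmorph1. Qed.
Lemma RtoC0 : RtoC 0 = 0 :> C. Proof. exact: rmorph0. Qed.
Lemma RtoC_nat n : RtoC n%:R = n%:R :> C. Proof. exact: rmorph_nat. Qed.
Lemma RtoC_eq0 x : (RtoC x == 0) = (x == 0). Proof. exact: fmorph_eq0. Qed.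

Lemma RtoC_sum (I : Type) (l : seq I) (P : pred I) (f : I -> R) :
  RtoC (\sum_(i <- l | P i) f i) = \sum_(i <- l | P i) RtoC (f i).
Proof. exact: rmorph_sum. Qed.

Lemma RtoC_inj : injective (@RtoC R). Proof. exact: fmorph_inj. Qed.

Lemma normC_cmod z : `|z| = RtoC (cmod z).
Proof. by []. Qed.

Lemma CC_eqP z w : ReC z = ReC w -> ImC z = ImC w -> z = w.
Proof. by case: z w => [a b] [c d] /= -> ->. Qed.

Lemma ReCD z w : ReC (z + w) = ReC z + ReC w. Proof. by case: z w => [a b] [c d]. Qed.
Lemma ImCD z w : ImC (z + w) = ImC z + ImC w. Proof. by case: z w => [a b] [c d]. Qed.
Lemma ReCN z : ReC (- z) = - ReC z. Proof. by case: z. Qed.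
Lemma ImCN z : ImC (- z) = - ImC z. Proof. by case: z. Qed.
Lemma ReCB z w : ReC (z - w) = ReC z - ReC w. Proof. by rewrite ReCD ReCN. Qed.
Lemma ImCB z w : ImC (z - w) = ImC z - ImC w. Proof. by rewrite ImCD ImCN. Qed.
Lemma ReCM z w : ReC (z * w) = ReC z * ReC w - ImC z * ImC w.
Proof. by case: z w => [a b] [c d]. Qed.
Lemma ImCM z w : ImC (z * w) = ReC z * ImC w + ImC z * ReC w.
Proof. by case: z w => [a b] [c d] /=. Qed.
Lemma ReC_RtoC x : ReC (RtoC x) = x. Proof. by []. Qed.
Lemma ImC_RtoC x : ImC (RtoC x) = 0. Proof. by []. Qed.
Lemma ReC_i : ReC (ImUnit R) = 0. Proof. by []. Qed.
Lemma ImC_i : ImC (ImUnit R) = 1. Proof. by []. Qed.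
Lemma ReC1 : ReC (1 : C) = 1. Proof. by []. Qed.
Lemma ImC1 : ImC (1 : C) = 0. Proof. by []. Qed.
Lemma ReC0 : ReC (0 : C) = 0. Proof. by []. Qed.
Lemma ImC0 : ImC (0 : C) = 0. Proof. by []. Qed.

Definition reimE := (ReCD, ImCD, ReCN, ImCN, ReCM, ImCM, ReC_RtoC, ImC_RtoC,
  ReC_i, ImC_i, ReC1, ImC1, ReC0, ImC0).

Lemma CC_reim z : z = RtoC (ReC z) + ImUnit R * RtoC (ImC z).
Proof. by apply: CC_eqP; rewrite !reimE; ring. Qed.

Lemma cmodE z : cmod z = Num.sqrt (ReC z ^+ 2 + ImC z ^+ 2).
Proof. by case: z. Qed.

Lemma cmod_sqr z : cmod z ^+ 2 = ReC z ^+ 2 + ImC z ^+ 2.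
Proof. by rewrite cmodE sqr_sqrtr // addr_ge0 ?sqr_ge0. Qed.

Lemma cmod_ge0 z : 0 <= cmod z.
Proof. by rewrite cmodE sqrtr_ge0. Qed.

Lemma cmodM z w : cmod (z * w) = cmod z * cmod w.
Proof. by apply: (@complexI R); rewrite -[LHS]normC_cmod normrM !normC_cmod -RtoCM. Qed.

Lemma cmodD z w : cmod (z + w) <= cmod z + cmod w.
Proof. by rewrite -lecR rmorphD; exact: (ler_normD (z : C) w). Qed.

Lemma cmodN z : cmod (- z) = cmod z.
Proof. by rewrite !cmodE ReCN ImCN !sqrrN. Qed.

Lemma cmodB z w : cmod (z - w) <= cmod z + cmod w.
Proof. by rewrite (le_trans (cmodD _ _)) // cmodN. Qed.

Lemma cmodC z w : cmod (z - w) = cmod (w - z).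
Proof. by rewrite -cmodN opprB. Qed.

Lemma cmod_RtoC x : cmod (RtoC x) = `|x|.
Proof. by rewrite cmodE reimE expr0n addr0 sqrtr_sqr. Qed.

Lemma cmod0 : cmod (0 : C) = 0.
Proof. by rewrite -RtoC0 cmod_RtoC normr0. Qed.

Lemma cmod1 : cmod (1 : C) = 1.
Proof. by rewrite -RtoC1 cmod_RtoC normr1. Qed.

Lemma cmod_i : cmod (ImUnit R) = 1.
Proof. by rewrite cmodE !reimE expr0n expr1n add0r sqrtr1. Qed.

Lemma cmod_eq0 z : (cmod z == 0) = (z == 0).
Proof.
apply/eqP/eqP => [z0|->]; last exact: cmod0.
by apply/eqP; rewrite -normr_eq0 normC_cmod z0 RtoC0.
Qed.

Lemma cmod_gt0 z : (0 < cmod z) = (z != 0).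
Proof. by rewrite lt0r cmod_ge0 cmod_eq0 andbT. Qed.

Lemma cmodV z : cmod z^-1 = (cmod z)^-1.
Proof.
have [->|z0] := eqVneq z 0; first by rewrite invr0 cmod0 invr0.
have z1 : cmod z != 0 by rewrite cmod_eq0.
by apply: (mulfI z1); rewrite -cmodM !mulfV // cmod1.
Qed.

Lemma cmodX z n : cmod (z ^+ n) = cmod z ^+ n.
Proof. by elim: n => [|n IHn]; rewrite ?expr0 ?cmod1 // !exprS cmodM IHn. Qed.

Lemma cmod_sum (I : Type) (r : seq I) (P : pred I) (f : I -> C) :
  cmod (\sum_(i <- r | P i) f i) <= \sum_(i <- r | P i) cmod (f i).
Proof.
elim/big_ind2: _ => [|z a w b za wb|//]; first by rewrite cmod0.
by apply: le_trans (cmodD _ _) (lerD za wb).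
Qed.

Lemma Re_le_cmod z : `|ReC z| <= cmod z.
Proof. by rewrite cmodE -sqrtr_sqr ler_wsqrtr // lerDl sqr_ge0. Qed.

Lemma Im_le_cmod z : `|ImC z| <= cmod z.
Proof. by rewrite cmodE -sqrtr_sqr ler_wsqrtr // lerDr sqr_ge0. Qed.

Lemma cmod_le_reim z : cmod z <= `|ReC z| + `|ImC z|.
Proof.
rewrite {1}(CC_reim z) (le_trans (cmodD _ _)) // cmodM cmod_i mul1r.
by rewrite !cmod_RtoC.
Qed.

Lemma cmod_ge_sub z w : cmod z - cmod w <= cmod (z - w).
Proof. by rewrite lerBlDr; have := cmodD (z - w) w; rewrite subrK. Qed.

(** The radius of a ball in [CC] is itself an element of [CC]; being positive, it has zero imaginary
    part. This turns neighbourhoods into statements with real radii. *)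
Lemma near_CCP z (P : C -> Prop) :
  (\forall t \near z, P t) <->
  exists2 d : R, 0 < d & forall t, cmod (t - z) < d -> P t.
Proof.
split.
- move=> /nbhs_normP[e /= e0 eP].
  have eE : e = RtoC (ReC e).
    by move: e0; rewrite ltcE /= => /andP[/eqP ei _]; case: e ei eP => a b /= ->.
  exists (ReC e); first by move: e0; rewrite eE ltcR.
  by move=> t tz; apply: eP; rewrite /ball_ /= distrC eE normC_cmod ltcR.
- move=> [d d0 dP]; apply/nbhs_normP; exists (RtoC d); first by rewrite /= ltcR.
  by move=> t; rewrite /ball_ /= distrC normC_cmod ltcR; exact: dP.
Qed.

Lemma eqO_cmodP (u : nat -> C) (v : nat -> R) :
  (exists M : R, \forall n \near \oo, cmod (u n) <= M * `|v n|) <->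
  u =O_\oo (fun n => RtoC (v n)).
Proof.
split.
- move=> [M uM]; apply/eqOP; near=> k; near=> n.
  rewrite normC_cmod [`|RtoC _|]normC_cmod cmod_RtoC.
  have Mk : RtoC M <= k.
    by near: k; apply: nbhs_pinfty_ge; apply/complex_realP; exists M.
  apply: (@le_trans _ _ (RtoC M * RtoC `|v n|)).
    by rewrite -RtoCM lecR; near: n.
  by rewrite ler_wpM2r // lecR.
- move=> /eqO_exP[k k0 uk].
  have kE : k = RtoC (ReC k).
    by move: k0; rewrite ltcE /= => /andP[/eqP ei _]; case: k ei {uk} => x y /= ->.
  exists (ReC k); near=> n.
  have : `|u n| <= k * `|RtoC (v n)| by near: n.
  by rewrite !normC_cmod {1}kE cmod_RtoC -RtoCM lecR.
Unshelve. all: by end_near. Qed.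

End ComplexModulus.

(** * Elementary inequalities for sine, cosine and the exponential *)

Section RealBounds.
Variable R : realType.
Implicit Types x y : R.

Lemma MVT_all (f df : R -> R) : (forall x, is_derive x (1 : R) f (df x)) ->
  forall a b, exists2 c, Num.min a b <= c <= Num.max a b & f b - f a = df c * (b - a).
Proof.
move=> fdf.
have H a b : a < b -> exists2 c, a <= c <= b & f b - f a = df c * (b - a).
  move=> ab; have [|c cab E] := @MVT R f df a b ab (fun x _ => fdf x).
    apply: continuous_subspaceT => x; apply: differentiable_continuous.
    exact/derivable1_diffP/(@ex_derive _ _ _ _ _ _ _ (fdf x)).
  by exists c => //; move: cab; rewrite in_itv /= => /andP[/ltW -> /ltW ->].
move=> a b; case: (ltgtP a b) => [ab|ba|->].
- by have [c cab E] := H a b ab; exists c.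
- by have [c cab E] := H b a ba; exists c => //; rewrite -opprB E -mulrN opprB.
- by exists b; rewrite ?lexx // !subrr mulr0.
Qed.

Lemma abs_le_between (a c : R) : Num.min 0 a <= c <= Num.max 0 a -> `|c| <= `|a|.
Proof.
case: (ltgtP 0 a) => [a0|a0|<-] /andP[c1 c2]; rewrite ler_norml.
- by rewrite (gtr0_norm a0); apply/andP; split; lra.
- by rewrite (ltr0_norm a0); apply/andP; split; lra.
- by rewrite normr0; apply/andP; split; lra.
Qed.

Lemma abs_sin_le y : `|sin y| <= `|y|.
Proof.
have [c _] := @MVT_all sin cos (@is_derive_sin R) 0 y.
rewrite sin0 !subr0 => ->; rewrite normrM -[leRHS]mul1r.
by rewrite ler_wpM2r ?normr_ge0 ?cos_max.
Qed.

Lemma abs_cos1_le y : `|cos y - 1| <= y ^+ 2.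
Proof.
have [c /abs_le_between cy] := @MVT_all cos (fun x => - sin x) (@is_derive_cos R) 0 y.
rewrite cos0 !subr0 => ->; rewrite normrM normrN -real_normK ?num_real // expr2.
by rewrite ler_wpM2r ?normr_ge0 // (le_trans (abs_sin_le c)).
Qed.

Lemma abs_sin_sub_le y : `|sin y - y| <= `|y| ^+ 3.
Proof.
have D (x : R) : is_derive x (1 : R) (fun x : R => sin x - x) (cos x - 1).
  by apply: is_deriveB.
have [c /abs_le_between cy] := MVT_all D 0 y.
rewrite sin0 !subr0 => ->; rewrite normrM exprSr.
rewrite ler_wpM2r ?normr_ge0 // (le_trans (abs_cos1_le c)) //.
by rewrite -real_normK ?num_real // lerXn2r ?nnegrE ?normr_ge0.
Qed.

(** Both sides come from e^x >= 1 + x: applied to -x it gives e^x <= 1 / (1 - x), and this is at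
    most 1 + x + 2 x^2 because x^2 (1 - 2 x) >= 0. *)
Lemma abs_expR1x_le x : `|x| <= 2^-1 -> `|expR x - 1 - x| <= 2 * x ^+ 2.
Proof.
rewrite ler_norml => /andP[x1 x2].
have E1 := expR_ge1Dx x; have E2 : expR x * (1 - x) <= 1.
  by rewrite -[leRHS](expRxMexpNx_1 x) ler_wpM2l ?expR_ge0 // expR_ge1Dx.
have E3 : expR x <= 1 + x + 2 * x ^+ 2.
  have x3 : 0 <= x ^+ 2 * (1 - 2 * x) by rewrite mulr_ge0 ?sqr_ge0 //; lra.
  have E3 : 1 <= (1 + x + 2 * x ^+ 2) * (1 - x) by nra.
  have x4 : 0 < 1 - x by lra.
  by rewrite -(ler_pM2r x4) (le_trans E2).
by rewrite ger0_norm; lra.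
Qed.

Lemma abs_expR1_le x : `|x| <= 2^-1 -> `|expR x - 1| <= 2 * `|x|.
Proof.
move=> x2; have := abs_expR1x_le x2; rewrite -real_normK ?num_real // => E.
have := ler_normD (expR x - 1 - x) x; rewrite subrK.
by have := normr_ge0 x; nra.
Qed.

Lemma expR_sub1_le x : expR x - 1 <= x * expR x.
Proof.
have := expR_ge1Dx (- x); rewrite expRN => H.
have := @ler_wpM2r _ (expR x) (expR_ge0 x) _ _ H.
by rewrite mulVf ?expR_eq0 // mulrDl mul1r mulNr; lra.
Qed.

End RealBounds.

Section ComplexExp.
Variable R : realType.
Local Notation C := (CC R).
Implicit Types (x y : R) (z w : C).

Lemma ReC_cexp z : ReC (cexp z) = expR (ReC z) * cos (ImC z).
Proof. by rewrite /cexp !reimE; ring. Qed.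

Lemma ImC_cexp z : ImC (cexp z) = expR (ReC z) * sin (ImC z).
Proof. by rewrite /cexp !reimE; ring. Qed.

Lemma cexpD z w : cexp (z + w) = cexp z * cexp w.
Proof.
by apply: CC_eqP; rewrite !(ReCM, ImCM, ReC_cexp, ImC_cexp) ReCD ImCD expRD !(cosD, sinD); ring.
Qed.

Lemma cexp0 : cexp (0 : C) = 1.
Proof. by apply: CC_eqP; rewrite !(ReC_cexp, ImC_cexp) !reimE !(expR0, cos0, sin0, mulr1, mulr0). Qed.

Lemma cexpN z : cexp (- z) = (cexp z)^-1.
Proof.
have H : cexp z * cexp (- z) = 1 by rewrite -cexpD subrr cexp0.
have z0 : cexp z != 0.
  by apply/eqP => z0; move/eqP: H; rewrite z0 mul0r eq_sym oner_eq0.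
by apply: (mulfI z0); rewrite H mulfV.
Qed.

Lemma cmod_cexp z : cmod (cexp z) = expR (ReC z).
Proof.
rewrite cmodE ReC_cexp ImC_cexp !exprMn -mulrDr cos2Dsin2 mulr1 sqrtr_sqr.
by rewrite ger0_norm ?expR_ge0.
Qed.

Lemma cexp_neq0 z : cexp z != 0.
Proof. by rewrite -cmod_gt0 cmod_cexp expR_gt0. Qed.

Lemma cexp_RtoC x : cexp (RtoC x) = RtoC (expR x).
Proof. by apply: CC_eqP; rewrite !(ReC_cexp, ImC_cexp) !reimE !(cos0, sin0, mulr1, mulr0). Qed.

Lemma cexpMn n z : cexp (n%:R * z) = cexp z ^+ n.
Proof.
elim: n => [|n IHn]; first by rewrite mul0r cexp0.
by rewrite -natr1 mulrDl mul1r cexpD IHn exprSr.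
Qed.

Lemma cexp_sum (I : Type) (r : seq I) (P : pred I) (f : I -> C) :
  cexp (\sum_(i <- r | P i) f i) = \prod_(i <- r | P i) cexp (f i).
Proof. exact: (big_morph _ cexpD cexp0). Qed.

(** The constant is generous: the real and imaginary parts are at most 4 |z|^2 and 3 |z|^2. *)
Lemma cmod_cexp1x_le z : cmod z <= 2^-1 -> cmod (cexp z - 1 - z) <= 10 * cmod z ^+ 2.
Proof.
move=> z2; set m := cmod z in z2 *.
have xm : `|ReC z| <= m := Re_le_cmod z; have ym : `|ImC z| <= m := Im_le_cmod z.
set x := ReC z in xm; set y := ImC z in ym.
have m0 : 0 <= m := cmod_ge0 z.
have x2 : `|x| <= 2^-1 by apply: le_trans z2.
have X1 := abs_expR1x_le x2; have X2 := abs_expR1_le x2.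
have Y1 := abs_cos1_le y; have Y2 := abs_sin_sub_le y; have Y3 := abs_sin_le y.
have E2 : expR x <= 2.
  have := ler_norm (expR x - 1); lra.
rewrite -[x ^+ 2]real_normK ?num_real // in X1.
rewrite -[y ^+ 2]real_normK ?num_real // in Y1.
have xx : `|x| ^+ 2 <= m ^+ 2 by rewrite lerXn2r ?nnegrE.
have yy : `|y| ^+ 2 <= m ^+ 2 by rewrite lerXn2r ?nnegrE.
have yyy : `|y| ^+ 3 <= m ^+ 2.
  by rewrite exprSr (le_trans _ yy) // ler_piMr ?sqr_ge0 //; lra.
rewrite (le_trans (cmod_le_reim _)) // !(ReCD, ReCN, ImCD, ImCN) ReC_cexp ImC_cexp ReC1 ImC1 -/x -/y subr0.
have -> : expR x * cos y - 1 - x = expR x * (cos y - 1) + (expR x - 1 - x) by ring.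
have -> : expR x * sin y - y = (expR x - 1) * sin y + (sin y - y) by ring.
have A : `|expR x * (cos y - 1) + (expR x - 1 - x)| <= 4 * m ^+ 2.
  rewrite (le_trans (ler_normD _ _)) // normrM (ger0_norm (expR_ge0 x)).
  have : expR x * `|cos y - 1| <= 2 * m ^+ 2.
    by rewrite ler_pM ?expR_ge0 // (le_trans Y1).
  lra.
have B : `|(expR x - 1) * sin y + (sin y - y)| <= 3 * m ^+ 2.
  rewrite (le_trans (ler_normD _ _)) // normrM.
  have : `|expR x - 1| * `|sin y| <= (2 * m) * m.
    by rewrite ler_pM // ?(le_trans X2) ?(le_trans Y3) // ler_wpM2l.
  rewrite -mulrA -expr2; lra.
by have := sqr_ge0 m; lra.
Qed.

End ComplexExp.

(** * The exponential formula *)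

Section FormalExp.
Variable F : numFieldType.
Implicit Types a b A B : fps F.

(** Identities that involve finitely many coefficients are proved for truncations, where the
    derivative and the Leibniz rule of polynomials apply. *)
Let tr a N : {poly F} := \poly_(i < N) a i.

Let coef_tr a N m : (m < N)%N -> (tr a N)`_m = a m.
Proof. by move=> mN; rewrite coef_poly mN. Qed.

Lemma fps_pow_coef a k N m : (m < N)%N ->
  fps_pow a k m = ((\poly_(i < N) a i) ^+ k)`_m.
Proof.
elim: k m => [|k IHk] m mN; first by rewrite expr0 coef1.
rewrite exprS coefM /fps_pow iterS; apply: eq_bigr => j _.
have jm : (j <= m)%N by rewrite -ltnS.
rewrite (coef_tr _ (leq_ltn_trans jm mN)) -/(fps_pow a k) IHk //.
exact: leq_ltn_trans (leq_subr _ _) mN.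
Qed.

Lemma fps_pow_low a k m : a 0%N = 0 -> (m < k)%N -> fps_pow a k m = 0.
Proof.
move=> a0; elim: k m => [//|k IHk] m mk; rewrite /fps_pow iterS /fps_mul.
apply: big1 => -[[|j] /= jm] _; first by rewrite a0 mul0r.
rewrite -/(fps_pow a k) IHk ?mulr0 //.
by case: m mk jm => [//|m] mk _; rewrite subSS (leq_ltn_trans (leq_subr _ _)).
Qed.

(** The length of the sum in [fps_exp] depends on the index of the coefficient; a common length
    makes all coefficients below N those of a single polynomial. *)
Lemma fps_expE a N m : a 0%N = 0 -> (m < N)%N ->
  fps_exp a m = \sum_(k < N) (k`!%:R)^-1 * fps_pow a k m.
Proof.
move=> a0 mN; rewrite /fps_exp (big_ord_widen N (fun k => (k`!%:R)^-1 * fps_pow a k m)) //.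
rewrite [RHS](bigID (fun k : 'I_N => (k < m.+1)%N)) /= [X in _ + X]big1 ?addr0 //.
by move=> k; rewrite -leqNgt => mk; rewrite fps_pow_low ?mulr0.
Qed.

Lemma fps_exp0 a : fps_exp a 0 = 1.
Proof. by rewrite /fps_exp big_ord1 /fps_pow /= /fps_one eqxx invr1 mul1r. Qed.

(* The coefficient form of (exp a)' = a' exp a. *)
Lemma fps_exp_rec a n : a 0%N = 0 ->
  n.+1%:R * fps_exp a n.+1
  = \sum_(k < n.+1) k.+1%:R * a k.+1 * fps_exp a (n - k)%N.
Proof.
move=> a0; set p := tr a n.+2.
pose E := \sum_(k < n.+2) (k`!%:R)^-1 *: p ^+ k.
have EE m N : (m < n.+2)%N -> (m < N)%N ->
    fps_exp a m = (\sum_(k < N) (k`!%:R)^-1 *: p ^+ k)`_m.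
  move=> mn mN; rewrite (fps_expE a0 mN) coef_sum; apply: eq_bigr => k _.
  by rewrite coefZ (fps_pow_coef _ _ mn).
have -> : n.+1%:R * fps_exp a n.+1 = (E^`())`_n.
  by rewrite coef_deriv -(EE n.+1) // mulr_natl.
(* Differentiation shifts the exponential sum and drops its top term. Coefficients up to degree n do
   not see the loss, by [EE] with n + 1 terms. *)
have -> : E^`() = p^`() * \sum_(k < n.+1) (k`!%:R)^-1 *: p ^+ k.
  rewrite /E raddf_sum big_ord_recl /= expr0 derivZ derivC scaler0 add0r big_distrr /=.
  apply: eq_bigr => k _; rewrite derivZ deriv_exp /bump /= add1n.
  rewrite factS natrM invfM -[(p^`() * _) *+ _]scaler_nat scalerA mulrAC mulVf ?pnatr_eq0 // mul1r.
  by rewrite scalerAr.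
rewrite coefM; apply: eq_bigr => k _; have kn : (k < n.+1)%N by [].
have nk : (n - k < n.+1)%N by rewrite ltnS leq_subr.
rewrite coef_deriv coef_tr // mulr_natl.
by rewrite -(EE _ _ (ltnW nk) nk).
Qed.

Lemma fps_rec_unique (c A B : fps F) : A 0%N = B 0%N ->
  (forall n, n.+1%:R * A n.+1 = \sum_(k < n.+1) c k * A (n - k)%N) ->
  (forall n, n.+1%:R * B n.+1 = \sum_(k < n.+1) c k * B (n - k)%N) -> A =1 B.
Proof.
move=> AB0 recA recB n; elim/ltn_ind: n => -[//|n] IHn.
apply: (@mulfI _ n.+1%:R); first by rewrite pnatr_eq0.
rewrite recA recB; apply: eq_bigr => k _; rewrite IHn //.
by rewrite ltnS leq_subr.
Qed.

(** Both sides solve the recursion driven by the derivative of a + b; for the product this is the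
    Leibniz rule. *)
Lemma fps_exp_add a b : a 0%N = 0 -> b 0%N = 0 ->
  fps_exp (fun n => a n + b n) =1 fps_mul (fps_exp a) (fps_exp b).
Proof.
move=> a0 b0.
apply: (@fps_rec_unique (fun k => k.+1%:R * (a k.+1 + b k.+1))).
- by rewrite /fps_mul big_ord1 !fps_exp0 mulr1.
- by move=> n; rewrite fps_exp_rec // a0 b0 addr0.
move=> n; set A := tr (fps_exp a) n.+2; set B := tr (fps_exp b) n.+2.
pose p := tr a n.+2; pose q := tr b n.+2.
have mulE m : (m < n.+2)%N -> fps_mul (fps_exp a) (fps_exp b) m = (A * B)`_m.
  move=> mn; rewrite coefM; apply: eq_bigr => j _.
  have jm : (j <= m)%N by rewrite -ltnS.
  rewrite !coef_tr //; first exact: leq_ltn_trans (leq_subr _ _) mn.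
  exact: leq_ltn_trans jm mn.
(* A truncated exponential satisfies its differential equation only in degrees at most n; [mulcong]
   says that the n-th coefficient of a product sees no other degree. *)
have dE c (c0 : c 0%N = 0) j : (j < n.+1)%N ->
    ((tr (fps_exp c) n.+2)^`())`_j = ((tr c n.+2)^`() * tr (fps_exp c) n.+2)`_j.
  move=> jn; rewrite coef_deriv coef_tr // -mulr_natl fps_exp_rec // coefM.
  apply: eq_bigr => k _; have kj : (k < j.+1)%N by [].
  rewrite coef_deriv !coef_tr // ?mulr_natl //.
    by rewrite (leq_ltn_trans (leq_subr _ _)) // ltnW.
  by rewrite ltnS (leq_trans kj).
have mulcong (u v w : {poly F}) : (forall j, (j < n.+1)%N -> u`_j = v`_j) ->
    (u * w)`_n = (v * w)`_n.
  by move=> uv; rewrite !coefM; apply: eq_bigr => j _; rewrite uv.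
rewrite mulE // mulr_natl -coef_deriv derivM coefD.
rewrite (mulcong _ (p^`() * A) B); last exact: (dE a).
rewrite [A * _]mulrC (mulcong _ (q^`() * B) A); last exact: (dE b).
rewrite -coefD -mulrA -mulrA [B * A]mulrC -mulrDl coefM.
apply: eq_bigr => k _; have kn : (k < n.+1)%N by [].
rewrite mulE ?coefD ?coef_deriv ?coef_tr ?mulr_natl ?mulrnDl //.
by rewrite ltnS (leq_trans (leq_subr _ _)).
Qed.
End FormalExp.

(** * Characteristic functions as normalizations for tilted weights *)

Section CharacteristicFunction.
Variables (R : realType) (Theta : nat -> R).
Local Notation C := (CC R).

Lemma porbit_card_le n (s : 'S_n) (c : {set 'I_n}) :
  c \in porbits s -> (0 < #|c| < n.+1)%N.
Proof.
case/imsetP=> x _ ->; rewrite lt0n card_porbit_neq0 ltnS /=.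
by rewrite -[leqRHS]card_ord max_card.
Qed.

Lemma prod_ncycles (A : fieldType) n (s : 'S_n) (f : nat -> A) (k : nat) :
  \prod_(1 <= m < k.+1) f m ^+ ncycles m s
  = \prod_(c in porbits s) (if (1 <= #|c| <= k)%N then f #|c| else 1).
Proof.
under eq_bigr => m _ do rewrite /ncycles -prodr_const.
under eq_bigr => m _ do under eq_bigl => c do rewrite inE.
rewrite (exchange_big_dep (fun c => c \in porbits s)) /=; last first.
  by move=> m c _ /andP[].
apply: eq_bigr => c cs; rewrite cs.
by under eq_bigl => m do rewrite /= eq_sym; rewrite big_nat1_eq ltnS.
Qed.

Variables (b : nat) (sc : nat -> R).

(** The factor exp(i s_m C_m) is absorbed into the weight of the cycles of length m, so h_n
    E[exp(i ...)] is the same sum as h_n with complex weights. *)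
Definition tilted_weight m : C :=
  RtoC (Theta m) * (if (1 <= m <= b)%N then cexp (ImUnit R * RtoC (sc m)) else 1).

Lemma cycle_weight_cexp n (s : 'S_n) :
  RtoC (cycle_weight Theta s)
    * cexp (ImUnit R * RtoC (\sum_(1 <= m < b.+1) sc m * (ncycles m s)%:R))
  = perm_weight tilted_weight s.
Proof.
rewrite /cycle_weight rmorph_prod.
under eq_bigr => m _ do rewrite rmorphXn.
rewrite rmorph_sum big_distrr cexp_sum /=.
under [X in _ * X]eq_bigr => m _.
  rewrite rmorphM rmorph_nat mulrA [_ * _%:R]mulrC cexpMn.
  over.
rewrite !prod_ncycles -big_split; apply: eq_bigr => c cs /=.
by have := porbit_card_le cs; rewrite ltnS => ->.
Qed.

Hypothesis Theta_ge0 : forall m : nat, (0 < m)%N -> 0 <= Theta m.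

Lemma cycle_weight_ge0 n (s : 'S_n) : 0 <= cycle_weight Theta s.
Proof.
rewrite /cycle_weight big_nat; apply: prodr_ge0 => m /andP[m0 _].
by rewrite exprn_ge0 // Theta_ge0.
Qed.

Lemma hnorm_char_fun n :
  RtoC (hnorm Theta n) * char_fun Theta b sc n
  = (n`!%:R)^-1 * cycle_sum tilted_weight n.
Proof.
rewrite /char_fun /ETheta !big_distrr /=; apply: eq_bigr => s _.
rewrite -cycle_weight_cexp mulrA -RtoCM [RHS]mulrA -RtoC_nat -RtoCV -RtoCM.
congr (RtoC _ * _); rewrite /PTheta; have [h0|h0] := eqVneq (hnorm Theta n) 0.
  (* When the normalization vanishes, [PTheta] is 0 by the convention for division; the right-hand
     side is 0 too, since non-negative weights with sum 0 all vanish. *)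
  rewrite h0 mul0r; have := h0; rewrite /hnorm => /eqP.
  rewrite mulf_eq0 invr_eq0 pnatr_eq0 eqn0Ngt fact_gt0 /=.
  rewrite psumr_eq0 => [|t _]; last exact: cycle_weight_ge0.
  by move=> /allP/(_ s (mem_index_enum _))/eqP ->; rewrite mulr0.
by rewrite invfM mulrA mulrA mulfV // mul1r.
Qed.

Lemma hnormE n : RtoC (hnorm Theta n) = (n`!%:R)^-1 * cycle_sum (fun m => RtoC (Theta m)) n.
Proof.
rewrite rmorphM fmorphV rmorph_nat rmorph_sum; congr (_ * _).
apply: eq_bigr => s _; rewrite /cycle_weight rmorph_prod.
under eq_bigr => m _ do rewrite rmorphXn.
rewrite prod_ncycles; apply: eq_bigr => c cs /=.
by have := porbit_card_le cs; rewrite ltnS => ->.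
Qed.

(** Both sides obey n c_n = x_1 c_(n-1) + ... + x_n c_0, because n^_k / n! = 1 / (n-k)!. The entry
    of index 0 is [x 0 / 0], that is 0, so the exponent has no constant term whatever [x 0] is. *)
Lemma cycle_sum_exp (x : nat -> C) n :
  (n`!%:R)^-1 * cycle_sum x n = fps_exp (fun k => x k / k%:R) n.
Proof.
move: n; apply: (@fps_rec_unique _ (fun k => x k.+1)).
- rewrite fps_exp0 invr1 mul1r /cycle_sum; under eq_bigr => s _.
    rewrite /perm_weight big_pred0; first over.
    by move=> c; apply/imsetP => -[[]].
  by rewrite sumr_const card_Sn.
- move=> n; rewrite cycle_sum_rec factS natrM invfM mulrA mulrA mulfV ?pnatr_eq0 // mul1r.
  rewrite big_distrr /=; apply: eq_bigr => k _; have kn : (k <= n)%N by rewrite -ltnS.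
  rewrite -(ffact_fact kn) natrM invfM; set c := (n ^_ k)%:R.
  have c0 : c != 0 by rewrite pnatr_eq0 -lt0n ffact_gt0.
  by field; rewrite c0 pnatr_eq0 -lt0n fact_gt0.
- move=> n; rewrite fps_exp_rec ?invr0 ?mulr0 //; apply: eq_bigr => k _.
  by rewrite mulrCA mulfV ?pnatr_eq0 // mulr1.
Qed.

Lemma eq_fps_exp (F : numFieldType) (a c : fps F) : a =1 c -> fps_exp a =1 fps_exp c.
Proof.
move=> ac; have E k : fps_pow a k =1 fps_pow c k.
  elim: k => [//|k IHk] n; rewrite /fps_pow !iterS.
  by apply: eq_bigr => j _; rewrite ac; congr (_ * _); exact: IHk.
by move=> n; apply: eq_bigr => k _; rewrite E.
Qed.

Lemma char_fun_gf n :
  RtoC (hnorm Theta n) * char_fun Theta b sc n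
  = fps_mul (fps_exp (shift_fps Theta b sc)) (GTheta Theta) n.
Proof.
rewrite hnorm_char_fun cycle_sum_exp /GTheta -fps_exp_add //.
apply: eq_fps_exp => -[|k]; first by rewrite invr0 mulr0 /shift_fps /gTheta /= addr0.
rewrite /shift_fps /gTheta /tilted_weight /shift_coef !RtoCM !RtoCV !RtoC_nat.
by case: ifP => _ /=; ring.
Qed.

Lemma hnorm_gf n : RtoC (hnorm Theta n) = GTheta Theta n.
Proof.
rewrite hnormE cycle_sum_exp; apply: eq_fps_exp => -[|k].
  by rewrite invr0 mulr0 /gTheta.
by rewrite /gTheta rmorphM fmorphV rmorph_nat.
Qed.

End CharacteristicFunction.

(** * Recursions with converging weights *)

Section WeightedRecursion.
Variables (R : realType) (al u : nat -> R) (th : R).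
Hypothesis u0 : u 0%N = 1.
Hypothesis al_ge0 : forall k, 0 <= al k.+1.
Hypothesis u_rec : forall n,
  n.+1%:R * u n.+1 = \sum_(k < n.+1) al k.+1 * u (n - k)%N.

Let U n := \sum_(j < n) u j.

Lemma u_ge0 n : 0 <= u n.
Proof.
elim/ltn_ind: n => -[|n] IHn; first by rewrite u0.
rewrite -(@pmulr_rge0 _ n.+1%:R) ?ltr0n // u_rec sumr_ge0 // => k _.
by rewrite mulr_ge0 // IHn // ltnS leq_subr.
Qed.

Lemma partial_sum_ge1 n : 1 <= U n.+1.
Proof.
by rewrite /U big_ord_recl u0 lerDl sumr_ge0 // => k _; apply: u_ge0.
Qed.

Lemma partial_sum_ge0 n : 0 <= U n.
Proof. by rewrite sumr_ge0 // => k _; apply: u_ge0. Qed.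

Lemma partial_sum_mono m n : (m <= n)%N -> U m <= U n.
Proof.
move=> /subnKC <-; rewrite /U big_split_ord lerDl sumr_ge0 // => k _.
exact: u_ge0.
Qed.

Lemma partial_sum_rev n : \sum_(k < n.+1) u (n - k)%N = U n.+1.
Proof.
rewrite /U (reindex_inj rev_ord_inj) /=; apply: eq_bigr => k _.
by rewrite subSS subKn // -ltnS.
Qed.

Variables (A : R).
Hypothesis al_le : forall k, al k.+1 <= A.

Lemma bound_ge0 : 0 <= A.
Proof. exact: le_trans (al_ge0 0) (al_le 0). Qed.

Lemma u_le_partial_sum n : n.+1%:R * u n.+1 <= A * U n.+1.
Proof.
rewrite u_rec -partial_sum_rev big_distrr /=; apply: ler_sum => k _.
by rewrite ler_wpM2r ?u_ge0.
Qed.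

(** The a priori bound u_m <= A U_m / m is used at m = n - k >= n / 2, which costs only the factor
    2. *)
Lemma u_le_half n k : (0 < n)%N -> (k.*2 <= n)%N -> (k < n)%N ->
  u (n - k)%N <= 2 * A * U n / n%:R.
Proof.
move=> n0 kn kltn; have nR : (0 : R) < n%:R by rewrite ltr0n.
rewrite ler_pdivlMr //.
case E : (n - k)%N => [|j]; first by move: kltn; rewrite -subn_gt0 E.
have H := u_le_partial_sum j.
have H2 : n%:R <= 2 * j.+1%:R :> R.
  by rewrite -natrM ler_nat; lia.
have H3 : U j.+1 <= U n by rewrite partial_sum_mono // -E leq_subr.
have H4 := ler_wpM2l bound_ge0 H3.
have H5 := ler_wpM2r (u_ge0 j.+1) H2.
by rewrite mulrC -mulrA; nra.
Qed.

(** The rate at which the weights converge, later n^gamma. The ratio condition says that p grows no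
    faster than linearly; it makes 1 / p k comparable to n / (k p n). *)
Variable p : nat -> R.
Hypothesis p_gt0 : forall k, 0 < p k.+1.
Hypothesis p_ratio : forall k n, (0 < k <= n)%N -> k%:R / p k <= n%:R / p n.
Hypothesis p_double : forall k n, (0 < n <= k.*2)%N -> p n <= 2 * p k.

Lemma harmonic_le n : \sum_(k < n.+1) (k.+1%:R : R)^-1 <= 1 + ln n.+1%:R.
Proof.
elim: n => [|n IHn]; first by rewrite big_ord1 invr1 ln1 addr0.
rewrite big_ord_recr /=.
have n2 : (0 : R) < n.+2%:R by rewrite ltr0n.
have n1 : (0 : R) < n.+1%:R by rewrite ltr0n.
have : ln (n.+1%:R : R) - ln n.+2%:R <= - n.+2%:R^-1.
  rewrite -ln_div ?posrE //.
  have -> : n.+1%:R / n.+2%:R = 1 + - n.+2%:R^-1 :> R.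
    move: n2; rewrite -(natr1 n.+1); move: (n.+1%:R) => x x0.
    by field; exact: lt0r_neq0.
  by rewrite le_ln1Dx // ltrN2 invf_lt1 // ltr1n.
move: IHn; move: (\sum_(k < n.+1) _) (ln _) (ln _) (_^-1) => S l1 l2 a; lra.
Qed.

Lemma ln_nat_ge_half n : (2 <= n)%N -> 2^-1 <= ln (n%:R : R).
Proof.
move=> n2; have n0 : (0 : R) < n%:R by rewrite ltr0n (leq_trans _ n2).
have : ln (n%:R : R)^-1 <= n%:R^-1 - 1.
  by have := @le_ln1Dx R (n%:R^-1 - 1); rewrite [1 + _]addrC subrK; apply; rewrite ltrBrDl subrr invr_gt0.
rewrite lnV ?posrE //; have : (n%:R : R)^-1 <= 2^-1 by rewrite lef_pV2 ?posrE // ler_nat.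
lra.
Qed.

(** Split at half of n. For small indices u_(n-k) is at most 2 A U_n / n and 1 / p k is at most n /
    (k p n), which leaves a harmonic sum. For large ones 1 / p k <= 2 / p n, and the values of u sum
    to at most U_n. Since ln n >= 1/2, the harmonic sum is at most 3 ln n and 1 is at most 2 ln n,
    whence 6 A + 4. *)
Lemma conv_le n : (2 <= n)%N ->
  \sum_(k < n) (p k.+1)^-1 * u (n - k.+1)%N <= (6 * A + 4) * (ln n%:R / p n) * U n.
Proof.
case: n => [//|n] n2; set N := n.+1.
have N0 : (0 : R) < N%:R by rewrite ltr0n.
have pN : 0 < p N := p_gt0 n.
have UN := partial_sum_ge0 N; have A0 := bound_ge0.
have lnN := ln_nat_ge_half n2.
apply: (@le_trans _ _ (\sum_(k < N) (2 * A * U N / p N * k.+1%:R^-1 + 2 / p N * u (n - k)%N))).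
  apply: ler_sum => k _; have kn : (k < N)%N by [].
  have pk := p_gt0 k; have uk := u_ge0 (n - k); have k0 : (0 : R) < k.+1%:R by rewrite ltr0n.
  rewrite subSS; have [k2|k2] := leqP k.+1.*2 N.
    have kN : (k.+1 < N)%N by lia.
    have := u_le_half (isT : (0 < N)%N) k2 kN; rewrite subSS => H.
    have H2 : (p k.+1)^-1 <= N%:R / p N / k.+1%:R.
      by rewrite ler_pdivlMr // mulrC p_ratio.
    have H3 : (p k.+1)^-1 * u (n - k)%N <= N%:R / p N / k.+1%:R * (2 * A * U N / N%:R).
      by rewrite ler_pM // invr_ge0 ltW.
    apply: (le_trans H3); have -> : N%:R / p N / k.+1%:R * (2 * A * U N / N%:R) = 2 * A * U N / p N / k.+1%:R.
      by field; rewrite !lt0r_neq0.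
    by rewrite lerDl mulr_ge0 // divr_ge0 // ltW.
  have H : (p k.+1)^-1 <= 2 / p N.
    by rewrite ler_pdivlMr // mulrC ler_pdivrMr // p_double //= ltnW.
  have H2 : (p k.+1)^-1 * u (n - k)%N <= 2 / p N * u (n - k)%N by rewrite ler_wpM2r.
  by apply: (le_trans H2); rewrite lerDr !mulr_ge0 ?invr_ge0 // ltW.
rewrite big_split -!big_distrr /= partial_sum_rev -/N.
have H := harmonic_le n; rewrite -/N in H.
have H1 : 2 * A * U N / p N * (\sum_(i < N) i.+1%:R^-1) <= 2 * A * U N / p N * (3 * ln N%:R).
  rewrite ler_wpM2l ?divr_ge0 ?mulr_ge0 // ?(ltW pN) //.
  by move: H lnN; move: (\sum_(i < N) _) (ln _) => S l; lra.
have H2 : 2 / p N * U N <= 2 / p N * U N * (2 * ln N%:R).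
  rewrite ler_peMr ?mulr_ge0 ?invr_ge0 ?(ltW pN) //.
  by move: lnN; move: (ln _) => l; lra.
by apply: (le_trans (lerD H1 H2)); rewrite le_eqVlt; apply/orP; left; apply/eqP; ring.
Qed.


Let eps n := ln (n%:R : R) / p n.

Variable M : R.
Hypothesis th_gt0 : 0 < th.
Hypothesis al_cvg : forall k, `|al k.+1 - th| <= M / p k.+1.
Hypothesis eps_small : forall e, 0 < e -> exists N, forall n, (N <= n)%N -> eps n <= e.
Hypothesis p_le : forall n, p n.+1 <= n.+1%:R.

Lemma rate_ge0 : 0 <= M.
Proof.
have := le_trans (normr_ge0 _) (al_cvg 0); rewrite pmulr_lge0 //.
by rewrite invr_gt0.
Qed.

Lemma eps_ge0 n : (0 < n)%N -> 0 <= eps n.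
Proof.
case: n => // n _; rewrite divr_ge0 // ?ln_ge0 ?ler1n //.
exact: ltW.
Qed.

Lemma eps_succ n : (2 <= n)%N -> eps n <= 2 * eps n.+1.
Proof.
case: n => // n n2; rewrite /eps.
have pn := p_gt0 n; have pn2 := p_gt0 n.+1; have l2 := ln_nat_ge_half n2.
have l3 : ln (n.+1%:R : R) <= ln n.+2%:R by rewrite ler_ln ?posrE ?ltr0n // ler_nat.
have H : p n.+2 <= 2 * p n.+1 by rewrite p_double //; lia.
have H1 : 1 <= 2 * p n.+1 / p n.+2 by rewrite ler_pdivlMr // mul1r.
rewrite ler_pdivrMr //.
have -> : 2 * (ln n.+2%:R / p n.+2) * p n.+1 = ln n.+2%:R * (2 * p n.+1 / p n.+2) by ring.
by rewrite (le_trans l3) // ler_peMr //; lra.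
Qed.

Lemma inv_le_eps n : (2 <= n)%N -> n%:R^-1 <= 2 * eps n.
Proof.
case: n => // n n2; have l2 := ln_nat_ge_half n2; have pn := p_gt0 n.
rewrite /eps mulrA ler_pdivlMr // mulrC ler_pdivrMr ?ltr0n //.
by have := p_le n; have : (0 : R) < n.+1%:R by []; nra.
Qed.

Lemma u_main_term n : (2 <= n)%N ->
  `|n%:R * u n - th * U n| <= M * (6 * A + 4) * eps n * U n.
Proof.
case: n => // n n2; rewrite u_rec -[X in _ - _ * X]partial_sum_rev big_distrr /= -sumrB.
have := ler_wpM2l rate_ge0 (conv_le n2); rewrite -/(eps _) => H.
have -> : M * (6 * A + 4) * eps n.+1 * U n.+1 = M * ((6 * A + 4) * eps n.+1 * U n.+1) by ring.
apply: le_trans H.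
rewrite big_distrr (le_trans (ler_norm_sum _ _ _)) //; apply: ler_sum => k _ /=.
rewrite -mulrBl normrM (ger0_norm (u_ge0 _)) subSS mulrA.
by rewrite ler_wpM2r ?u_ge0.
Qed.

(** The error in [u_main_term] is a small multiple of U_n itself; once it is below th U_n / 2 it can
    be absorbed. This is where th > 0 is indispensable. *)
Lemma u_lower : exists2 N, (2 <= N)%N &
  forall n, (N <= n)%N -> U n <= 2 / th * (n%:R * u n).
Proof.
set K := M * (6 * A + 4); have K0 : 0 <= K.
  by have := rate_ge0; have := bound_ge0 => *; rewrite mulr_ge0 //; lra.
have e0 : 0 < th / 2 / (K + 1) by rewrite !divr_gt0 //; lra.
have [N HN] := eps_small e0; exists (maxn 2 N); first exact: leq_maxl.
move=> n; rewrite geq_max => /andP[n2 nN].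
have := u_main_term n2; rewrite -/K ler_norml => /andP[H _].
have := HN _ nN; rewrite ler_pdivlMr ?ltr_wpDl // => H2.
have Un := partial_sum_ge0 n; have en : 0 <= eps n by rewrite eps_ge0 // (leq_trans _ n2).
have H3 : K * eps n * U n <= th / 2 * U n by rewrite ler_wpM2r //; lra.
by rewrite mulrAC ler_pdivlMr //; lra.
Qed.

Lemma u_step : exists C N, 0 <= C /\
  forall n, (N <= n)%N -> `|u n.+1 - u n| <= C * eps n.+1 * u n.+1.
Proof.
have [N N2 HN] := u_lower; set K := M * (6 * A + 4).
have A0 := bound_ge0; have K0 : 0 <= K by rewrite mulr_ge0 ?rate_ge0 //; lra.
have Q0 : 0 <= 2 * A * `|th - 1| * 2 + 3 * K by apply: addr_ge0; [rewrite !mulr_ge0|apply: mulr_ge0].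
exists ((2 * A * `|th - 1| * 2 + 3 * K) * (2 / th)), N; split.
  by rewrite mulr_ge0 // divr_ge0 // ltW.
move=> n nN; have n2 := leq_trans N2 nN; have n0 : (0 : R) < n.+1%:R by rewrite ltr0n.
have H1 := u_main_term n2; have H2 := u_main_term (leqW n2); rewrite -/K in H1 H2.
have H3 := HN _ (leqW nN); have Un := partial_sum_ge0 n.+1.
have US : U n.+1 = U n + u n by rewrite /U big_ord_recr.
have H4 : u n <= 2 * A * U n.+1 / n.+1%:R.
  by have := @u_le_half n.+1 1 isT; rewrite subSS subn0; apply; clear -n2; lia.
have H5 := inv_le_eps (leqW n2); have H6 := eps_succ n2.
have e0 : 0 <= eps n.+1 by exact: eps_ge0.
have H7 : K * eps n * U n <= K * (2 * eps n.+1) * U n.+1.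
  have en : 0 <= eps n by apply: eps_ge0; apply: ltnW.
  apply: ler_pM; [exact: mulr_ge0|exact: partial_sum_ge0|exact: ler_wpM2l|].
  exact: partial_sum_mono.
rewrite -(ler_pM2l n0) -[X in X * `|_|]gtr0_norm // -normrM.
(* The difference of the two defects k u_k - th U_k; the increment U_(n+1) - U_n = u_n and the
   passage from n to n + 1 produce the last term. *)
have -> : n.+1%:R * (u n.+1 - u n) = (n.+1%:R * u n.+1 - th * U n.+1)
    - (n%:R * u n - th * U n) + (th - 1) * u n.
  by rewrite US -(natr1 n); ring.
have H8 : `|(th - 1) * u n| <= `|th - 1| * (2 * A * U n.+1 * (2 * eps n.+1)).
  rewrite normrM (ger0_norm (u_ge0 n)) ler_wpM2l // (le_trans H4) //.
  by rewrite ler_wpM2l // !mulr_ge0.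
have H9 : (2 * A * `|th - 1| * 2 + 3 * K) * eps n.+1 * U n.+1
    <= n.+1%:R * ((2 * A * `|th - 1| * 2 + 3 * K) * (2 / th) * eps n.+1 * u n.+1).
  have {}Q0 : 0 <= (2 * A * `|th - 1| * 2 + 3 * K) * eps n.+1 by rewrite mulr_ge0.
  by rewrite (le_trans (ler_wpM2l Q0 H3)) // le_eqVlt; apply/orP; left; apply/eqP; ring.
apply: le_trans H9; apply: (le_trans (ler_normD _ _)).
apply: (le_trans (lerD (ler_normB _ _) H8)).
apply: (le_trans (lerD (lerD H2 (le_trans H1 H7)) (lexx _))).
by rewrite le_eqVlt; apply/orP; left; apply/eqP; ring.
Qed.

Lemma u_half_le : exists C N, 0 <= C /\ forall n k, (N <= n)%N -> (k.*2 <= n)%N ->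
  u (n - k)%N <= C * u n.
Proof.
have [N N2 HN] := u_lower; have A0 := bound_ge0.
exists (2 * A * (2 / th)), N; split; first by rewrite !mulr_ge0 ?invr_ge0 // ltW.
move=> n k nN kn; have n0 : (0 < n)%N by lia.
have nR : (0 : R) < n%:R by rewrite ltr0n.
have H : u (n - k)%N <= 2 * A * U n / n%:R by apply: u_le_half => //; lia.
apply: (le_trans H); rewrite -mulrA -[leRHS]mulrA; apply: ler_wpM2l; first by rewrite mulr_ge0.
rewrite ler_pdivrMr //; have := HN _ nN; rewrite mulrA mulrAC; exact.
Qed.

Lemma partial_sum_le : exists C N, 0 <= C /\ forall n, (N <= n)%N ->
  U n.+1 <= C * n%:R * u n.
Proof.
have [N N2 HN] := u_lower.
exists (2 / th + 1), N; split; first by rewrite addr_ge0 ?divr_ge0 ?ltW.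
move=> n nN; have H3 := HN _ nN; rewrite {1}/U big_ord_recr /= -/(U n).
rewrite -mulrA mulrDl mul1r lerD // ler_peMl ?u_ge0 // ler1n; lia.
Qed.

Lemma u_gt0 : exists N, forall n, (N <= n)%N -> 0 < u n.
Proof.
have [N N2 HN] := u_lower; exists N => -[|n] nN; first by lia.
have := HN _ nN; have := partial_sum_ge1 n.
have n0 : (0 : R) < n.+1%:R by rewrite ltr0n.
have := u_ge0 n.+1; rewrite le_eqVlt => /orP[/eqP <-|//].
by rewrite !mulr0; lra.
Qed.

Lemma sum_inv_sqr_le n : \sum_(k < n) (k.+1%:R ^+ 2 : R)^-1 <= 2.
Proof.
case: n => [|n]; first by rewrite big_ord0.
suff H : \sum_(k < n.+1) (k.+1%:R ^+ 2 : R)^-1 <= 2 - n.+1%:R^-1.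
  by apply: (le_trans H); rewrite gerBl invr_ge0.
elim: n => [|n IHn]; first by rewrite big_ord1 expr1n invr1; lra.
rewrite big_ord_recr /= (le_trans (lerD IHn (lexx _))) //.
rewrite -(natr1 n.+1); have : (1 : R) <= n.+1%:R by rewrite ler1n.
move: (n.+1%:R) => x x1.
have -> : 2 - (x + 1)^-1 = 2 - x^-1 + (x * (x + 1))^-1.
  by field; rewrite !lt0r_neq0 //; lra.
by rewrite lerD2l lef_pV2 ?posrE; nra.
Qed.

(** The same splitting as in [conv_le], but the sum of 1 / k^2 is bounded by 2, so no logarithm
    appears. For k > n / 2 the crude bound 1 / k^2 <= 4 / n is enough. *)
Lemma conv_inv_sqr_le n : (0 < n)%N ->
  \sum_(k < n) (k.+1%:R ^+ 2)^-1 * u (n - k.+1)%N <= (4 * A + 4) * U n / n%:R.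
Proof.
case: n => // n _; set N := n.+1; have N0 : (0 : R) < N%:R by rewrite ltr0n.
have UN := partial_sum_ge0 N; have A0 := bound_ge0.
apply: (@le_trans _ _ (\sum_(k < N) (2 * A * U N / N%:R * (k.+1%:R ^+ 2)^-1
    + 4 / N%:R * u (n - k)%N))).
  apply: ler_sum => k _; have uk := u_ge0 (n - k); have k0 : (0 : R) < k.+1%:R by rewrite ltr0n.
  have P1 : 0 <= 2 * A * U N / N%:R * (k.+1%:R ^+ 2)^-1.
    by rewrite !mulr_ge0 ?invr_ge0 ?sqr_ge0 // ltW.
  have P2 : 0 <= 4 / N%:R * u (n - k)%N by rewrite !mulr_ge0 ?invr_ge0 // ltW.
  rewrite subSS; have [k2|k2] := leqP k.+1.*2 N.
    have kN : (k.+1 < N)%N by lia.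
    have := u_le_half (isT : (0 < N)%N) k2 kN; rewrite subSS => H.
    have H3 : (k.+1%:R ^+ 2)^-1 * u (n - k)%N <= (k.+1%:R ^+ 2)^-1 * (2 * A * U N / N%:R).
      by rewrite ler_wpM2l // invr_ge0 sqr_ge0.
    by apply: (le_trans H3); rewrite mulrC lerDl.
  have H : (k.+1%:R ^+ 2)^-1 <= 4 / N%:R :> R.
    rewrite ler_pdivlMr // mulrC ler_pdivrMr ?exprn_gt0 //.
    rewrite -natrX -natrM ler_nat; move: k2; rewrite /N.
    by case: k {k0 uk P1 P2} => k /= _; nia.
  have H2 : (k.+1%:R ^+ 2)^-1 * u (n - k)%N <= 4 / N%:R * u (n - k)%N by rewrite ler_wpM2r.
  by apply: (le_trans H2); rewrite lerDr.
rewrite big_split -!big_distrr /= partial_sum_rev -/N.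
have H := sum_inv_sqr_le N.
have H1 : 2 * A * U N / N%:R * (\sum_(i < N) (i.+1%:R ^+ 2)^-1) <= 2 * A * U N / N%:R * 2.
  by rewrite ler_wpM2l // !mulr_ge0 // invr_ge0 ltW.
apply: (le_trans (lerD H1 (lexx _))).
by rewrite le_eqVlt; apply/orP; left; apply/eqP; ring.
Qed.

(* When the weights vary slowly, differencing the recursion avoids the loss of
   the logarithm. *)
Lemma u_step_smooth (M' : R) :
  (forall k, `|al k.+2 - al k.+1| <= M' / k.+1%:R ^+ 2) ->
  exists C N, 0 <= C /\
  forall n, (N <= n)%N -> `|u n.+1 - u n| <= C / n.+1%:R * u n.+1.
Proof.
move=> alM'; have A0 := bound_ge0.
have M'0 : 0 <= M'.
  by have := le_trans (normr_ge0 _) (alM' 0%N); rewrite expr1n divr1.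
have [N1 N12 HN1] := u_lower; have [C2 [N2 [C20 HN2]]] := u_half_le.
(* [al 1 + 1] bounds |al 1 - 1|; the other term is the convolution bound with U replaced by u
   through [u_lower]. The factor C2 passes from u_(n+1) to u_(n+2). *)
set K := al 1%N + 1 + M' * (4 * A + 4) * (2 / th).
have K0 : 0 <= K.
  rewrite addr_ge0 // ?addr_ge0 // !mulr_ge0 ?invr_ge0 ?addr_ge0 ?mulr_ge0 //.
  exact: ltW.
exists (K * C2), (N1 + N2)%N; split; first exact: mulr_ge0.
case=> [|n] nN; first by lia.
have nR : (0 : R) < n.+2%:R by rewrite ltr0n.
have nR1 : (0 : R) < n.+1%:R by rewrite ltr0n.
have un : u n.+1 <= C2 * u n.+2.
  by have := HN2 n.+2 1%N; rewrite subSS subn0; apply; lia.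
(* The recursions for u_(n+2) and u_(n+1) are aligned on the common values u_(n-k); only the term
   [al 1 * u_(n+1)] of the first has no partner. *)
have E : n.+2%:R * (u n.+2 - u n.+1)
    = (al 1%N - 1) * u n.+1 + \sum_(k < n.+1) (al k.+2 - al k.+1) * u (n.+1 - k.+1)%N.
  under eq_bigr => k _ do rewrite mulrBl.
  have F : \sum_(k < n.+1) al k.+1 * u (n.+1 - k.+1)%N = n.+1%:R * u n.+1.
    by rewrite u_rec; apply: eq_bigr => k _; rewrite subSS.
  rewrite sumrB F mulrBr (u_rec n.+1) [X in X - _ = _]big_ord_recl subn0 /= -(natr1 n.+1).
  rewrite [X in _ + X - _](_ : _ = \sum_(i < n.+1) al i.+2 * u (n.+1 - i.+1)%N) //.
  by ring.
have S : `|\sum_(k < n.+1) (al k.+2 - al k.+1) * u (n.+1 - k.+1)%N|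
    <= M' * (4 * A + 4) * (2 / th) * u n.+1.
  have H := ler_wpM2l M'0 (conv_inv_sqr_le (isT : (0 < n.+1)%N)).
  have H2 : (4 * A + 4) * U n.+1 / n.+1%:R <= (4 * A + 4) * (2 / th) * u n.+1.
    rewrite -mulrA -[leRHS]mulrA ler_wpM2l //; first by lra.
    rewrite ler_pdivrMr //; have := HN1 n.+1; rewrite mulrA mulrAC; apply; lia.
  apply: (le_trans _ (le_trans H _)); last first.
    have -> : M' * (4 * A + 4) * (2 / th) * u n.+1 = M' * ((4 * A + 4) * (2 / th) * u n.+1) by ring.
    exact: ler_wpM2l.
  rewrite big_distrr (le_trans (ler_norm_sum _ _ _)) //; apply: ler_sum => k _ /=.
  by rewrite normrM (ger0_norm (u_ge0 _)) mulrA ler_wpM2r ?u_ge0.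
have S2 : `|n.+2%:R * (u n.+2 - u n.+1)| <= K * u n.+1.
  rewrite E (le_trans (ler_normD _ _)) // [leRHS]mulrDl lerD // normrM.
  rewrite (ger0_norm (u_ge0 _)) ler_wpM2r ?u_ge0 //.
  by rewrite (le_trans (ler_normB _ _)) // normr1 ger0_norm.
rewrite -(ler_pM2l nR) -[X in X * `|_|]gtr0_norm // -normrM (le_trans S2) //.
have -> : n.+2%:R * (K * C2 / n.+2%:R * u n.+2) = K * (C2 * u n.+2).
  by field; rewrite lt0r_neq0.
exact: ler_wpM2l.
Qed.

End WeightedRecursion.

(** * Comparison of distant terms of a slowly varying sequence *)

Section SlowVariation.
Variables (R : realType) (u : nat -> R) (e : nat -> R).
Hypothesis u_ge0 : forall n, 0 <= u n.

(** For k <= n / 2 the one-step bounds telescope, since u and e change by bounded factors on that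
    range; the result is linear in k. For k > n / 2 the values are only compared with the partial
    sum, of size n u_n, and n = n^2 / n <= 4 k^2 C4 e_n. The square of k covers both cases. *)
Lemma slow_variation (C1 C2 C3 C4 : R) (N : nat) :
  0 <= C1 -> 0 <= C2 -> 0 <= C3 -> 0 <= C4 ->
  (forall n, (N <= n)%N -> `|u n.+1 - u n| <= C1 * e n.+1 * u n.+1) ->
  (forall n k, (N <= n)%N -> (k.*2 <= n)%N -> u (n - k)%N <= C2 * u n) ->
  (forall n, (N <= n)%N -> \sum_(j < n.+1) u j <= C3 * n%:R * u n) ->
  (forall m n, (N <= m)%N -> (m <= n <= m.*2)%N -> e m <= C4 * e n) ->
  (forall n, (N <= n)%N -> 0 <= e n /\ n%:R^-1 <= C4 * e n) ->
  exists2 C, 0 <= C & forall n k, (N.*2.+2 <= n)%N -> (k <= n)%N ->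
    `|u (n - k)%N - u n| <= C * k%:R ^+ 2 * e n * u n.
Proof.
move=> C10 C20 C30 C40 H1 H2 H3 H4 H5.
exists (C1 * C4 * C2 + 4 * C4 * (C3 + 1)).
  by rewrite addr_ge0 ?mulr_ge0 ?addr_ge0.
move=> n k nN kn; have [en0 en] : 0 <= e n /\ n%:R^-1 <= C4 * e n by apply: H5; lia.
have n0 : (0 : R) < n%:R by rewrite ltr0n; lia.
have [k2|k2] := leqP k.*2 n.
  have near : `|u (n - k)%N - u n| <= C1 * C4 * C2 * k%:R * e n * u n.
    elim: k kn k2 => [|k IHk] kn k2; first by rewrite subn0 subrr normr0 mulr0 !mul0r.
    have -> : u (n - k.+1)%N - u n = (u (n - k)%N - u n) - (u (n - k)%N - u (n - k.+1)%N) by ring.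
    rewrite (le_trans (ler_normB _ _)) // -natr1 mulrDr mulr1 !mulrDl lerD ?IHk //; try (clear -nN kn k2; lia).
    have := H1 (n - k.+1)%N; have -> : (n - k.+1).+1 = (n - k)%N by lia.
    move=> H; apply: (le_trans (H _)); first by clear -nN kn k2; lia.
    have Hk : u (n - k)%N <= C2 * u n by apply: H2; clear -nN kn k2; lia.
    have He : e (n - k)%N <= C4 * e n by apply: H4; clear -nN kn k2; lia.
    have -> : C1 * C4 * C2 * e n * u n = C1 * (C4 * e n) * (C2 * u n) by ring.
    apply: ler_pM => //; last by rewrite ler_wpM2l.
    by rewrite mulr_ge0 //; apply: (H5 _ _).1; clear -nN kn k2; lia.
  apply: (le_trans near); rewrite !ler_wpM2r ?u_ge0 //.
  apply: (@le_trans _ _ (C1 * C4 * C2 * k%:R ^+ 2)).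
    rewrite ler_wpM2l ?mulr_ge0 // -natrX ler_nat; nia.
  by rewrite ler_wpM2r ?sqr_ge0 // lerDl !mulr_ge0 // addr_ge0.
have uk : u (n - k)%N <= \sum_(j < n.+1) u j.
  have kn' : (n - k < n.+1)%N by lia.
  by rewrite (bigD1 (Ordinal kn')) //= lerDl sumr_ge0.
have H3n := H3 n ltac:(clear -nN; lia).
have B1 : `|u (n - k)%N - u n| <= (C3 + 1) * n%:R * u n.
  rewrite (le_trans (ler_normB _ _)) // !ger0_norm // mulrDl mulrDl mul1r.
  rewrite lerD ?(le_trans uk) // ler_peMl // ler1n; clear -nN; lia.
apply: (le_trans B1); rewrite ler_wpM2r //.
have B2 : n%:R <= 4 * C4 * (k%:R ^+ 2 * e n).
  have k4 : n%:R ^+ 2 <= 4 * k%:R ^+ 2 :> R.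
    by rewrite -!natrX -natrM ler_nat; clear -k2; nia.
  have -> : n%:R = n%:R ^+ 2 * n%:R^-1 :> R by field; rewrite lt0r_neq0.
  have -> : 4 * C4 * (k%:R ^+ 2 * e n) = (4 * k%:R ^+ 2) * (C4 * e n) by ring.
  by rewrite ler_pM // ?sqr_ge0 // invr_ge0 ltW.
apply: (@le_trans _ _ (4 * C4 * (C3 + 1) * k%:R ^+ 2 * e n)).
  have -> : 4 * C4 * (C3 + 1) * k%:R ^+ 2 * e n = (C3 + 1) * (4 * C4 * (k%:R ^+ 2 * e n)) by ring.
  by rewrite ler_wpM2l // addr_ge0.
by rewrite !ler_wpM2r ?sqr_ge0 // lerDr !mulr_ge0.
Qed.

End SlowVariation.

(** * Complex derivatives and the logarithm *)

Section ComplexDerivative.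
Variable R : realType.
Local Notation C := (CC R).
Implicit Types (x y e : R) (z w d : C) (f g : C -> C).

(** Complex differentiability as linear approximation with real radii: the rules of calculus become
    inequalities between reals, with no quotient and no punctured neighbourhood. *)
Definition cdiff f z d := forall e, 0 < e -> exists2 r, 0 < r &
  forall w, cmod (w - z) < r -> cmod (f w - f z - d * (w - z)) <= e * cmod (w - z).

Lemma derivable_cdiff f z : derivable f z 1 -> exists d, cdiff f z d.
Proof.
move=> fz; exists ('D_1 f z) => e e0.
have /cvgr_dist_le/(_ (RtoC e)) : (fun h => h^-1 *: (f (h *: 1 + z) - f z)) @ 0^' --> 'D_1 f z := fz.
rewrite ltcR => /(_ e0); rewrite near_withinE => /near_CCP[r r0 H].
exists r => // w wz; have [->|wz0] := eqVneq w z.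
  by rewrite !subrr mulr0 subr0 cmod0 mulr0.
have h0 : w - z != 0 by rewrite subr_eq0.
have := H (w - z); rewrite subr0 => /(_ wz h0).
rewrite normC_cmod lecR [_ *: 1]mulr1 subrK [_ *: _]mulrC => H2.
have -> : f w - f z - 'D_1 f z * (w - z) = - (('D_1 f z - (f w - f z) / (w - z)) * (w - z)).
  by field.
by rewrite cmodN cmodM ler_wpM2r ?cmod_ge0.
Qed.

(** Allows the product, chain and inverse rules to end with any fixed multiple of [e]. *)
Lemma cdiff_scaled f z d (K : R) : 0 <= K ->
  (forall e, 0 < e -> exists2 r, 0 < r &
    forall w, cmod (w - z) < r ->
      cmod (f w - f z - d * (w - z)) <= K * e * cmod (w - z)) -> cdiff f z d.
Proof.
move=> K0 H e e0; have e1 : 0 < e / (K + 1) by rewrite divr_gt0 // ltr_wpDl.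
have [r r0 Hr] := H _ e1; exists r => // w wz.
apply: (le_trans (Hr w wz)); rewrite ler_wpM2r ?cmod_ge0 // mulrA.
by rewrite ler_pdivrMr ?ltr_wpDl // mulrC ler_wpM2l ?(ltW e0) // lerDl.
Qed.

Lemma cdiff_lip f z d : cdiff f z d -> exists2 r, 0 < r &
  forall w, cmod (w - z) < r -> cmod (f w - f z) <= (cmod d + 1) * cmod (w - z).
Proof.
move=> /(_ 1 ltr01)[r r0 H]; exists r => // w /H; rewrite mul1r => Hw.
have -> : f w - f z = (f w - f z - d * (w - z)) + d * (w - z) by rewrite subrK.
by rewrite (le_trans (cmodD _ _)) // cmodM mulrDl mul1r addrC lerD2l.
Qed.

Lemma cdiff_cts f z d : cdiff f z d -> forall e, 0 < e -> exists2 r, 0 < r &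
  forall w, cmod (w - z) < r -> cmod (f w - f z) <= e.
Proof.
move=> /cdiff_lip[r r0 H] e e0; set K := cmod d + 1 in H.
have K0 : 0 < K by rewrite ltr_wpDl ?cmod_ge0.
exists (Num.min r (e / K)); first by rewrite lt_min r0 divr_gt0.
move=> w; rewrite lt_min => /andP[wr we]; apply: (le_trans (H w wr)).
by rewrite mulrC -ler_pdivlMr // ltW.
Qed.

Lemma cdiff_cst c z : cdiff (fun=> c) z 0.
Proof. by move=> e e0; exists 1 => // w _; rewrite subrr mul0r subrr cmod0 mulr_ge0 ?cmod_ge0 ?ltW. Qed.

Lemma cdiff_id z : cdiff id z 1.
Proof. by move=> e e0; exists 1 => // w _; rewrite mul1r subrr cmod0 mulr_ge0 ?cmod_ge0 ?ltW. Qed.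

Lemma cdiffD f g z d d' : cdiff f z d -> cdiff g z d' -> cdiff (fun w => f w + g w) z (d + d').
Proof.
move=> fd gd; apply: (@cdiff_scaled _ _ _ 2) => // e e0.
have [r r0 Hr] := fd e e0; have [s s0 Hs] := gd e e0.
exists (Num.min r s); first by rewrite lt_min r0.
move=> w; rewrite lt_min => /andP[/Hr H1 /Hs H2].
have -> : f w + g w - (f z + g z) - (d + d') * (w - z)
  = (f w - f z - d * (w - z)) + (g w - g z - d' * (w - z)) by ring.
by rewrite (le_trans (cmodD _ _)) // -mulrA mulr_natl mulr2n lerD.
Qed.

Lemma cdiffM f g z d d' : cdiff f z d -> cdiff g z d' ->
  cdiff (fun w => f w * g w) z (d * g z + f z * d').
Proof.
move=> fd gd; set K := cmod (g z) + cmod (f z) + (cmod d + 1).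
have K0 : 0 <= K by rewrite !addr_ge0 ?cmod_ge0.
apply: (@cdiff_scaled _ _ _ K) => // e e0.
have [r r0 Hr] := fd e e0; have [s s0 Hs] := gd e e0.
have [t t0 Ht] := cdiff_lip fd; have [t' t'0 Ht'] := cdiff_cts gd e0.
exists (Num.min (Num.min r s) (Num.min t t')); first by rewrite !lt_min r0 s0 t0.
move=> w; rewrite !lt_min => /andP[/andP[/Hr H1 /Hs H2] /andP[/Ht H3 /Ht' H4]].
have -> : f w * g w - f z * g z - (d * g z + f z * d') * (w - z)
  = g z * (f w - f z - d * (w - z)) + f z * (g w - g z - d' * (w - z))
    + (f w - f z) * (g w - g z) by ring.
rewrite (le_trans (cmodD _ _)) // -[leRHS]mulrA [leRHS]mulrDl lerD //.
  by rewrite (le_trans (cmodD _ _)) // !cmodM [leRHS]mulrDl lerD // ler_wpM2l ?cmod_ge0.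
rewrite cmodM [e * _]mulrC mulrA ler_pM ?cmod_ge0 //.
Qed.

Lemma cdiffZ c f z d : cdiff f z d -> cdiff (fun w => c * f w) z (c * d).
Proof. by move=> fd; have := cdiffM (cdiff_cst c z) fd; rewrite mul0r add0r. Qed.

Lemma cdiffN f z d : cdiff f z d -> cdiff (fun w => - f w) z (- d).
Proof.
move=> fd e e0; have [r r0 H] := fd e e0; exists r => // w /H.
have -> : - f w - - f z - - d * (w - z) = - (f w - f z - d * (w - z)) by ring.
by rewrite cmodN.
Qed.

Lemma cdiffB f g z d d' : cdiff f z d -> cdiff g z d' -> cdiff (fun w => f w - g w) z (d - d').
Proof. by move=> fd gd; apply: cdiffD => //; apply: cdiffN. Qed.

Lemma cdiff_sum (I : Type) (r : seq I) (f : I -> C -> C) z (d : I -> C) :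
  (forall i, cdiff (f i) z (d i)) ->
  cdiff (fun w => \sum_(i <- r) f i w) z (\sum_(i <- r) d i).
Proof.
move=> fd; elim: r => [|i r IHr].
  rewrite big_nil; have -> : (fun w => \sum_(i <- [::]) f i w) = fun=> 0 by apply/funext => w; rewrite big_nil.
  exact: cdiff_cst.
rewrite big_cons.
have -> : (fun w => \sum_(j <- i :: r) f j w) = fun w => f i w + \sum_(j <- r) f j w.
  by apply/funext => w; rewrite big_cons.
exact: cdiffD.
Qed.

Lemma cdiffX n z : cdiff (fun w => w ^+ n) z (n%:R * z ^+ n.-1).
Proof.
elim: n => [|n IHn]; first by rewrite mul0r; exact: cdiff_cst.
have -> : (fun w : C => w ^+ n.+1) = (fun w => w * w ^+ n) by apply/funext => w; rewrite exprS.
have := cdiffM (cdiff_id z) IHn; congr cdiff => /=.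
by case: n {IHn} => [|n]; rewrite ?mul0r ?mulr0 ?addr0 //= exprS -(natr1 n.+1); ring.
Qed.

Lemma cdiff_comp f g z d d' : cdiff f z d -> cdiff g (f z) d' ->
  cdiff (fun w => g (f w)) z (d' * d).
Proof.
move=> fd gd; set K := cmod d + 1 + cmod d'.
apply: (@cdiff_scaled _ _ _ K); first by rewrite !addr_ge0 ?cmod_ge0.
move=> e e0; have [r r0 Hr] := fd e e0; have [s s0 Hs] := gd e e0.
have [t t0 Ht] := cdiff_lip fd.
have [t' t'0 Ht'] := cdiff_cts fd (divr_gt0 s0 (ltr0Sn R 1)).
exists (Num.min r (Num.min t t')); first by rewrite !lt_min r0 t0.
move=> w; rewrite !lt_min => /andP[/Hr H1 /andP[/Ht H3 /Ht' H4]].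
have H2 : cmod (g (f w) - g (f z) - d' * (f w - f z)) <= e * cmod (f w - f z).
  by apply: Hs; lra.
have -> : g (f w) - g (f z) - d' * d * (w - z)
  = (g (f w) - g (f z) - d' * (f w - f z)) + d' * (f w - f z - d * (w - z)) by ring.
rewrite (le_trans (cmodD _ _)) // -[leRHS]mulrA [leRHS]mulrDl lerD //.
  by rewrite (le_trans H2) // mulrCA ler_wpM2l // ltW.
by rewrite cmodM ler_wpM2l ?cmod_ge0.
Qed.

Lemma cdiff_inv z : z != 0 -> cdiff (fun w => w^-1) z (- z^-1 ^+ 2).
Proof.
move=> z0; have m0 : 0 < cmod z by rewrite cmod_gt0.
apply: (@cdiff_scaled _ _ _ (2 / cmod z ^+ 3)).
  by rewrite divr_ge0 // exprn_ge0 // ltW.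
move=> e e0; exists (Num.min (cmod z / 2) e).
  by rewrite lt_min e0 divr_gt0.
move=> w; rewrite lt_min => /andP[w1 w2].
have wm : cmod z / 2 < cmod w.
  by have := cmod_ge_sub z (z - w); rewrite (cmodC z w) (_ : z - (z - w) = w); [lra | ring].
have w0 : w != 0 by rewrite -cmod_gt0; lra.
have -> : w^-1 - z^-1 - - z^-1 ^+ 2 * (w - z) = (w - z) * ((w - z) * (w^-1 * z^-1 ^+ 2)).
  by field; rewrite z0 w0.
rewrite cmodM mulrC ler_wpM2r ?cmod_ge0 // cmodM mulrC ler_pM ?cmod_ge0 //; last exact: ltW.
rewrite cmodM cmodX !cmodV exprVn.
have -> : 2 / cmod z ^+ 3 = (cmod z / 2)^-1 * (cmod z ^+ 2)^-1 by field; rewrite lt0r_neq0.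
by rewrite ler_wpM2r ?invr_ge0 ?sqr_ge0 // lef_pV2 ?posrE ?divr_gt0 // ?ltW //; lra.
Qed.

Lemma cdiff_cexp z : cdiff (@cexp R) z (cexp z).
Proof.
apply: (@cdiff_scaled _ _ _ (10 * cmod (cexp z))); first by rewrite mulr_ge0 ?cmod_ge0.
move=> e e0; exists (Num.min 2^-1 e); first by rewrite lt_min e0 invr_gt0 ltr0n.
move=> w; rewrite lt_min => /andP[/ltW w1 /ltW w2].
have -> : cexp w - cexp z - cexp z * (w - z) = cexp z * (cexp (w - z) - 1 - (w - z)).
  have -> : cexp w = cexp z * cexp (w - z) by rewrite -cexpD addrC subrK.
  by ring.
have -> : 10 * cmod (cexp z) * e * cmod (w - z) = cmod (cexp z) * (10 * (e * cmod (w - z))) by ring.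
rewrite cmodM ler_wpM2l ?cmod_ge0 // (le_trans (cmod_cexp1x_le w1)) //.
by rewrite ler_wpM2l // expr2 ler_wpM2r ?cmod_ge0.
Qed.

End ComplexDerivative.

Section MeanValue.
Variable R : realType.
Local Notation C := (CC R).

Lemma is_derive_eps (f : R -> R) (x l : R) :
  (forall e, 0 < e -> exists2 r, 0 < r & forall y, `|y - x| < r ->
     `|f y - f x - l * (y - x)| <= e * `|y - x|) -> is_derive x (1 : R) f l.
Proof.
move=> H.
suff Hc : (fun h => h^-1 *: (f (h *: (1 : R) + x) - f x)) @ 0^' --> l.
  by split; [apply/cvg_ex; exists l | exact: cvg_lim Hc].
apply/cvgrPdist_le => e e0; rewrite near_withinE; have [r r0 Hr] := H e e0.
near=> h => h0; have hr : `|h| < r.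
  by near: h; exists r => //= h; rewrite /ball_ /= sub0r normrN.
have := Hr (h + x); rewrite addrK => /(_ hr) Hh.
rewrite [_ *: 1]mulr1 /GRing.scale /= distrC.
have -> : h^-1 * (f (h + x) - f x) - l = h^-1 * (f (h + x) - f x - l * h).
  by field.
by rewrite normrM normfV mulrC ler_pdivrMr ?normr_gt0.
Unshelve. all: by end_near. Qed.

(* The factor 2 comes from treating real and imaginary parts separately. *)
Lemma cdiff_mean_value (f : C -> C) (d : R -> C) (z h : C) (M : R) :
  (forall s : R, 0 <= s <= 1 -> cdiff f (z + RtoC s * h) (d s)) ->
  (forall s : R, 0 <= s <= 1 -> cmod (d s) <= M) ->
  cmod (f (z + h) - f z) <= 2 * M * cmod h.
Proof.
move=> fd dM.
(* [p] stands for the real or the imaginary part; the real mean value theorem is applied to it along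
   the segment. *)
have key (p : C -> R) : (forall a b, p (a - b) = p a - p b) ->
    (forall (s : R) a, p (a * RtoC s) = p a * s) -> (forall a, `|p a| <= cmod a) ->
    `|p (f (z + h) - f z)| <= M * cmod h.
  move=> pB pM pn; pose phi s := p (f (z + RtoC s * h)).
  have D (s : R) : 0 <= s <= 1 -> is_derive s (1 : R) phi (p (d s * h)).
    move=> s01; apply: is_derive_eps => e e0.
    have e1 : 0 < e / (cmod h + 1) by rewrite divr_gt0 // ltr_wpDl ?cmod_ge0.
    have [r r0 Hr] := fd s s01 _ e1.
    exists (r / (cmod h + 1)); first by rewrite divr_gt0 // ltr_wpDl ?cmod_ge0.
    move=> y; rewrite ltr_pdivlMr ?ltr_wpDl ?cmod_ge0 // => ys.
    have E : z + RtoC y * h - (z + RtoC s * h) = h * RtoC (y - s).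
      by rewrite RtoCB; ring.
    have := Hr (z + RtoC y * h); rewrite E cmodM cmod_RtoC => H.
    rewrite /phi -pM -!pB (le_trans (pn _)) //.
    rewrite mulrA in H; rewrite (le_trans (H _)) //.
      rewrite mulrC (le_lt_trans _ ys) // ler_wpM2l // lerDl //.
    rewrite [leLHS]mulrA ler_wpM2r // mulrAC ler_pdivrMr ?ltr_wpDl ?cmod_ge0 //.
    by rewrite ler_wpM2l ?(ltW e0) // lerDl.
  have phi_cts : {within `[(0 : R), 1], continuous phi}.
    apply: derivable_within_continuous => s; rewrite in_itv /= => s01.
    exact: (@ex_derive _ _ _ _ _ _ _ (D s s01)).
  have D' (s : R) : s \in `]0, 1[%R -> is_derive s (1 : R) phi (p (d s * h)).
    by rewrite in_itv /= => /andP[/ltW s0 /ltW s1]; apply: D; rewrite s0.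
  have [c] := MVT_segment ler01 D' phi_cts.
  rewrite in_itv /= => c01; rewrite /phi RtoC1 RtoC0 mul1r mul0r addr0 subr0 mulr1.
  rewrite -pB => ->; rewrite (le_trans (pn _)) // cmodM ler_wpM2r ?cmod_ge0 //.
  exact: dM.
rewrite (le_trans (cmod_le_reim _)) // -mulrA mulr_natl mulr2n lerD // key //.
- exact: ReCB.
- by move=> s a; rewrite !reimE; ring.
- exact: Re_le_cmod.
- exact: ImCB.
- by move=> s a; rewrite !reimE; ring.
- exact: Im_le_cmod.
Qed.

End MeanValue.

(** * The principal logarithm on the slit plane *)

Section ComplexLog.
Variable R : realType.
Local Notation C := (CC R).
Implicit Types (x y e : R) (z w : C).

Lemma ReC_clog z : ReC (clog z) = ln (cmod z).
Proof. by rewrite /clog !reimE; ring. Qed.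

Lemma ImC_clog z : ImC (clog z) = carg z.
Proof. by rewrite /clog !reimE; ring. Qed.

Lemma cos_ratio_bounds z : -1 <= ReC z / cmod z <= 1.
Proof.
rewrite -ler_norml normrM normfV (ger0_norm (cmod_ge0 z)).
have [->|z0] := eqVneq z 0; first by rewrite cmod0 invr0 mulr0.
by rewrite ler_pdivrMr ?cmod_gt0 // mul1r Re_le_cmod.
Qed.

Lemma cexp_clog z : z != 0 -> cexp (clog z) = z.
Proof.
move=> z0; have m0 : 0 < cmod z by rewrite cmod_gt0.
have q1 := cos_ratio_bounds z.
have S : sin (acos (ReC z / cmod z)) = `|ImC z| / cmod z.
  rewrite sin_acos // -[cmod z in RHS]ger0_norm ?ltW // -normf_div -sqrtr_sqr.
  congr Num.sqrt; have := cmod_sqr z => E.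
  have -> : 1 = cmod z ^+ 2 / cmod z ^+ 2 by rewrite mulfV // lt0r_neq0 // exprn_gt0.
  by rewrite [in X in X / _]E; field; rewrite lt0r_neq0.
have K : cos (acos (ReC z / cmod z)) = ReC z / cmod z by apply: acosK; rewrite in_itv.
apply: CC_eqP; rewrite (ReC_cexp, ImC_cexp) ReC_clog ImC_clog lnK ?posrE // /carg.
  by case: ifP => _; rewrite ?cosN K mulrC divfK // lt0r_neq0.
case: ifP => [im|/negbT]; rewrite ?sinN S; last rewrite -ltNge => im.
  by rewrite ger0_norm // mulrC divfK // lt0r_neq0.
by rewrite ltr0_norm // mulNr opprK mulrC divfK // lt0r_neq0.
Qed.

Definition slit z := (0 < ReC z) || (ImC z != 0).

Lemma slit_neq0 z : slit z -> z != 0.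
Proof. by apply: contraTneq => ->; rewrite /slit !reimE ltxx eqxx. Qed.

Lemma cts_eps (f : R -> R) x : {for x, continuous f} -> forall e, 0 < e ->
  exists2 r, 0 < r & forall y, `|y - x| < r -> `|f y - f x| <= e.
Proof.
move=> fx e e0; have /cvgrPdist_le/(_ e e0)/nbhs_ballP[r /= r0 H] := fx.
by exists r => // y yx; rewrite distrC; apply: H; rewrite /ball /= distrC.
Qed.

Lemma cos_ratio_lip z w : z != 0 -> w != 0 ->
  `|ReC w / cmod w - ReC z / cmod z| <= 2 / cmod z * cmod (w - z).
Proof.
rewrite -!cmod_gt0 => z0 w0.
have -> : ReC w / cmod w - ReC z / cmod z
    = (ReC (w - z) + ReC w / cmod w * (cmod z - cmod w)) / cmod z.
  by rewrite ReCB; field; rewrite !lt0r_neq0.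
rewrite normrM normfV (gtr0_norm z0) [leRHS]mulrAC ler_wpM2r ?invr_ge0 ?(ltW z0) //.
rewrite (le_trans (ler_normD _ _)) // mulr_natl mulr2n lerD ?Re_le_cmod //.
rewrite normrM -[leRHS]mul1r ler_pM // ?ler_norml ?cos_ratio_bounds //.
by have := cmod_ge_sub z w; have := cmod_ge_sub w z; rewrite (cmodC z w); lra.
Qed.

(** One-sided continuity at the endpoint 1, read off the monotonicity of cosine; it is needed for
    arguments near the positive real axis. *)
Lemma acos_cts1 e : 0 < e -> exists2 r, 0 < r &
  forall q, -1 <= q <= 1 -> `|q - 1| < r -> acos q <= e.
Proof.
move=> e0; set e' := Num.min e (pi / 2); have pi0 := pi_gt0 R.
have e'0 : 0 < e' by rewrite lt_min e0 /=; lra.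
have e'pi : e' <= pi by rewrite ge_min; apply/orP; right; lra.
have c1 : cos e' < 1 by rewrite -cos0 ltr_cos ?in_itv /= ?lexx ?(ltW e'0) ?(ltW pi0).
exists (1 - cos e'); first by rewrite subr_gt0.
move=> q q1; rewrite ltr_norml => /andP[q2 _].
have a1 := acos_ge0 q1; have a2 := acos_lepi q1.
have : cos e' < cos (acos q) by rewrite acosK ?in_itv //; lra.
rewrite ltr_cos ?in_itv /= ?a1 ?(ltW e'0) // => /ltW/le_trans; apply.
by rewrite ge_min lexx.
Qed.

(** Off the real axis the sign of the imaginary part is locally constant and [acos] is continuous at
    an interior point. On the positive axis the sign may change, but both branches have absolute
    value [acos] of a ratio near 1, which is small. *)
Lemma carg_cts z e : slit z -> 0 < e -> exists2 r, 0 < r &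
  forall w, cmod (w - z) < r -> `|carg w - carg z| <= e.
Proof.
move=> sz e0; have z0 := slit_neq0 sz; have m0 : 0 < cmod z by rewrite cmod_gt0.
have wn0 w : cmod (w - z) < cmod z -> w != 0.
  by apply: contraTneq => ->; rewrite sub0r cmodN ltxx.
have cts : {for ReC z / cmod z, continuous (@acos R)} -> exists2 r, 0 < r &
    forall w, cmod (w - z) < r -> `|acos (ReC w / cmod w) - acos (ReC z / cmod z)| <= e.
  move=> /cts_eps/(_ e e0)[r r0 H].
  exists (Num.min (cmod z) (r * cmod z / 2)).
    by rewrite lt_min m0 divr_gt0 ?mulr_gt0.
  move=> w; rewrite lt_min => /andP[/wn0 w0 wr]; apply: H.
  rewrite (le_lt_trans (cos_ratio_lip z0 w0)) // mulrAC ltr_pdivrMr //; lra.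
have [im0|im0] := eqVneq (ImC z) 0.
  move: sz; rewrite /slit im0 eqxx orbF => re0.
  have q1 : ReC z / cmod z = 1.
    by rewrite cmodE im0 expr0n addr0 sqrtr_sqr gtr0_norm // mulfV // lt0r_neq0.
  have [r r0 H] := acos_cts1 e0.
  exists (Num.min (cmod z) (r * cmod z / 2)).
    by rewrite lt_min m0 divr_gt0 ?mulr_gt0.
  move=> w; rewrite lt_min => /andP[/wn0 w0 wr].
  have -> : carg z = 0 by rewrite /carg im0 lexx q1 acos1.
  rewrite subr0.
  have -> : `|carg w| = acos (ReC w / cmod w).
    by rewrite /carg; case: ifP => _; rewrite ?normrN ger0_norm // acos_ge0 // cos_ratio_bounds.
  apply: H; first exact: cos_ratio_bounds.
  rewrite -q1 (le_lt_trans (cos_ratio_lip z0 w0)) // mulrAC ltr_pdivrMr //; lra.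
have [|r r0 H] := cts.
  apply: continuous_acos; rewrite -ltr_norml normrM normfV (gtr0_norm m0).
  rewrite ltr_pdivrMr // mul1r cmodE -sqrtr_sqr.
  have i0 : 0 < ImC z ^+ 2 by rewrite exprn_even_gt0.
  by rewrite ltr_sqrt ?ltrDl // ltr_wpDl ?sqr_ge0.
exists (Num.min r `|ImC z|); first by rewrite lt_min r0 normr_gt0.
move=> w; rewrite lt_min => /andP[/H wr wi].
have := le_lt_trans (Im_le_cmod (w - z)) wi; rewrite ImCB ltr_norml => /andP[i1 i2].
rewrite /carg; have [z1|z1] := leP 0 (ImC z).
  by rewrite (ger0_norm z1) in i1 i2; have -> : 0 <= ImC w by lra.
rewrite (ltr0_norm z1) in i1 i2; have -> : (0 <= ImC w) = false by apply/negbTE; rewrite -ltNge; lra.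
by rewrite -opprD normrN.
Qed.

Lemma clog_cts z e : slit z -> 0 < e -> exists2 r, 0 < r &
  forall w, cmod (w - z) < r -> cmod (clog w - clog z) <= e.
Proof.
move=> sz e0; have z0 := slit_neq0 sz; have m0 : 0 < cmod z by rewrite cmod_gt0.
have e2 : 0 < e / 2 by lra.
have [r r0 H] := carg_cts sz e2.
have [s s0 Hs] := cts_eps (continuous_ln m0) e2.
exists (Num.min r s); first by rewrite lt_min r0.
move=> w; rewrite lt_min => /andP[/H wr ws].
rewrite (le_trans (cmod_le_reim _)) // ReCB ImCB !ReC_clog !ImC_clog.
have := Hs (cmod w); have : `|cmod w - cmod z| < s.
  rewrite (le_lt_trans _ ws) // ler_norml.
  by have := cmod_ge_sub z w; have := cmod_ge_sub w z; rewrite (cmodC z w); lra.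
move=> h /(_ h); lra.
Qed.

(** The inverse function argument: by continuity of [clog], the derivative of [cexp] at [clog z]
    applies to h = clog w - clog z. Taking the error below |z| / 2 first gives |z| |h| <= 2 |w - z|,
    and then the error term is of the required order. *)
Lemma cdiff_clog z : slit z -> cdiff (@clog R) z z^-1.
Proof.
move=> sz; have z0 := slit_neq0 sz; have m0 : 0 < cmod z by rewrite cmod_gt0.
have wn0 w : cmod (w - z) < cmod z -> w != 0.
  by apply: contraTneq => ->; rewrite sub0r cmodN ltxx.
apply: (@cdiff_scaled _ _ _ _ (2 / cmod z ^+ 2)).
  by rewrite divr_ge0 // exprn_ge0 // ltW.
move=> e e0; set e' := Num.min e (cmod z / 2).
have e'0 : 0 < e' by rewrite lt_min e0 divr_gt0.
have [s s0 Hs] := cdiff_cexp (clog z) e'0.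
have [r r0 Hr] := clog_cts sz (divr_gt0 s0 (ltr0Sn R 1)).
exists (Num.min r (cmod z)); first by rewrite lt_min r0.
move=> w; rewrite lt_min => /andP[/Hr wr /wn0 w0].
have := Hs (clog w); rewrite !cexp_clog // => /(_ _)H.
have {H} : cmod (w - z - z * (clog w - clog z)) <= e' * cmod (clog w - clog z).
  by apply: H; lra.
set h := clog w - clog z => H1.
have H2 : cmod z * cmod h <= 2 * cmod (w - z).
  have : e' * cmod h <= cmod z / 2 * cmod h.
    by rewrite ler_wpM2r ?cmod_ge0 // ge_min lexx orbT.
  have := cmod_ge_sub (z * h) (z * h - (w - z)); rewrite cmodM [X in _ <= cmod X](_ : _ = w - z); last by ring.
  by rewrite (cmodC (z * h)); lra.
have -> : h - z^-1 * (w - z) = - (z^-1 * (w - z - z * h)) by field.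
rewrite cmodN cmodM cmodV mulrC ler_pdivrMr // (le_trans H1) //.
have H3 : e' * cmod h <= e * cmod h by rewrite ler_wpM2r ?cmod_ge0 // ge_min lexx.
rewrite (le_trans H3) //.
have -> : 2 / cmod z ^+ 2 * e * cmod (w - z) * cmod z = e * (2 * cmod (w - z) / cmod z).
  by field; rewrite lt0r_neq0.
by rewrite ler_wpM2l ?(ltW e0) // ler_pdivlMr // mulrC.
Qed.

Lemma slit_inv z : slit z -> slit z^-1.
Proof.
move=> sz; have m0 : 0 < ReC z ^+ 2 + ImC z ^+ 2.
  by rewrite -cmod_sqr exprn_gt0 // cmod_gt0 slit_neq0.
have RE : ReC z^-1 = ReC z / (ReC z ^+ 2 + ImC z ^+ 2) by case: z {sz m0}.
have IM : ImC z^-1 = - (ImC z / (ReC z ^+ 2 + ImC z ^+ 2)) by case: z {sz m0 RE}.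
by rewrite /slit RE IM pmulr_lgt0 ?invr_gt0 // oppr_eq0 mulf_eq0 invr_eq0 (gt_eqF m0) orbF.
Qed.

Lemma slit_scale x z : 0 < x -> slit (RtoC x * z) = slit z.
Proof.
move=> x0; rewrite /slit !reimE !mul0r subr0 addr0 pmulr_rgt0 //.
by rewrite mulf_eq0 (gt_eqF x0).
Qed.

Lemma cdiff_log_sing (r th : R) (t : C) : 0 < r -> slit (RtoC r - t) ->
  cdiff (log_sing r th) t (RtoC th * (RtoC r - t)^-1).
Proof.
move=> r0 st; have rC : RtoC r != 0 :> C by rewrite RtoC_eq0 lt0r_neq0.
have tr : RtoC r - t != 0 := slit_neq0 st.
have zE : 1 - t / RtoC r = RtoC r^-1 * (RtoC r - t) by rewrite RtoCV; field.
have zs : slit (1 - t / RtoC r) by rewrite zE slit_scale // invr_gt0.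
apply: cdiffZ; have z0 := slit_neq0 zs.
have D1 : cdiff (fun t => 1 - t / RtoC r) t (- (RtoC r)^-1).
  have := cdiffB (cdiff_cst 1 t) (cdiffZ (RtoC r)^-1 (cdiff_id t)).
  rewrite sub0r mulr1; congr cdiff; apply/funext => w; rewrite mulrC //.
have D2 := cdiff_comp D1 (cdiff_inv z0).
have D3 := cdiff_comp D2 (cdiff_clog (slit_inv zs)).
have -> : (RtoC r - t)^-1 = (1 - t / RtoC r)^-1^-1 * (- (1 - t / RtoC r)^-1 ^+ 2 * - (RtoC r)^-1).
  by field; rewrite ?rC ?tr.
by move: D3; congr cdiff; apply/funext => w; rewrite mul1r.
Qed.

End ComplexLog.

(** * Taylor expansions at 0 *)

Section Taylor.
Variable R : realType.
Local Notation C := (CC R).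
Implicit Types (f g : C -> C) (c : nat -> C).

(** An asymptotic expansion to every order, with no convergence required. It determines the
    coefficients, is stable under the linear operations needed, and is all that the contour integral
    uses at 0. *)
Definition taylor0 f c := forall n, exists (M r : R), 0 < r /\
  forall t, cmod t < r -> cmod (f t - \sum_(k < n.+1) c k * t ^+ k) <= M * cmod t ^+ n.+1.

Lemma taylor0_eq_near f g c (r : R) : 0 < r -> (forall t, cmod t < r -> f t = g t) ->
  taylor0 f c -> taylor0 g c.
Proof.
move=> r0 fg fc n; have [M [s [s0 H]]] := fc n; exists M, (Num.min r s).
split=> [|t]; first by rewrite lt_min r0.
by rewrite lt_min => /andP[tr /H]; rewrite fg.
Qed.

Lemma taylor0D f g c c' : taylor0 f c -> taylor0 g c' ->
  taylor0 (fun t => f t + g t) (fun k => c k + c' k).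
Proof.
move=> fc gc n; have [M [s [s0 H]]] := fc n; have [M' [s' [s'0 H']]] := gc n.
exists (M + M'), (Num.min s s'); split=> [|t]; first by rewrite lt_min s0.
rewrite lt_min => /andP[/H Ht /H' Ht'].
under eq_bigr => k _ do rewrite mulrDl.
rewrite big_split /= opprD addrACA (le_trans (cmodD _ _)) // mulrDl.
exact: lerD.
Qed.

Lemma taylor0Z f c (a : C) : taylor0 f c -> taylor0 (fun t => a * f t) (fun k => a * c k).
Proof.
move=> fc n; have [M [s [s0 H]]] := fc n.
exists (cmod a * M), s; split=> // t /H Ht.
under eq_bigr => k _ do rewrite -mulrA.
by rewrite -big_distrr -mulrBr cmodM -mulrA ler_wpM2l ?cmod_ge0.
Qed.

Lemma taylor0_cst (a : C) : taylor0 (fun=> a) (fun k => if k == 0%N then a else 0).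
Proof.
move=> n; exists 0, 1; split=> // t _; rewrite mul0r big_ord_recl /= mulr1.
by rewrite big1 ?addr0 ?subrr ?cmod0 // => k _; rewrite mul0r.
Qed.

Lemma taylor0_mulX f c : taylor0 f c ->
  taylor0 (fun t => t * f t) (fun k => if k is k'.+1 then c k' else 0).
Proof.
move=> fc [|n].
  have [M [s [s0 H]]] := fc 0%N; exists (cmod (c 0%N) + `|M| * s), s; split=> // t ts.
  have := H t ts; rewrite !big_ord1 expr0 mulr1 expr1 mul0r subr0 => Ht.
  rewrite cmodM mulrC ler_wpM2r ?cmod_ge0 //.
  have -> : f t = c 0%N + (f t - c 0%N) by ring.
  rewrite (le_trans (cmodD _ _)) // lerD2l (le_trans Ht) //.
  rewrite (@le_trans _ _ (`|M| * cmod t)) //.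
    by rewrite ler_wpM2r ?cmod_ge0 ?ler_norm.
  by rewrite ler_wpM2l // ltW.
have [M [s [s0 H]]] := fc n; exists M, s; split=> // t ts.
rewrite big_ord_recl mul0r add0r.
have -> : \sum_(i < n.+1) c i * t ^+ bump 0 i = t * \sum_(i < n.+1) c i * t ^+ i.
  by rewrite big_distrr; apply: eq_bigr => i _; rewrite /bump /= add1n exprS; ring.
by rewrite -mulrBr cmodM exprS mulrCA ler_wpM2l ?cmod_ge0 // H.
Qed.

Lemma taylor0_unique f c c' : taylor0 f c -> taylor0 f c' -> c =1 c'.
Proof.
move=> fc fc' n; elim/ltn_ind: n => n IHn.
have [M [s [s0 H]]] := fc n; have [M' [s' [s'0 H']]] := fc' n.
apply/eqP; rewrite -subr_eq0 -cmod_eq0 eq_le cmod_ge0 andbT.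
apply/ler_addgt0Pr => e e0; rewrite add0r.
set K := `|M + M'| + 1; have K0 : 0 < K by rewrite ltr_wpDl.
pose x := Num.min (Num.min s s' / 2) (e / K).
have x0 : 0 < x by rewrite lt_min !divr_gt0 // lt_min s0.
have xs : x < Num.min s s'.
  rewrite /x; have : 0 < Num.min s s' by rewrite lt_min s0.
  by move: (Num.min s s') => y y0; rewrite gt_min; apply/orP; left; lra.
have xe : x <= e / K by rewrite ge_min lexx orbT.
move: xs; rewrite lt_min => /andP[xs xs'].
have cx : cmod (RtoC x) = x by rewrite cmod_RtoC gtr0_norm.
have := H (RtoC x); have := H' (RtoC x); rewrite cx => /(_ xs') + /(_ xs).
rewrite !big_ord_recr /= => H1 H2.
have E : \sum_(i < n) c i * RtoC x ^+ i = \sum_(i < n) c' i * RtoC x ^+ i.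
  by apply: eq_bigr => i _; rewrite IHn.
rewrite E in H2; set S := \sum_(i < n) _ in H1 H2.
have : cmod ((c n - c' n) * RtoC x ^+ n) <= (M + M') * x ^+ n.+1.
  have -> : (c n - c' n) * RtoC x ^+ n =
    (f (RtoC x) - (S + c' n * RtoC x ^+ n)) - (f (RtoC x) - (S + c n * RtoC x ^+ n)) by ring.
  by rewrite (le_trans (cmodB _ _)) // mulrDl [leRHS]addrC lerD.
rewrite cmodM cmodX cx exprS mulrA ler_pM2r ?exprn_gt0 // => /le_trans; apply.
have xk : x * K <= e by rewrite -ler_pdivlMr.
rewrite (le_trans _ xk) // mulrC ler_wpM2l ?(ltW x0) // /K.
by have := ler_norm (M + M'); lra.
Qed.

Lemma geom_sum_le (q : R) m : 0 <= q <= 2^-1 -> \sum_(i < m) q ^+ i <= 2.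
Proof.
move=> /andP[q0 q2]; elim: m => [|m IHm]; first by rewrite big_ord0.
rewrite big_ord_recl expr0; under eq_bigr => i _ do rewrite lift0 exprS.
rewrite -big_distrr /=; have : q * \sum_(i < m) q ^+ i <= 2^-1 * 2.
  by rewrite ler_pM // sumr_ge0 // => i _; rewrite exprn_ge0.
by lra.
Qed.

(** Convergence at one point x > 0 bounds |a_k| x^k, so for |t| < x / 2 the tail is dominated by a
    geometric series of ratio at most 1/2. *)
Lemma taylor0_pseries a g : (\forall t \near (0 : C), pseries_cvg a t (g t)) -> taylor0 g a.
Proof.
move=> /near_CCP[r r0 H] n.
have conv t : cmod t < r -> forall e, 0 < e -> exists N, forall m, (N <= m)%N ->
    cmod (g t - \sum_(k < m) a k * t ^+ k) <= e.
  move=> tr e e0; have := H t; rewrite subr0 => /(_ tr) /cvgr_dist_le/(_ (RtoC e)).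
  rewrite ltcR => /(_ e0)[N _ HN]; exists N => m Nm.
  by have := HN m Nm; rewrite /series /= big_mkord normC_cmod lecR.
pose x := r / 2; have x0 : 0 < x by rewrite divr_gt0.
have cx : cmod (RtoC x) = x by rewrite cmod_RtoC gtr0_norm.
have [|N HN] := conv (RtoC x) _ 1 ltr01; first by rewrite cx /x; lra.
(* From N on, consecutive partial sums are both within 1 of the limit, so each term has modulus at
   most 2. *)
pose B := \sum_(k < N) cmod (a k) * x ^+ k + 2.
have aB k : cmod (a k) * x ^+ k <= B.
  have P j : 0 <= cmod (a j) * x ^+ j by rewrite mulr_ge0 ?cmod_ge0 ?exprn_ge0 ?(ltW x0).
  have [kN|kN] := ltnP k N.
    rewrite /B (bigD1 (Ordinal kN)) //= -addrA lerDl addr_ge0 // sumr_ge0 //.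
  have H1 := HN k kN; have := HN k.+1 (leqW kN); rewrite big_ord_recr /= => H2.
  rewrite -[x in x ^+ k]cx -cmodX -cmodM.
  set S := \sum_(i < k) _ in H1 H2.
  have -> : a k * RtoC x ^+ k = (g (RtoC x) - S) - (g (RtoC x) - (S + a k * RtoC x ^+ k)) by ring.
  rewrite (le_trans (cmodB _ _)) // (le_trans (lerD H1 H2)) // /B.
  by rewrite lerDr sumr_ge0.
have B0 : 0 <= B by apply: le_trans (aB 0%N); rewrite mulr_ge0 ?cmod_ge0.
exists (B * 2 / x ^+ n.+1), (x / 2); split=> [|t tx]; first by rewrite divr_gt0.
have q2 : 0 <= cmod t / x <= 2^-1.
  by rewrite divr_ge0 ?cmod_ge0 ?(ltW x0) //= ler_pdivrMr //; lra.
apply/ler_addgt0Pr => e e0; have tr : cmod t < r by rewrite /x in tx; lra.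
have [N' HN'] := conv t tr e e0.
have := HN' (n.+1 + N')%N (leq_addl _ _); rewrite big_split_ord /= => H1.
set S := \sum_(i < n.+1) _ in H1 *; set S' := \sum_(i < N') _ in H1.
have -> : g t - S = (g t - (S + S')) + S' by ring.
rewrite (le_trans (cmodD _ _)) // [leRHS]addrC lerD // /S' (le_trans (cmod_sum _ _ _)) //.
apply: (@le_trans _ _ (\sum_(i < N') B * (cmod t / x) ^+ n.+1 * (cmod t / x) ^+ i)).
  apply: ler_sum => i _; rewrite cmodM cmodX -mulrA -exprD expr_div_n mulrA mulrAC.
  rewrite ler_wpM2r ?exprn_ge0 ?cmod_ge0 // ler_pdivlMr ?exprn_gt0 //.
rewrite -big_distrr expr_div_n /=.
have -> : B * 2 / x ^+ n.+1 * cmod t ^+ n.+1 = B * (cmod t ^+ n.+1 / x ^+ n.+1) * 2 by ring.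
rewrite ler_wpM2l ?geom_sum_le // !mulr_ge0 ?exprn_ge0 ?cmod_ge0 ?invr_ge0 //.
by rewrite exprn_ge0 ?(ltW x0).
Qed.

Definition log_coef (r th : R) k : C := if k == 0%N then 0 else RtoC (th / (k%:R * r ^+ k)).

Lemma clog1 : clog (1 : C) = 0.
Proof.
apply: CC_eqP; rewrite ?ReC_clog ?ImC_clog ?cmod1 ?ln1 //.
by rewrite /carg ImC1 lexx cmod1 ReC1 divr1 acos1.
Qed.

(** The remainder vanishes at 0, and its derivative is th (w / r)^n / (r - w) by the finite
    geometric sum; the mean value inequality gives one more power of t. *)
Lemma taylor0_log_sing (r th : R) : 0 < r -> taylor0 (log_sing r th) (log_coef r th).
Proof.
move=> r0 n; set K := `|th| / r ^+ n * (2 / r).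
have rC : RtoC r != 0 :> C by rewrite RtoC_eq0 lt0r_neq0.
exists (2 * K), (r / 2); split=> [|t tr]; first by rewrite divr_gt0.
pose D w := log_sing r th w - \sum_(k < n.+1) log_coef r th k * w ^+ k.
pose d w := RtoC th * (RtoC r - w)^-1
  - \sum_(k < n.+1) log_coef r th k * (k%:R * w ^+ k.-1).
have small (s : R) : 0 <= s <= 1 -> cmod (RtoC s * t) <= cmod t.
  by move=> /andP[s0 s1]; rewrite cmodM cmod_RtoC ger0_norm // ler_piMl ?cmod_ge0.
have rt w : cmod w <= cmod t -> r / 2 <= cmod (RtoC r - w) /\ slit (RtoC r - w).
  move=> wt; split.
    by have := cmod_ge_sub (RtoC r) w; rewrite cmod_RtoC gtr0_norm //; lra.
  by rewrite /slit ReCB ReC_RtoC; have := Re_le_cmod w; rewrite ler_norml => /andP[_ H]; apply/orP; left; lra.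
have dE w : cmod w <= cmod t -> d w = RtoC th / RtoC r ^+ n * w ^+ n * (RtoC r - w)^-1.
  move=> wt; have [_ /slit_neq0 rw] := rt w wt.
  rewrite /d big_ord_recl mul0r add0r; under eq_bigr => i _ do rewrite lift0.
  have -> : \sum_(i < n) log_coef r th i.+1 * (i.+1%:R * w ^+ i.+1.-1)
      = RtoC th / RtoC r * \sum_(i < n) (w / RtoC r) ^+ i.
    rewrite big_distrr; apply: eq_bigr => i _; rewrite /log_coef /=.
    rewrite RtoCM RtoCV RtoCM RtoC_nat RtoCX expr_div_n exprS; field.
    by rewrite expf_neq0 rC // nat1r pnatr_eq0.
  have w1 : w / RtoC r - 1 != 0.
    have -> : w / RtoC r - 1 = - (RtoC r - w) / RtoC r by field.
    by rewrite mulf_neq0 ?oppr_eq0 ?invr_eq0.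
  have -> : \sum_(i < n) (w / RtoC r) ^+ i = ((w / RtoC r) ^+ n - 1) / (w / RtoC r - 1).
    by rewrite subrX1 [RHS]mulrC mulKf.
  rewrite expr_div_n; field; rewrite rC rw expf_neq0 //=.
  by rewrite mulN1r -oppr_eq0 opprB.
have := @cdiff_mean_value R D (fun s => d (0 + RtoC s * t)) 0 t (K * cmod t ^+ n).
rewrite add0r; have -> : D 0 = 0.
  rewrite /D big_ord_recl /= mul0r add0r big1 ?subr0.
    by rewrite /log_sing mul0r subr0 divr1 clog1 mulr0.
  by move=> i _; rewrite exprS mul0r mulr0.
rewrite subr0 => H; rewrite (le_trans (H _ _)) //.
- move=> s s01; rewrite add0r; have [_ sl] := rt _ (small s s01).
  apply: cdiffB; first exact: cdiff_log_sing.
  by apply: cdiff_sum => k; apply: cdiffZ; exact: cdiffX.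
- move=> s s01; rewrite add0r; move: (small s s01); move: (RtoC s * t) => w wt.
  rewrite dE //; have [r2 _] := rt _ wt.
  rewrite !(cmodM, cmodV, cmodX, cmod_RtoC) (gtr0_norm r0) /K.
  have -> : `|th| / r ^+ n * (2 / r) * cmod t ^+ n = `|th| / r ^+ n * cmod t ^+ n * (2 / r) by ring.
  have rn : 0 <= r ^+ n by rewrite exprn_ge0 // ltW.
  apply: ler_pM; rewrite ?mulr_ge0 ?invr_ge0 ?exprn_ge0 ?cmod_ge0 ?(ltW r0) //.
    by rewrite ler_wpM2l ?divr_ge0 // lerXn2r ?nnegrE ?cmod_ge0.
  by rewrite -[2 / r]invf_div lef_pV2 ?posrE ?divr_gt0 // (lt_le_trans _ r2) // divr_gt0.
- by rewrite exprSr -!mulrA.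
Qed.

End Taylor.

(** * Rates for the characteristic functions *)

Section PolynomialExp.
Variable R : realType.
Local Notation C := (CC R).
Variables (q : fps C) (b : nat).
Hypothesis q0 : q 0%N = 0.
Hypothesis q_supp : forall k, (b < k)%N -> q k = 0.

Let pi_ := fps_exp q.

Lemma sum_ord_supp_le (F : nat -> R) m :
  (forall j, 0 <= F j) -> (forall j, (b <= j)%N -> F j = 0) ->
  \sum_(j < m) F j <= \sum_(j < b) F j.
Proof.
move=> F0 Fb; apply: (@le_trans _ _ (\sum_(j < m + b) F j)).
  by rewrite big_split_ord /= lerDl sumr_ge0.
by rewrite addnC big_split_ord /= gerDl big1 // => j _; rewrite Fb ?leq_addr.
Qed.

Lemma fps_exp_coef_conv (X : R) j : 0 < X ->
  \sum_(m < j.+1) cmod (m.+1%:R * q m.+1) * X ^+ m * (cmod (pi_ (j - m)%N) * X ^+ (j - m))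
  = (\sum_(m < j.+1) cmod (m.+1%:R * q m.+1) * cmod (pi_ (j - m)%N)) * X ^+ j.
Proof.
move=> X0; rewrite big_distrl; apply: eq_bigr => m _ /=.
have mj : (m <= j)%N by rewrite -ltnS.
have -> : X ^+ j = X ^+ m * X ^+ (j - m) by rewrite -exprD subnKC.
ring.
Qed.

(** Every radius X is allowed, as the exponential of a polynomial is entire. The recursion gives
    (k+1) |pi_(k+1)| X^(k+1) <= S K with S fixed, so the bound K propagates as soon as k + 1 >= S; K
    collects the earlier terms. *)
Lemma fps_exp_coef_le (X : R) : 0 < X ->
  exists2 K, 0 <= K & forall k, cmod (pi_ k) * X ^+ k <= K.
Proof.
move=> X0; pose F j := cmod (j.+1%:R * q j.+1) * X ^+ j.
have F0 j : 0 <= F j by rewrite mulr_ge0 ?cmod_ge0 ?exprn_ge0 ?(ltW X0).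
pose S := (\sum_(j < b) F j) * X.
have S0 : 0 <= S by rewrite mulr_ge0 ?(ltW X0) // sumr_ge0.
have [k0 Sk] : exists k0 : nat, S <= k0%:R.
  by exists (Num.truncn S).+1; apply/ltW; rewrite truncnS_gt.
have P k : 0 <= cmod (pi_ k) * X ^+ k by rewrite mulr_ge0 ?cmod_ge0 ?exprn_ge0 ?(ltW X0).
exists (\sum_(k < k0.+1) cmod (pi_ k) * X ^+ k); first by rewrite sumr_ge0.
set K := \sum_(k < k0.+1) _; have K0 : 0 <= K by rewrite sumr_ge0.
move=> k; elim/ltn_ind: k => k IHk; have [kk|kk] := ltnP k k0.+1.
  by rewrite /K (bigD1 (Ordinal kk)) //= lerDl sumr_ge0.
case: k IHk kk => // k IHk kk.
have k1 : (0 : R) < k.+1%:R by rewrite ltr0n.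
rewrite -(ler_pM2l k1).
have H : k.+1%:R * (cmod (pi_ k.+1) * X ^+ k.+1)
    <= (\sum_(m < k.+1) F m * (cmod (pi_ (k - m)%N) * X ^+ (k - m))) * X.
  rewrite fps_exp_coef_conv // exprSr !mulrA !ler_wpM2r ?exprn_ge0 ?(ltW X0) //.
  rewrite -[k.+1%:R]ger0_norm // -cmod_RtoC RtoC_nat -cmodM fps_exp_rec //.
  rewrite (le_trans (cmod_sum _ _ _)) // ler_sum // => m _.
  by rewrite cmodM.
apply: (le_trans H); apply: (@le_trans _ _ (S * K)).
  rewrite /S -mulrA [X * K]mulrC mulrA ler_wpM2r ?(ltW X0) //.
  apply: (@le_trans _ _ ((\sum_(m < k.+1) F m) * K)).
    rewrite big_distrl /= ler_sum // => m _; rewrite ler_wpM2l // IHk //.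
    by rewrite ltnS leq_subr.
  rewrite ler_wpM2r // sum_ord_supp_le // => j bj.
  by rewrite /F q_supp // mulr0 cmod0 mul0r.
rewrite ler_wpM2r // (le_trans Sk) // ler_nat; exact: ltnW.
Qed.

Lemma cdiff_horner (p : {poly C}) (z : C) : cdiff (horner p) z (p^`()).[z].
Proof.
elim/poly_ind: p => [|p c IHp].
  rewrite deriv0 horner0; have -> : horner (0 : {poly C}) = fun=> 0.
    by apply/funext => w; rewrite horner0.
  exact: cdiff_cst.
have -> : horner (p * 'X + c%:P) = fun w => p.[w] * w + c.
  by apply/funext => w; rewrite !hornerE.
have := cdiffD (cdiffM IHp (cdiff_id z)) (cdiff_cst c z).
by congr cdiff; rewrite derivD derivM derivX derivC !hornerE.
Qed.

Variable r : R.
Hypothesis r0 : 0 < r.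

(** The truncation f almost solves f' = Q' f: the defect E has only the degrees n, ..., n + b, and
    the coefficient bound at radius 2 r makes it O(2^-n) on |w| <= r. Then f e^(-Q), with derivative
    E e^(-Q), stays close to its value 1 at 0. *)
Lemma fps_exp_partial_sum : exists2 K, 0 <= K & forall n,
  cmod (\sum_(k < n.+1) pi_ k * RtoC r ^+ k - cexp (\sum_(m < b.+1) q m * RtoC r ^+ m))
    <= K / 2 ^+ n.
Proof.
have X0 : 0 < 2 * r by rewrite mulr_gt0.
have [K K0 HK] := fps_exp_coef_le X0.
pose Q : {poly C} := \poly_(m < b.+1) q m.
pose S := \sum_(m < b) cmod (m.+1%:R * q m.+1) * (2 * r) ^+ m.
have S0 : 0 <= S by rewrite sumr_ge0 // => m _; rewrite mulr_ge0 ?cmod_ge0 ?exprn_ge0 ?(ltW X0).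
have QE m : Q^`()`_m = m.+1%:R * q m.+1.
  rewrite coef_deriv coef_poly mulr_natl; case: ltnP => // bm.
  by rewrite q_supp ?mulr0n ?mul0rn.
pose W := expR (\sum_(m < b.+1) cmod (q m) * r ^+ m).
have W0 : 0 <= W by rewrite expR_ge0.
exists (W * (2 * ((b.+1%:R * (S * K)) * W) * r)).
  by rewrite !mulr_ge0 ?(ltW r0).
move=> n; pose f : {poly C} := \poly_(k < n.+1) pi_ k.
pose E := f^`() - Q^`() * f.
have EE j : (j < n)%N -> E`_j = 0.
  move=> jn; rewrite coefB coef_deriv coef_poly ltnS jn -[X in X - _]mulr_natl fps_exp_rec //.
  rewrite coefM -sumrB big1 // => m _; rewrite QE coef_poly.
  have -> : (j - m < n.+1)%N by lia.
  by rewrite subrr.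
have Ele j : (n <= j)%N -> cmod E`_j * r ^+ j <= S * K / 2 ^+ n.
  move=> nj; have -> : E`_j = - (Q^`() * f)`_j.
    by rewrite coefB coef_deriv coef_poly ltnS ltnNge nj /= mul0rn sub0r.
  rewrite cmodN coefM.
  apply: (@le_trans _ _ (S * K / 2 ^+ j)); last first.
    rewrite ler_wpM2l ?mulr_ge0 // lef_pV2 ?posrE ?exprn_gt0 //.
    by rewrite ler_weXn2l // ler1n.
  rewrite ler_pdivlMr ?exprn_gt0 // -mulrA -exprMn [r * 2]mulrC.
  apply: (@le_trans _ _ ((\sum_(m < j.+1) cmod (m.+1%:R * q m.+1) * cmod (pi_ (j - m)%N)) * (2 * r) ^+ j)).
    rewrite ler_wpM2r ?exprn_ge0 ?(ltW X0) // (le_trans (cmod_sum _ _ _)) // ler_sum // => m _.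
    rewrite QE cmodM ler_wpM2l ?cmod_ge0 // coef_poly; case: ifP => // _.
    by rewrite cmod0 cmod_ge0.
  rewrite -fps_exp_coef_conv //.
  apply: (@le_trans _ _ ((\sum_(m < j.+1) cmod (m.+1%:R * q m.+1) * (2 * r) ^+ m) * K)).
    rewrite big_distrl /= ler_sum // => m _; rewrite ler_wpM2l ?HK //.
    by rewrite mulr_ge0 ?cmod_ge0 ?exprn_ge0 ?(ltW X0).
  rewrite ler_wpM2r // (sum_ord_supp_le (F := fun m => cmod (m.+1%:R * q m.+1) * (2 * r) ^+ m)) //.
    by move=> i; rewrite mulr_ge0 ?cmod_ge0 ?exprn_ge0 ?(ltW X0).
  by move=> i bi; rewrite q_supp // mulr0 cmod0 mul0r.
have Esize : (size E <= n + b.+1)%N.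
  apply/leq_sizeP => j nj; rewrite coefB coef_deriv coef_poly coefM big1.
    have -> : (j.+1 < n.+1)%N = false by lia.
    by rewrite mul0rn subr0.
  move=> m _; rewrite QE coef_poly; have [mb|mb] := ltnP m b.
    have -> : (j - m < n.+1)%N = false by lia.
    by rewrite mulr0.
  by rewrite q_supp // mulr0 mul0r.
have Ehorner w : cmod w <= r -> cmod E.[w] <= b.+1%:R * (S * K) / 2 ^+ n.
  move=> wr; rewrite (horner_coef_wide _ Esize) big_split_ord /= big1 ?add0r; last first.
    by move=> i _; rewrite EE // mul0r.
  rewrite (le_trans (cmod_sum _ _ _)) //.
  apply: (@le_trans _ _ (\sum_(i < b.+1) S * K / 2 ^+ n)).
    apply: ler_sum => i _; rewrite cmodM cmodX (le_trans _ (Ele (n + i)%N _)) ?leq_addr //.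
    by rewrite ler_wpM2l ?cmod_ge0 // lerXn2r ?nnegrE ?cmod_ge0 ?(ltW r0).
  have -> : b.+1%:R * (S * K) / 2 ^+ n = (S * K / 2 ^+ n) *+ b.+1 by rewrite -[RHS]mulr_natl; ring.
  by rewrite sumr_const card_ord.
pose F w := f.[w] * cexp (- Q.[w]).
have FD w : cdiff F w (E.[w] * cexp (- Q.[w])).
  have D := cdiff_comp (cdiffN (cdiff_horner Q w)) (cdiff_cexp (- Q.[w])).
  have := cdiffM (cdiff_horner f w) D.
  by congr cdiff; rewrite /E hornerD hornerN hornerM; ring.
have Wle w : cmod w <= r -> expR (cmod Q.[w]) <= W.
  move=> wr; rewrite ler_expR (horner_coef_wide _ (size_poly _ _)).
  rewrite (le_trans (cmod_sum _ _ _)) // ler_sum // => m _.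
  rewrite cmodM cmodX coef_poly ltn_ord ler_wpM2l ?cmod_ge0 //.
  by rewrite lerXn2r ?nnegrE ?cmod_ge0 ?(ltW r0).
have expRe (w : C) : cmod (cexp w) <= expR (cmod w).
  by rewrite cmod_cexp ler_expR (le_trans (ler_norm _)) // Re_le_cmod.
have cr : cmod (RtoC r) = r by rewrite cmod_RtoC gtr0_norm.
have MV : cmod (F (RtoC r) - F 0) <= 2 * (b.+1%:R * (S * K) / 2 ^+ n * W) * r.
  rewrite -[X in F X - _]add0r -[X in _ * X]cr.
  pose d (s : R) := E.[0 + RtoC s * RtoC r] * cexp (- Q.[0 + RtoC s * RtoC r]).
  apply: (@cdiff_mean_value R F d) => s s01; first exact: FD.
  rewrite /d add0r; have sr : cmod (RtoC s * RtoC r) <= r.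
    move: s01 => /andP[s0 s1].
    by rewrite cmodM cr cmod_RtoC ger0_norm // ler_piMl // ltW.
  rewrite cmodM ler_pM ?cmod_ge0 ?Ehorner // (le_trans (expRe _)) // cmodN Wle //.
have F0 : F 0 = 1.
  rewrite /F !horner_coef0 !coef_poly /= q0 oppr0 cexp0 mulr1; exact: fps_exp0.
have fE : \sum_(k < n.+1) pi_ k * RtoC r ^+ k = f.[RtoC r].
  rewrite (horner_coef_wide _ (size_poly _ _)); apply: eq_bigr => k _.
  by rewrite coef_poly ltn_ord.
have QrE : \sum_(m < b.+1) q m * RtoC r ^+ m = Q.[RtoC r].
  rewrite (horner_coef_wide _ (size_poly _ _)); apply: eq_bigr => k _.
  by rewrite coef_poly ltn_ord.
have -> : \sum_(k < n.+1) pi_ k * RtoC r ^+ k - cexp (\sum_(m < b.+1) q m * RtoC r ^+ m)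
    = cexp Q.[RtoC r] * (F (RtoC r) - F 0).
  rewrite fE QrE F0 /F cexpN mulrBr mulr1 mulrCA mulfV ?cexp_neq0 // mulr1 //.
rewrite cmodM -[leRHS]mulrA ler_pM ?cmod_ge0 //.
  by rewrite (le_trans (expRe _)) //; apply: Wle; rewrite cr.
apply: (le_trans MV); rewrite le_eqVlt; apply/orP; left; apply/eqP; ring.
Qed.

End PolynomialExp.

(** * The rates n^gamma satisfy the conditions of the abstract recursion *)

Section PowerRate.
Variables (R : realType) (g : R).
Hypotheses (g0 : 0 < g) (g1 : g <= 1).

Let p (n : nat) : R := n%:R `^ g.

Lemma rate_gt0 k : 0 < p k.+1.
Proof. by rewrite powR_gt0 // ltr0n. Qed.

Lemma rate_ge1 k : 1 <= p k.+1.
Proof.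
apply: (@le_trans _ _ (1 `^ g)); first by rewrite powR1.
by rewrite ge0_ler_powR ?nnegrE ?(ltW g0) // ler1n. Qed.

Lemma rate_le n : p n.+1 <= n.+1%:R.
Proof. by rewrite -[leRHS]powRr1 // ler_powR // ler1n. Qed.

Lemma rate_ratio k n : (0 < k <= n)%N -> k%:R / p k <= n%:R / p n.
Proof.
move=> /andP[k0 kn].
have E (m : nat) : (0 < m)%N -> m%:R / p m = m%:R `^ (1 - g).
  by move=> m0; rewrite powRB ?powRr1 // pnatr_eq0 -lt0n m0 implybT.
rewrite !E ?(leq_trans k0) // ge0_ler_powR ?nnegrE ?subr_ge0 //.
by rewrite ler_nat.
Qed.

Lemma rate_double k n : (0 < n <= k.*2)%N -> p n <= 2 * p k.
Proof.
move=> /andP[_ nk]; apply: (@le_trans _ _ ((2 * k%:R) `^ g)).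
  by rewrite ge0_ler_powR ?nnegrE ?(ltW g0) ?mulr_ge0 // -natrM ler_nat mul2n.
rewrite powRM // ler_wpM2r ?powR_ge0 //.
by rewrite -[leRHS]powRr1 // ler_powR // ler1n.
Qed.

(** With y = n^(g/2) one has ln n = (2/g) ln y <= (2/g) y and n^g = y^2, so it suffices that y >= 2
    / (g e); [T] is the corresponding n. *)
Lemma log_rate_small (e : R) : 0 < e ->
  exists N, forall n, (N <= n)%N -> ln (n%:R : R) / p n <= e.
Proof.
move=> e0; pose T := (2 / g / e) `^ (2 / g).
have T0 : 0 < 2 / g / e by rewrite !divr_gt0.
exists (maxn 1 (Num.truncn T).+1) => n; rewrite geq_max => /andP[n0 nT].
have nR : (0 : R) < n%:R by rewrite ltr0n.
have Tn : T <= n%:R.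
  by apply: ltW; apply: (lt_le_trans (truncnS_gt T)); rewrite ler_nat.
set y := n%:R `^ (g / 2); have y0 : 0 < y by rewrite powR_gt0.
have g2 : 0 <= g / 2 by rewrite divr_ge0 // ltW.
have Ty : 2 / g / e <= y.
  have -> : 2 / g / e = T `^ (g / 2).
    rewrite -powRrM; have -> : 2 / g * (g / 2) = 1 by field; rewrite lt0r_neq0.
    by rewrite powRr1 // ltW.
  by rewrite ge0_ler_powR ?nnegrE ?powR_ge0.
have -> : p n = y * y.
  by rewrite -powRD ?(gt_eqF nR) ?implybT // -splitr.
have lny : g / 2 * ln n%:R <= y by rewrite -ln_powR ltW // ln_sublinear.
rewrite ler_pdivrMr ?mulr_gt0 //.
have H1 : 2 / g <= e * y by rewrite [leRHS]mulrC -ler_pdivrMr.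
have -> : ln (n%:R : R) = 2 / g * (g / 2 * ln n%:R) by field; rewrite lt0r_neq0.
by rewrite [leRHS]mulrA ler_pM ?mulr_ge0 ?divr_ge0 ?invr_ge0 ?(ltW g0) // ln_ge0 // ler1n.
Qed.

End PowerRate.

(** * From slow variation of the normalizations to the characteristic function *)

Section Limit.
Variables (R : realType) (Theta : nat -> R).
Local Notation C := (CC R).
Hypothesis Theta_ge0 : forall m : nat, (0 < m)%N -> 0 <= Theta m.
Variables (b : nat) (s : nat -> R) (r : R).
Hypothesis r0 : 0 < r.

Let u n := hnorm Theta n * r ^+ n.
Let al k := Theta k * r ^+ k.

Lemma hnorm_rec n : n.+1%:R * hnorm Theta n.+1
  = \sum_(k < n.+1) Theta k.+1 * hnorm Theta (n - k).
Proof.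
apply: RtoC_inj.  rewrite RtoCM RtoC_nat hnorm_gf /GTheta fps_exp_rec //.
rewrite RtoC_sum; apply: eq_bigr => k _.
rewrite RtoCM hnorm_gf /gTheta /= -RtoC_nat -RtoCM; congr (RtoC _ * _).
by rewrite mulrCA mulfV ?mulr1 // pnatr_eq0.
Qed.

Lemma scaled_rec n : n.+1%:R * u n.+1 = \sum_(k < n.+1) al k.+1 * u (n - k)%N.
Proof.
rewrite /u mulrA hnorm_rec big_distrl; apply: eq_bigr => k _ /=.
have kn : (k <= n)%N by rewrite -ltnS.
have -> : r ^+ n.+1 = r ^+ k.+1 * r ^+ (n - k) by rewrite -exprD addSn subnKC.
by rewrite /al; ring.
Qed.

Lemma scaled0 : u 0%N = 1.
Proof.
rewrite /u expr0 mulr1; apply: RtoC_inj.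
by rewrite hnorm_gf /GTheta fps_exp0.
Qed.

Lemma sum_sqr_geom_le n : \sum_(k < n) (k%:R ^+ 2 / 4 ^+ k : R) <= 4.
Proof.
suff : \sum_(k < n) (k%:R ^+ 2 / 4 ^+ k : R) <= 4 - 4 / 2 ^+ n.
  by move=> H; apply: (le_trans H); rewrite gerBl divr_ge0 // exprn_ge0.
elim: n => [|n IHn]; first by rewrite big_ord0 expr0 divr1 subrr.
rewrite big_ord_recr /= (le_trans (lerD IHn (lexx _))) //.
have P2 : (0 : R) < 2 ^+ n by rewrite exprn_gt0.
have sq : n%:R ^+ 2 <= 2 * 2 ^+ n :> R.
  rewrite -!natrX -natrM ler_nat; elim: n {IHn P2} => // -[|[|[|n]]] // IHn.
  by rewrite [(2 ^ n.+4)%N]expnS; move: (2 ^ n.+3)%N IHn => x; nia.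
have -> : 4 ^+ n = 2 ^+ n * 2 ^+ n :> R by rewrite -exprMn -natrM.
rewrite [2 ^+ n.+1]exprS; move: (2 ^+ n) P2 sq => x x0 sq.
have -> : 4 - 4 / (2 * x) = 4 - 4 / x + 2 / x by field; rewrite lt0r_neq0.
rewrite lerD2l ler_pdivrMr ?mulr_gt0 //.
have -> : 2 / x * (x * x) = 2 * x by field; rewrite lt0r_neq0.
exact: sq.
Qed.

Lemma shift_supp k : (b < k)%N -> shift_fps Theta b s k = 0.
Proof. by move=> bk; rewrite /shift_fps [(k <= b)%N]leqNgt bk andbF. Qed.

Lemma char_limitE : char_limit Theta b s r
  = cexp (\sum_(m < b.+1) shift_fps Theta b s m * RtoC r ^+ m).
Proof.
rewrite /char_limit big_ord_recl mul0r add0r big_add1 big_mkord.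
by congr cexp; apply: eq_bigr => m _; rewrite lift0 /shift_fps ltn_ord.
Qed.

(** The characteristic function is the sum of pi_k r^k u_(n-k) / u_n. Replacing the ratios by 1
    costs O(e_n), and completing the partial sum of pi_k r^k to the exponential costs O(2^-n), hence
    O(1/n). *)
Lemma char_fun_cvg (e : nat -> R) (D C4 : R) (N : nat) : 0 <= D ->
  (forall n, (N <= n)%N -> 0 < u n) ->
  (forall n, (N <= n)%N -> n%:R^-1 <= C4 * e n) ->
  (forall n k, (N <= n)%N -> (k <= n)%N ->
    `|u (n - k)%N - u n| <= D * k%:R ^+ 2 * e n * u n) ->
  exists M : R, \forall n \near \oo,
    cmod (char_fun Theta b s n - char_limit Theta b s r) <= M * e n.
Proof.
move=> D0 u0 e1 uD.
(* At radius 4 r the coefficients satisfy |pi_k| r^k <= K / 4^k, which absorbs the factor k^2 of the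
   slow variation. *)
have [K K0 HK] := @fps_exp_coef_le R (shift_fps Theta b s) b (erefl _) shift_supp (4 * r) (mulr_gt0 (ltr0Sn _ 3) r0).
have [K' K'0 HK'] := @fps_exp_partial_sum R (shift_fps Theta b s) b (erefl _) shift_supp r r0.
pose pi_ := fps_exp (shift_fps Theta b s).
exists (4 * D * K + K' * C4); exists (maxn 1 N) => // n /=.
rewrite geq_max => /andP[n1 nN].
have un := u0 n nN; have en := e1 n nN.
have h0 : hnorm Theta n != 0.
  by apply/eqP => h0; move: un; rewrite /u h0 mul0r ltxx.
have uC : RtoC (u n) != 0 :> C by rewrite RtoC_eq0 lt0r_neq0.
have charE : char_fun Theta b s n
    = \sum_(k < n.+1) pi_ k * RtoC r ^+ k * RtoC (u (n - k)%N / u n).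
  have hC : RtoC (hnorm Theta n) != 0 :> C by rewrite RtoC_eq0.
  apply: (mulfI hC); rewrite char_fun_gf // /fps_mul big_distrr; apply: eq_bigr => k _ /=.
  rewrite -hnorm_gf -/(pi_ k).
  have -> : RtoC (hnorm Theta (n - k)) = RtoC (hnorm Theta n) * RtoC r ^+ k * RtoC (u (n - k)%N / u n).
    rewrite -RtoCX -!RtoCM; congr RtoC; rewrite /u.
    have kn : (k <= n)%N by rewrite -ltnS.
    have -> : r ^+ n = r ^+ k * r ^+ (n - k) by rewrite -exprD subnKC.
    by field; rewrite h0 !expf_neq0 // lt0r_neq0.
  by ring.
pose S := \sum_(k < n.+1) pi_ k * RtoC r ^+ k.
have -> : char_fun Theta b s n - char_limit Theta b s r
    = (char_fun Theta b s n - S) + (S - char_limit Theta b s r) by ring.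
rewrite (le_trans (cmodD _ _)) // mulrDl lerD //; last first.
  rewrite char_limitE (le_trans (HK' n)) // -mulrA ler_wpM2l // (le_trans _ en) //.
  rewrite lef_pV2 ?posrE ?exprn_gt0 ?ltr0n // -natrX ler_nat ltnW // ltn_expl //.
rewrite charE -sumrB (le_trans (cmod_sum _ _ _)) //.
apply: (@le_trans _ _ (\sum_(k < n.+1) D * K * e n * (k%:R ^+ 2 / 4 ^+ k))).
  apply: ler_sum => k _; have kn : (k <= n)%N by rewrite -ltnS.
  have -> : pi_ k * RtoC r ^+ k * RtoC (u (n - k)%N / u n) - pi_ k * RtoC r ^+ k
      = pi_ k * RtoC r ^+ k * RtoC ((u (n - k)%N - u n) / u n).
    by rewrite mulrBl mulfV ?lt0r_neq0 // RtoCB RtoC1; ring.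
  rewrite !cmodM cmodX !cmod_RtoC (gtr0_norm r0) normrM normfV (gtr0_norm un).
  have -> : D * K * e n * (k%:R ^+ 2 / 4 ^+ k) = K / 4 ^+ k * (D * k%:R ^+ 2 * e n) by ring.
  apply: ler_pM; rewrite ?mulr_ge0 ?cmod_ge0 ?exprn_ge0 ?invr_ge0 ?(ltW r0) ?(ltW un) //.
    rewrite ler_pdivlMr ?exprn_gt0 // -mulrA -exprMn [r * 4]mulrC.
    exact: HK.
  by rewrite ler_pdivrMr // uD.
rewrite -big_distrr /=.
(* The sign of [e n] is not assumed; the slow variation bound at k = 1, between non-negative sides,
   gives D e_n >= 0. *)
have en0 : 0 <= D * K * e n.
  have [//|k1] := leP 1%N n; last by lia.
  have := uD n 1%N nN n1.
  have := normr_ge0 (u (n - 1)%N - u n) => H1 /(le_trans H1).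
  rewrite expr1n mulr1 pmulr_lge0 // => De.
  by rewrite mulrAC mulr_ge0.
have -> : 4 * D * K * e n = D * K * e n * 4 by ring.
by rewrite ler_wpM2l // sum_sqr_geom_le.
Qed.

End Limit.

Section CoefficientCriteria.
Variables (R : realType) (Theta : nat -> R).
Hypothesis Theta_ge0 : forall m : nat, (0 < m)%N -> 0 <= Theta m.
Variables (b : nat) (s : nat -> R) (r th g M : R).
Hypotheses (r0 : 0 < r) (th0 : 0 < th) (g0 : 0 < g) (g1 : g <= 1).
Hypothesis coef_cvg :
  forall k, `|Theta k.+1 * r ^+ k.+1 - th| <= M / k.+1%:R `^ g.

Let u n := hnorm Theta n * r ^+ n.
Let al k := Theta k * r ^+ k.

Let al_ge0 k : 0 <= al k.+1.
Proof. by rewrite mulr_ge0 ?Theta_ge0 // exprn_ge0 // ltW. Qed.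

Let u_ge0' n : 0 <= u n.
Proof. exact: (u_ge0 (scaled0 Theta r) al_ge0 (scaled_rec Theta r)). Qed.

Let M0 : 0 <= M.
Proof.
have := le_trans (normr_ge0 _) (coef_cvg 0).
by rewrite pmulr_lge0 // invr_gt0 rate_gt0.
Qed.

Let al_le k : al k.+1 <= th + M.
Proof.
have := coef_cvg k; rewrite -/(al k.+1) ler_norml => /andP[_ H].
have : M / k.+1%:R `^ g <= M by rewrite ler_pdivrMr ?rate_gt0 // ler_peMr // rate_ge1.
by lra.
Qed.

(** Common to both classes: only the one-step bound must hold at the final rate [e]. The positivity
    and comparability of u come from the convergence of the weights at the power rate [g]. *)
Lemma char_fun_rate (e : nat -> R) (C1 : R) (N1 : nat) : 0 <= C1 ->
  (forall n, (N1 <= n)%N -> `|u n.+1 - u n| <= C1 * e n.+1 * u n.+1) ->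
  (forall m n, (2 <= m)%N -> (m <= n <= m.*2)%N -> e m <= 2 * e n) ->
  (forall n, (2 <= n)%N -> 0 <= e n /\ n%:R^-1 <= 2 * e n) ->
  (fun n => char_fun Theta b s n - char_limit Theta b s r) =O_\oo (fun n => RtoC (e n)).
Proof.
move=> C10 H1 e2 e0; apply/eqO_cmodP.
have [C2 [N2 [C20 H2]]] := u_half_le (scaled0 Theta r) al_ge0 (scaled_rec Theta r)
  al_le (rate_gt0 g) (rate_ratio g1) (rate_double g0 g1) th0 coef_cvg (log_rate_small g0).
have [C3 [N3 [C30 H3]]] := partial_sum_le (scaled0 Theta r) al_ge0 (scaled_rec Theta r)
  al_le (rate_gt0 g) (rate_ratio g1) (rate_double g0 g1) th0 coef_cvg (log_rate_small g0).
have [N4 H4] := u_gt0 (scaled0 Theta r) al_ge0 (scaled_rec Theta r)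
  al_le (rate_gt0 g) (rate_ratio g1) (rate_double g0 g1) th0 coef_cvg (log_rate_small g0).
pose N := (2 + N1 + N2 + N3)%N.
have [||||||D D0 HD] := @slow_variation R u e u_ge0' C1 C2 C3 2 N C10 C20 C30.
- by [].
- by move=> n nN; apply: H1; lia.
- by move=> n k nN; apply: H2; lia.
- by move=> n nN; apply: H3; lia.
- by move=> m n mN; apply: e2; lia.
- by move=> n nN; apply: e0; lia.
have [|||M' HM'] := @char_fun_cvg R Theta Theta_ge0 b s r r0 e D 2 (N.*2.+2 + N4)%N D0.
- by move=> n nN; apply: H4; lia.
- by move=> n nN; apply: (e0 n _).2; lia.
- by move=> n k nN; apply: HD; lia.
exists `|M'|; near=> n; apply: (@le_trans _ _ (M' * e n)); first by near: n.
by rewrite -normrM ler_norm.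
Unshelve. all: by end_near. Qed.

Lemma char_fun_log_rate :
  (fun n => char_fun Theta b s n - char_limit Theta b s r)
    =O_\oo (fun n => RtoC (ln (n%:R : R) / n%:R `^ g)).
Proof.
have [C1 [N1 [C10 H1]]] := u_step (scaled0 Theta r) al_ge0 (scaled_rec Theta r)
  al_le (rate_gt0 g) (rate_ratio g1) (rate_double g0 g1) th0 coef_cvg
  (log_rate_small g0) (rate_le g1).
apply: (@char_fun_rate _ C1 N1 C10 H1).
- move=> m n m2 /andP[mn n2]; have m0 : (0 : R) < m%:R by rewrite ltr0n; lia.
  have n0 : (0 : R) < n%:R by rewrite ltr0n; lia.
  have lnmn : ln (m%:R : R) <= ln n%:R by rewrite ler_ln ?posrE // ler_nat.
  have lnm : 0 <= ln (m%:R : R) by rewrite ln_ge0 // ler1n; lia.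
  have pd : n%:R `^ g <= 2 * m%:R `^ g by apply: rate_double => //; lia.
  rewrite mulrCA ler_pM ?invr_ge0 ?powR_ge0 // ler_pdivlMr ?powR_gt0 //.
  by rewrite mulrC ler_pdivrMr ?powR_gt0.
- move=> n n2; split; first by apply: (eps_ge0 (rate_gt0 g)); lia.
  by apply: (inv_le_eps (rate_gt0 g)) => //; exact: rate_le.
Qed.

Lemma char_fun_smooth_rate (M' : R) :
  (forall k, `|Theta k.+2 * r ^+ k.+2 - Theta k.+1 * r ^+ k.+1| <= M' / k.+1%:R ^+ 2) ->
  (fun n => char_fun Theta b s n - char_limit Theta b s r)
    =O_\oo (fun n => RtoC (1 / n%:R : R)).
Proof.
move=> alM'; have [C1 [N1 [C10 H1]]] := u_step_smooth (scaled0 Theta r) al_ge0 (scaled_rec Theta r)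
  al_le (rate_gt0 g) (rate_ratio g1) (rate_double g0 g1) th0 coef_cvg
  (log_rate_small g0) alM'.
apply: (@char_fun_rate _ C1 N1 C10).
- by move=> n nN; rewrite mul1r; exact: H1.
- move=> m n m2 /andP[mn n2]; have m0 : (0 : R) < m%:R by rewrite ltr0n; lia.
  have n0 : (0 : R) < n%:R by rewrite ltr0n; lia.
  by rewrite !mul1r ler_pdivlMr // mulrC ler_pdivrMr // -natrM ler_nat mul2n.
- move=> n n2; have n0 : (0 : R) < n%:R^-1 by rewrite invr_gt0 ltr0n; lia.
  by rewrite mul1r; split; lra.
Qed.

End CoefficientCriteria.

Section EventuallyBounded.
Variable R : realType.

Lemma eventually_bounded (v : nat -> R) (N : nat) (M : R) :
  (forall n, (N <= n)%N -> v n <= M) -> exists M', forall n, v n <= M'.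
Proof.
move=> H; exists (`|M| + \sum_(k < N) `|v k|) => n; have [nN|nN] := leqP N n.
  by rewrite (le_trans (H n nN)) // (le_trans (ler_norm M)) // lerDl sumr_ge0.
rewrite (le_trans (ler_norm _)) // (bigD1 (Ordinal nN)) //= addrCA lerDl.
by rewrite addr_ge0 // sumr_ge0.
Qed.

End EventuallyBounded.

Section ClassCoefficients.
Variables (R : realType) (Theta : nat -> R) (r th : R).
Local Notation C := (CC R).
Hypothesis r0 : 0 < r.

Let al k := Theta k * r ^+ k.

Lemma gTheta_sub_log_coef k :
  gTheta Theta k.+1 - log_coef r th k.+1
  = RtoC ((al k.+1 - th) / (k.+1%:R * r ^+ k.+1)).
Proof.
rewrite /gTheta /log_coef /= -RtoCB; congr RtoC; rewrite /al.
by field; rewrite nat1r pnatr_eq0 expf_neq0 // lt0r_neq0.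
Qed.

(** Uniqueness of expansions at 0 gives theta_k / k = th / (k r^k) + a_k; multiplying by k r^k turns
    O(r^-k k^(-1-g)) into O(k^-g). *)
Lemma class_eF_coef (g : R) : 0 < g ->
  fps_of_class (class_eF r th g) (gTheta Theta) ->
  exists M, forall k, `|al k.+1 - th| <= M / k.+1%:R `^ g.
Proof.
move=> gg0 [f [fg [_ _ _ [f0 [a [fE f0a aO]]]]]].
have T1 : taylor0 f (gTheta Theta) := taylor0_pseries fg.
have T2 : taylor0 f0 a.
  apply: taylor0_pseries; apply/near_CCP; exists r => // t.
  by rewrite subr0; exact: f0a.
have T3 := taylor0D (taylor0_log_sing th r0) T2.
have T4 : taylor0 f (fun k => log_coef r th k + a k).
  by apply: taylor0_eq_near T3; [exact: r0|move=> t tr /=; rewrite fE].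
have E := taylor0_unique T1 T4.
have [M [N _ HM]] := (eqO_cmodP _ _).2 aO.
pose v k := `|al k.+1 - th| * k.+1%:R `^ g.
have [|M' HM'] := @eventually_bounded R v N M; last first.
  by exists M' => k; rewrite ler_pdivlMr ?powR_gt0 ?ltr0n //; exact: HM'.
move=> k kN; have k0 : (0 : R) < k.+1%:R by rewrite ltr0n.
have := HM k.+1 (leqW kN); rewrite /=.
have -> : a k.+1 = RtoC ((al k.+1 - th) / (k.+1%:R * r ^+ k.+1)).
  by rewrite -gTheta_sub_log_coef E; ring.
have rk : 0 < r ^+ k.+1 by rewrite exprn_gt0.
have kg : 0 < k.+1%:R `^ g :> R by rewrite powR_gt0.
rewrite cmod_RtoC normrM normfV (gtr0_norm (mulr_gt0 k0 rk)).
have -> : k.+1%:R `^ (- 1 - g) = (k.+1%:R * k.+1%:R `^ g)^-1 :> R.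
  by rewrite -opprD powRN powRD ?(gt_eqF k0) ?implybT // powRr1 // ltW.
rewrite [X in M * X]ger0_norm ?divr_ge0 ?invr_ge0 ?mulr_ge0 ?(ltW rk) ?(ltW kg) ?(ltW k0) //.
rewrite ler_pdivrMr ?mulr_gt0 // => H.
rewrite /v -ler_pdivlMr // (le_trans H) // le_eqVlt; apply/orP; left; apply/eqP.
by field; rewrite !lt0r_neq0.
Qed.

End ClassCoefficients.

(** * Goursat's lemma *)

Section ComplexIntegral.
Variable R : realType.
Local Notation C := (CC R).
Local Notation mu := (@lebesgue_measure R).
Implicit Types (F G : R -> C) (a b : R).

Definition rint a b (f : R -> R) : R := \int[mu]_(x in `[a, b]) f x.

Definition cint a b F : C :=
  RtoC (rint a b (fun x => ReC (F x))) + ImUnit R * RtoC (rint a b (fun x => ImC (F x))).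

Definition ccts F (x : R) := forall e : R, 0 < e -> exists2 r, 0 < r &
  forall y, `|y - x| < r -> cmod (F y - F x) <= e.

Definition ccts_on a b F := forall x, a <= x <= b -> ccts F x.

Lemma eps_cts (f : R -> R) x : (forall e, 0 < e -> exists2 r, 0 < r &
  forall y, `|y - x| < r -> `|f y - f x| <= e) -> {for x, continuous f}.
Proof.
move=> H; apply/cvgrPdist_le => e e0; have [r r0 Hr] := H e e0.
apply/nbhs_ballP; exists r => //= y xy; rewrite distrC; apply: Hr.
by rewrite distrC.
Qed.

Lemma within_cts a b (f : R -> R) :
  (forall x, a <= x <= b -> {for x, continuous f}) -> {within `[a, b], continuous f}.
Proof.
move=> H; apply: continuous_in_subspaceT => x; rewrite inE /= in_itv /=; exact: H.
Qed.

Lemma rint_integrable a b (f : R -> R) : {within `[a, b], continuous f} ->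
  mu.-integrable `[a, b] (EFin \o f).
Proof. by move=> cf; apply: continuous_compact_integrable => //; exact: segment_compact. Qed.

Lemma ccts_re a b F : ccts_on a b F -> {within `[a, b], continuous (fun x => ReC (F x))}.
Proof.
move=> cF; apply: within_cts => x xab; apply: eps_cts => e e0.
have [r r0 H] := cF x xab e e0; exists r => // y /H.
by rewrite -ReCB; apply: le_trans; exact: Re_le_cmod.
Qed.

Lemma ccts_im a b F : ccts_on a b F -> {within `[a, b], continuous (fun x => ImC (F x))}.
Proof.
move=> cF; apply: within_cts => x xab; apply: eps_cts => e e0.
have [r r0 H] := cF x xab e e0; exists r => // y /H.
by rewrite -ImCB; apply: le_trans; exact: Im_le_cmod.
Qed.

Lemma cctsB a b F G : ccts_on a b F -> ccts_on a b G -> ccts_on a b (fun x => F x - G x).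
Proof.
move=> cF cG x xab e e0; have e2 : 0 < e / 2 by lra.
have [r r0 Hr] := cF x xab _ e2; have [s s0 Hs] := cG x xab _ e2.
exists (Num.min r s); first by rewrite lt_min r0.
move=> y; rewrite lt_min => /andP[/Hr H1 /Hs H2].
have -> : F y - G y - (F x - G x) = (F y - F x) - (G y - G x) by ring.
by rewrite (le_trans (cmodB _ _)) //; lra.
Qed.

Lemma cctsZ a b F (c : C) : ccts_on a b F -> ccts_on a b (fun x => c * F x).
Proof.
move=> cF x xab e e0; have e2 : 0 < e / (cmod c + 1) by rewrite divr_gt0 // ltr_wpDl ?cmod_ge0.
have [r r0 Hr] := cF x xab _ e2; exists r => // y /Hr H.
rewrite -mulrBr cmodM (le_trans (ler_wpM2l (cmod_ge0 c) H)) //.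
rewrite mulrA ler_pdivrMr ?ltr_wpDl ?cmod_ge0 // mulrC ler_wpM2l ?(ltW e0) //.
by rewrite lerDl.
Qed.

Lemma ccts_sub a b a' b' F : a <= a' -> b' <= b -> ccts_on a b F -> ccts_on a' b' F.
Proof. by move=> aa bb cF x /andP[x1 x2]; apply: cF; apply/andP; split; lra. Qed.

Lemma cintB a b F G : ccts_on a b F -> ccts_on a b G ->
  cint a b (fun x => F x - G x) = cint a b F - cint a b G.
Proof.
move=> cF cG; rewrite /cint /rint.
under eq_Rintegral do rewrite ReCB.
under [X in _ + _ * RtoC X = _]eq_Rintegral do rewrite ImCB.
rewrite !RintegralB //; try exact/rint_integrable/ccts_re; try exact/rint_integrable/ccts_im.
by rewrite !RtoCB; ring.
Qed.

Lemma cintZ a b F (c : C) : ccts_on a b F ->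
  cint a b (fun x => c * F x) = c * cint a b F.
Proof.
move=> cF; rewrite /cint /rint.
have iR := rint_integrable (ccts_re cF); have iI := rint_integrable (ccts_im cF).
have zR k : mu.-integrable `[a, b] (EFin \o (fun x => k * ReC (F x))).
  rewrite (_ : _ \o _ = (fun x => k%:E * (EFin \o (fun x => ReC (F x))) x)%E) //.
  exact: integrableZl.
have zI k : mu.-integrable `[a, b] (EFin \o (fun x => k * ImC (F x))).
  rewrite (_ : _ \o _ = (fun x => k%:E * (EFin \o (fun x => ImC (F x))) x)%E) //.
  exact: integrableZl.
under eq_Rintegral do rewrite ReCM.
under [X in _ + _ * RtoC X = _]eq_Rintegral do rewrite ImCM.
rewrite RintegralB // RintegralD // !RintegralZl //.
by apply: CC_eqP; rewrite !reimE; ring.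
Qed.

Lemma cint_split a m b F : a <= m <= b -> ccts_on a b F ->
  cint a b F = cint a m F + cint m b F.
Proof.
move=> /andP[am mb] cF; rewrite /cint /rint.
have key (f : R -> R) : {within `[a, b], continuous f} ->
    \int[mu]_(x in `[a, b]) f x = \int[mu]_(x in `[a, m]) f x + \int[mu]_(x in `[m, b]) f x.
  move=> /rint_integrable cf; have := @Rintegral_itvB R f (BLeft a) (BRight b) m cf.
  rewrite !bnd_simp => /(_ am mb) H.
  rewrite -[X in _ + X]Rintegral_itv_obnd_cbnd -?H; first by ring.
  apply: integrableS cf => //; apply: subset_itv; by rewrite bnd_simp.
rewrite (key _ (ccts_re cF)) (key _ (ccts_im cF)) !RtoCD; ring.
Qed.

Lemma rint_cst a b (k : R) : a <= b -> rint a b (fun=> k) = k * (b - a).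
Proof.
move=> ab; rewrite /rint Rintegral_cst //= lebesgue_measure_itv /= lte_fin.
by case: ltP => // ba; have -> : a = b by [lra]; rewrite subrr mulr0.
Qed.

Lemma rint_le a b (f g : R -> R) : {within `[a, b], continuous f} ->
  {within `[a, b], continuous g} -> (forall x, a <= x <= b -> f x <= g x) ->
  rint a b f <= rint a b g.
Proof.
by move=> cf cg fg; apply: le_Rintegral => //; exact: rint_integrable.
Qed.

(** The factor 2 comes from bounding the real and imaginary integrals separately. *)
Lemma cint_le a b F (g : R -> R) : {within `[a, b], continuous g} -> ccts_on a b F ->
  (forall x, a <= x <= b -> cmod (F x) <= g x) -> cmod (cint a b F) <= 2 * rint a b g.
Proof.
move=> cg cF Fg; rewrite (le_trans (cmodD _ _)) // cmodM cmod_i mul1r !cmod_RtoC.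
rewrite mulr_natl mulr2n.
have key (f : R -> R) : {within `[a, b], continuous f} ->
    (forall x, a <= x <= b -> `|f x| <= g x) -> `|rint a b f| <= rint a b g.
  move=> cf fg; rewrite (le_trans (le_normr_Rintegral _ (rint_integrable cf))) //.
  apply: rint_le => //; move=> x; apply: continuous_comp; first exact: cf.
  exact: norm_continuous.
apply: lerD; apply: key; [exact: ccts_re| |exact: ccts_im|].
- by move=> x xab; rewrite (le_trans (Re_le_cmod _)) // Fg.
- by move=> x xab; rewrite (le_trans (Im_le_cmod _)) // Fg.
Qed.

Lemma ccts_cst a b (c : C) : ccts_on a b (fun=> c).
Proof. by move=> x _ e e0; exists 1 => // y _; rewrite subrr cmod0 ltW. Qed.

Lemma cint_cst a b (c : C) : a <= b -> cint a b (fun=> c) = RtoC (b - a) * c.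
Proof.
by move=> ab; rewrite /cint !rint_cst //; apply: CC_eqP; rewrite !reimE; ring.
Qed.

Lemma cint_near_cst a b F (c : C) (M : R) : a <= b -> ccts_on a b F ->
  (forall x, a <= x <= b -> cmod (F x - c) <= M) ->
  cmod (cint a b F - RtoC (b - a) * c) <= 2 * M * (b - a).
Proof.
move=> ab cF FM; rewrite -cint_cst // -cintB //; last exact: ccts_cst.
rewrite -mulrA -rint_cst //; apply: cint_le => //.
  by apply: within_cts => x _; exact: cst_continuous.
by apply: cctsB => //; exact: ccts_cst.
Qed.

End ComplexIntegral.

Lemma sum4_lt_absurd (R : realFieldType) (q a b c d : R) :
  4 * a < q -> 4 * b < q -> 4 * c < q -> 4 * d < q -> q <= a + b + c + d -> False.
Proof. by lra. Qed.

Section Goursat.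
Variable R : realType.
Local Notation C := (CC R).
Variables (F : R -> R -> C) (u v : C).

(** Holomorphy read in the real coordinates of s u + t v: the differential is complex multiplication
    by one number d. *)
Definition pdiff (s t : R) := exists d : C, forall e, 0 < e -> exists2 r, 0 < r &
  forall s' t', `|s' - s| < r -> `|t' - t| < r ->
    cmod (F s' t' - F s t - d * (u * RtoC (s' - s) + v * RtoC (t' - t)))
      <= e * (`|s' - s| + `|t' - t|).

Lemma pdiff_cts s t : pdiff s t -> forall e, 0 < e -> exists2 r, 0 < r &
  forall s' t', `|s' - s| < r -> `|t' - t| < r -> cmod (F s' t' - F s t) <= e.
Proof.
move=> [d H] e e0; have [r r0 Hr] := H 1 ltr01.
set K := 1 + cmod d * (cmod u + cmod v).
have K0 : 0 < K by rewrite ltr_pwDl // mulr_ge0 ?addr_ge0 ?cmod_ge0.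
have eK : 0 < e / (2 * K) by rewrite divr_gt0 // mulr_gt0.
exists (Num.min r (e / (2 * K))); first by rewrite lt_min r0.
move=> s' t'; rewrite !lt_min => /andP[s1 s2] /andP[t1 t2].
have := Hr s' t' s1 t1; rewrite mul1r => H1.
set X := d * _ in H1; set D := `|s' - s| + _ in H1.
have D0 : 0 <= D by rewrite addr_ge0.
have HX : cmod X <= cmod d * (cmod u + cmod v) * D.
  rewrite /X cmodM -mulrA ler_wpM2l ?cmod_ge0 // (le_trans (cmodD _ _)) //.
  rewrite !cmodM !cmod_RtoC mulrDl.
  by rewrite lerD // ler_wpM2l ?cmod_ge0 // /D ?lerDl ?lerDr.
have -> : F s' t' - F s t = (F s' t' - F s t - X) + X by ring.
rewrite (le_trans (cmodD _ _)) // (le_trans (lerD H1 HX)) //.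
have -> : D + cmod d * (cmod u + cmod v) * D = K * D by rewrite /K; ring.
have DE : D <= 2 * (e / (2 * K)) by rewrite /D; lra.
rewrite (le_trans (ler_wpM2l (ltW K0) DE)) // le_eqVlt; apply/orP; left; apply/eqP.
by field; exact: lt0r_neq0.
Qed.

(** The integral over the boundary of the parallelogram with sides along u and v, opposite sides
    being grouped. *)
Definition rect_integral a1 a2 b1 b2 : C :=
  u * cint a1 a2 (fun s => F s b1 - F s b2) + v * cint b1 b2 (fun t => F a2 t - F a1 t).

Variables (a0 a1 b0 b1 : R).
Hypotheses (a01 : a0 <= a1) (b01 : b0 <= b1).
Hypothesis Fdiff : forall s t, a0 <= s <= a1 -> b0 <= t <= b1 -> pdiff s t.

Let ctsl t : b0 <= t <= b1 -> ccts_on a0 a1 (F^~ t).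
Proof.
move=> tb s sa e e0; have [r r0 H] := pdiff_cts (Fdiff sa tb) e0.
by exists r => // y ys; apply: H; rewrite ?subrr ?normr0.
Qed.

Let ctsr s : a0 <= s <= a1 -> ccts_on b0 b1 (F s).
Proof.
move=> sa t tb e e0; have [r r0 H] := pdiff_cts (Fdiff sa tb) e0.
by exists r => // y ys; apply: H; rewrite ?subrr ?normr0.
Qed.

Lemma rect_split4 s1 m s2 t1 p t2 :
  a0 <= s1 -> s1 <= m -> m <= s2 -> s2 <= a1 ->
  b0 <= t1 -> t1 <= p -> p <= t2 -> t2 <= b1 ->
  rect_integral s1 s2 t1 t2 = rect_integral s1 m t1 p + rect_integral m s2 t1 p
    + rect_integral s1 m p t2 + rect_integral m s2 p t2.
Proof.
move=> h1 h2 h3 h4 k1 k2 k3 k4; rewrite /rect_integral.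
have cl x y t : a0 <= x -> y <= a1 -> b0 <= t -> t <= b1 -> ccts_on x y (F^~ t).
  by move=> hx hy ht1 ht2; apply: (ccts_sub hx hy); apply: ctsl; rewrite ht1.
have cr x y s : b0 <= x -> y <= b1 -> a0 <= s -> s <= a1 -> ccts_on x y (F s).
  by move=> hx hy ht1 ht2; apply: (ccts_sub hx hy); apply: ctsr; rewrite ht1.
rewrite !cintB; try (apply: cl; lra); try (apply: cr; lra).
rewrite (@cint_split _ s1 m s2 (F^~ t1)); [|by rewrite h2|by apply: cl; lra].
rewrite (@cint_split _ s1 m s2 (F^~ t2)); [|by rewrite h2|by apply: cl; lra].
rewrite (@cint_split _ t1 p t2 (F s1)); [|by rewrite k2|by apply: cr; lra].
rewrite (@cint_split _ t1 p t2 (F s2)); [|by rewrite k2|by apply: cr; lra].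
by do 12! (move: (cint _ _ _) => ?); ring.
Qed.

Lemma rect_split_le x y a b : 0 <= a -> 0 <= b ->
  a0 <= x -> x + (a + a) <= a1 -> b0 <= y -> y + (b + b) <= b1 ->
  cmod (rect_integral x (x + (a + a)) y (y + (b + b)))
  <= cmod (rect_integral x (x + a) y (y + b))
     + cmod (rect_integral (x + a) (x + a + a) y (y + b))
     + cmod (rect_integral x (x + a) (y + b) (y + b + b))
     + cmod (rect_integral (x + a) (x + a + a) (y + b) (y + b + b)).
Proof.
move=> ha hb h1 h2 h3 h4; rewrite !addrA in h2 h4 *.
rewrite (@rect_split4 x (x + a) (x + a + a) y (y + b) (y + b + b)) ?lerDl //.
rewrite (le_trans (cmodD _ _)) // lerD // (le_trans (cmodD _ _)) // lerD //.
exact: cmodD.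
Qed.

Let A n := (a1 - a0) / 2 ^+ n.
Let B n := (b1 - b0) / 2 ^+ n.
Let Q n (x : R * R) := cmod (rect_integral x.1 (x.1 + A n) x.2 (x.2 + B n)).

(** A cell is stored by its lower corner. The choice falls on a quarter carrying at least a quarter
    of the integral; if the first three fail, the fourth qualifies by the triangle inequality. *)
Let next n (x : R * R) : R * R :=
  let x1 := (x.1 + A n.+1, x.2) in
  let x2 := (x.1, x.2 + B n.+1) in
  let x3 := (x.1 + A n.+1, x.2 + B n.+1) in
  if Q n x <= 4 * Q n.+1 x then x else
  if Q n x <= 4 * Q n.+1 x1 then x1 else
  if Q n x <= 4 * Q n.+1 x2 then x2 else x3.

Let cell := fix cell n : R * R := if n is m.+1 then next m (cell m) else (a0, b0).

Let A_half n : A n = A n.+1 + A n.+1.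
Proof. by rewrite /A exprS; field; rewrite expf_neq0. Qed.

Let B_half n : B n = B n.+1 + B n.+1.
Proof. by rewrite /B exprS; field; rewrite expf_neq0. Qed.

Let A_ge0 n : 0 <= A n.
Proof. by rewrite divr_ge0 ?subr_ge0 // exprn_ge0. Qed.

Let B_ge0 n : 0 <= B n.
Proof. by rewrite divr_ge0 ?subr_ge0 // exprn_ge0. Qed.

Let cell_step n : ((cell n.+1).1 = (cell n).1 \/ (cell n.+1).1 = (cell n).1 + A n.+1) /\
  ((cell n.+1).2 = (cell n).2 \/ (cell n.+1).2 = (cell n).2 + B n.+1).
Proof.
rewrite /= /next; case: ifP => _; first by split; left.
case: ifP => _; first by split; [right|left].
by case: ifP => _; split; [left|right|right|right].
Qed.

Let cell_mono n :
  [/\ (cell n).1 <= (cell n.+1).1, (cell n.+1).1 + A n.+1 <= (cell n).1 + A n,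
      (cell n).2 <= (cell n.+1).2 & (cell n.+1).2 + B n.+1 <= (cell n).2 + B n].
Proof.
have [h1 h2] := cell_step n; have A1 := A_ge0 n.+1; have B1 := B_ge0 n.+1.
rewrite (A_half n) (B_half n).
by case: h1 => ->; case: h2 => ->; split; lra.
Qed.

Let cell_in n : [/\ a0 <= (cell n).1, (cell n).1 + A n <= a1,
  b0 <= (cell n).2 & (cell n).2 + B n <= b1].
Proof.
elim: n => [|n [h1 h2 h3 h4]]; first by rewrite /A /B /= expr0 !divr1; split; lra.
have [k1 k2 k3 k4] := cell_mono n.
by split; [exact: le_trans k1|exact: le_trans h2|exact: le_trans k3|exact: le_trans h4].
Qed.

Let cell_large n : Q 0 (cell 0) <= 4 ^+ n * Q n (cell n).
Proof.
elim: n => [|n IHn]; first by rewrite expr0 mul1r.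
rewrite (le_trans IHn) // exprSr -mulrA ler_wpM2l ?exprn_ge0 //.
have [h1 h2 h3 h4] := cell_in n.
have [p1 p2] := (A_ge0 n.+1, B_ge0 n.+1).
rewrite /= /next; case: ifP => // /negbT; rewrite -ltNge => q0.
case: ifP => // /negbT; rewrite -ltNge => q1.
case: ifP => // /negbT; rewrite -ltNge => q2.
rewrite leNgt; apply/negP => q3; rewrite (A_half n) in h2; rewrite (B_half n) in h4.
have := rect_split_le p1 p2 h1 h2 h3 h4; rewrite -(A_half n) -(B_half n) => q4.
move: q0 q1 q2 q3 q4; rewrite /Q /=.
exact: sum4_lt_absurd.
Qed.

Lemma dist_le_length (x l y z : R) : x <= y <= x + l -> x <= z <= x + l -> `|z - y| <= l.
Proof. by rewrite ler_norml => /andP[? ?] /andP[? ?]; apply/andP; split; lra. Qed.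

Lemma nested_point (x l : nat -> R) : (forall n, 0 <= l n) ->
  (forall n, x n <= x n.+1) -> (forall n, x n.+1 + l n.+1 <= x n + l n) ->
  exists y, forall n, x n <= y <= x n + l n.
Proof.
move=> l0 xi xd.
have mono n k : x n <= x (n + k)%N.
  by elim: k => [|k IHk]; rewrite ?addn0 // addnS (le_trans IHk).
have anti n k : x (n + k)%N + l (n + k)%N <= x n + l n.
  by elim: k => [|k IHk]; rewrite ?addn0 // addnS (le_trans (xd _)).
have le n m : x n <= x m + l m.
  have [nm|/ltnW mn] := leqP n m.
    by rewrite -(subnKC nm) (le_trans (mono n (m - n)%N)) // lerDl.
  rewrite -[in x n](subnKC mn) (le_trans _ (anti m (n - m)%N)) // lerDl //.
exists (sup [set x n | n in setT]) => n; apply/andP; split.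
  apply: ub_le_sup; last by exists n.
  by exists (x 0%N + l 0%N) => _ [m _ <-].
apply: ge_sup; first by exists (x 0%N), 0%N.
by move=> _ [m _ <-].
Qed.

(** Bisection: on the n-th cell around the limit point, F differs from its affine part by at most a
    small multiple of S / 2^n, so the boundary integral is a small multiple of (S / 2^n)^2, which
    beats the factor 4^n. *)
Lemma rect_integral_eq0 : rect_integral a0 a1 b0 b1 = 0.
Proof.
apply/eqP; rewrite -cmod_eq0 eq_le cmod_ge0 andbT.
have -> : cmod (rect_integral a0 a1 b0 b1) = Q 0 (cell 0).
  by rewrite /Q /A /B /= expr0 !divr1 !(addrC _ (_ - _)) !subrK.
have [s sP] := @nested_point (fun n => (cell n).1) A A_ge0 (fun n => let: And4 h _ _ _ := cell_mono n in h)
  (fun n => let: And4 _ h _ _ := cell_mono n in h).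
have [t tP] := @nested_point (fun n => (cell n).2) B B_ge0 (fun n => let: And4 _ _ h _ := cell_mono n in h)
  (fun n => let: And4 _ _ _ h := cell_mono n in h).
have sa : a0 <= s <= a1.
  by have := sP 0%N; rewrite /A /= expr0 divr1 addrC subrK.
have tb : b0 <= t <= b1.
  by have := tP 0%N; rewrite /B /= expr0 divr1 addrC subrK.
have [d dP] := Fdiff sa tb.
apply/ler_addgt0Pr => e e0; rewrite add0r.
set S := (a1 - a0) + (b1 - b0); have S0 : 0 <= S by rewrite addr_ge0 ?subr_ge0.
set K := 4 * (cmod u + cmod v) * S ^+ 2 + 1.
have K0 : 0 < K by rewrite ltr_wpDl // mulr_ge0 ?sqr_ge0 // mulr_ge0 // addr_ge0 ?cmod_ge0.
have eK : 0 < e / K by rewrite divr_gt0.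
have [r r0 Hr] := dP _ eK.
have [n nP] : exists n, S / 2 ^+ n < r.
  exists (Num.truncn (S / r)).+1; rewrite ltr_pdivrMr ?exprn_gt0 // mulrC -ltr_pdivrMr //.
  rewrite (lt_le_trans (truncnS_gt _)) // -natrX ler_nat ltnW // ltn_expl //.
have SE : S / 2 ^+ n = A n + B n by rewrite /S /A /B mulrDl.
have [p1 p2] := (A_ge0 n, B_ge0 n).
have /andP[s1 s2] := sP n; have /andP[t1 t2] := tP n.
have [h1 h2 h3 h4] := cell_in n.
set x := (cell n).1 in s1 s2 h1 h2; set y := (cell n).2 in t1 t2 h3 h4.
have yA : y <= y <= y + B n by rewrite lexx lerDl.
have yB : y <= y + B n <= y + B n by rewrite lexx andbT lerDl.
have xA : x <= x <= x + A n by rewrite lexx lerDl.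
have xB : x <= x + A n <= x + A n by rewrite lexx andbT lerDl.
have yb : b0 <= y <= b1 /\ b0 <= y + B n <= b1.
  by rewrite h3 h4 (le_trans _ h4) ?lerDl // (le_trans h3) ?lerDl.
have xb : a0 <= x <= a1 /\ a0 <= x + A n <= a1.
  by rewrite h1 h2 (le_trans _ h2) ?lerDl // (le_trans h1) ?lerDl.
pose aff s' t' := F s t + d * (u * RtoC (s' - s) + v * RtoC (t' - t)).
have near s' t' : x <= s' <= x + A n -> y <= t' <= y + B n ->
    cmod (F s' t' - aff s' t') <= e / K * (S / 2 ^+ n).
  move=> /(dist_le_length (sP n)) D1 /(dist_le_length (tP n)) D2.
  have -> : F s' t' - aff s' t' = F s' t' - F s t - d * (u * RtoC (s' - s) + v * RtoC (t' - t)).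
    by rewrite /aff; ring.
  have ABr : A n + B n < r by rewrite -SE.
  rewrite (le_trans (Hr _ _ _ _)) //.
  - by rewrite (le_lt_trans D1) // (le_lt_trans _ ABr) // lerDl.
  - by rewrite (le_lt_trans D2) // (le_lt_trans _ ABr) // lerDr.
  by rewrite ler_wpM2l ?(ltW eK) // SE lerD.
(* The affine part has constant differences between opposite sides, and its two contributions u A (-
   d v B) and v B (d u A) cancel. *)
have affl s' : aff s' y - aff s' (y + B n) = - (d * v * RtoC (B n)).
  by rewrite /aff !RtoCB RtoCD; ring.
have affr t' : aff (x + A n) t' - aff x t' = d * u * RtoC (A n).
  by rewrite /aff !RtoCB RtoCD; ring.
set E := e / K * (S / 2 ^+ n) in near.
have N1 : cmod (cint x (x + A n) (fun s => F s y - F s (y + B n))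
    - RtoC (x + A n - x) * - (d * v * RtoC (B n))) <= 2 * (2 * E) * (x + A n - x).
  apply: cint_near_cst; first by rewrite lerDl.
    by case: yb => yb1 yb2; apply: cctsB; apply: (ccts_sub h1 h2); apply: ctsl.
  move=> s' s'x; rewrite -(affl s').
  have -> : F s' y - F s' (y + B n) - (aff s' y - aff s' (y + B n))
    = (F s' y - aff s' y) - (F s' (y + B n) - aff s' (y + B n)) by ring.
  by rewrite (le_trans (cmodB _ _)) // mulr_natl mulr2n lerD //; apply: near.
have N2 : cmod (cint y (y + B n) (fun t => F (x + A n) t - F x t)
    - RtoC (y + B n - y) * (d * u * RtoC (A n))) <= 2 * (2 * E) * (y + B n - y).
  apply: cint_near_cst; first by rewrite lerDl.
    by case: xb => xb1 xb2; apply: cctsB; apply: (ccts_sub h3 h4); apply: ctsr.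
  move=> t' t'y; rewrite -(affr t').
  have -> : F (x + A n) t' - F x t' - (aff (x + A n) t' - aff x t')
    = (F (x + A n) t' - aff (x + A n) t') - (F x t' - aff x t') by ring.
  by rewrite (le_trans (cmodB _ _)) // mulr_natl mulr2n lerD //; apply: near.
have lx : x + A n - x = A n by ring.
have ly : y + B n - y = B n by ring.
rewrite lx in N1; rewrite ly in N2.
have E0 : 0 <= E by rewrite mulr_ge0 ?(ltW eK) // divr_ge0 ?exprn_ge0.
have QE : Q n (cell n) <= 4 * E * (cmod u + cmod v) * (S / 2 ^+ n).
  rewrite /Q /rect_integral -/x -/y; set I1 := cint _ _ _ in N1 *; set I2 := cint _ _ _ in N2 *.
  have -> : u * I1 + v * I2 = u * (I1 - RtoC (A n) * - (d * v * RtoC (B n)))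
     + v * (I2 - RtoC (B n) * (d * u * RtoC (A n))) by ring.
  rewrite (le_trans (cmodD _ _)) // !cmodM.
  apply: (@le_trans _ _ (cmod u * (2 * (2 * E) * A n) + cmod v * (2 * (2 * E) * B n))).
    by rewrite lerD // ler_wpM2l ?cmod_ge0.
  rewrite SE; have -> : 4 * E * (cmod u + cmod v) * (A n + B n)
    = (cmod u * (2 * (2 * E) * A n) + cmod v * (2 * (2 * E) * B n))
      + 4 * E * (cmod u * B n + cmod v * A n) by ring.
  by rewrite lerDl mulr_ge0 //; [exact: mulr_ge0|rewrite addr_ge0 // mulr_ge0 ?cmod_ge0].
rewrite (le_trans (cell_large n)) //.
rewrite (le_trans (ler_wpM2l (exprn_ge0 n (ler0n _ 4)) QE)) // /E.
have -> : 4 ^+ n = 2 ^+ n * 2 ^+ n :> R by rewrite -exprMn -natrM.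
have -> : 2 ^+ n * 2 ^+ n * (4 * (e / K * (S / 2 ^+ n)) * (cmod u + cmod v) * (S / 2 ^+ n))
  = e / K * (4 * (cmod u + cmod v) * S ^+ 2).
  by field; rewrite lt0r_neq0 // expf_neq0.
rewrite mulrAC ler_pdivrMr // ler_wpM2l ?(ltW e0) //.
by rewrite /K lerDl.
Qed.

End Goursat.

(** * Coefficients as contour integrals *)

Section ContourIntegral.
Variable R : realType.
Local Notation C := (CC R).
Variable kp : R.
Hypothesis kp0 : 0 < kp.

Definition dir_up : C := RtoC (pi * kp) + ImUnit R * RtoC pi.
Definition dir_dn : C := RtoC (pi * kp) - ImUnit R * RtoC pi.

Definition ray (v : C) (s t : R) : C := RtoC s + RtoC t * v.

(* In the variable w with t = r e^w, the two rays from s towards s + dir_up and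
   s + dir_dn form a closed curve around 0. *)
Definition contour_int (f : C -> C) (s : R) : C :=
  dir_up * cint 0 1 (fun t => f (ray dir_up s t)) - dir_dn * cint 0 1 (fun t => f (ray dir_dn s t)).

Lemma cexp_dir_up_dn : cexp dir_up = cexp dir_dn.
Proof.
have r1 : ReC dir_up = pi * kp by rewrite /dir_up !reimE; ring.
have r2 : ReC dir_dn = pi * kp by rewrite /dir_dn !reimE; ring.
have i1 : ImC dir_up = pi by rewrite /dir_up !reimE; ring.
have i2 : ImC dir_dn = - pi by rewrite /dir_dn !reimE; ring.
by apply: CC_eqP; rewrite !(ReC_cexp, ImC_cexp) r1 r2 i1 i2 ?cosN ?sinN ?sinpi ?oppr0.
Qed.

Lemma dir_up_sub_dn : dir_up - dir_dn = 2 * RtoC pi * ImUnit R.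
Proof. by rewrite /dir_up /dir_dn; ring. Qed.

Lemma eq_cint (a b : R) (F G : R -> C) : (forall x, a <= x <= b -> F x = G x) ->
  cint a b F = cint a b G.
Proof.
move=> FG; rewrite /cint /rint; congr (RtoC _ + _ * RtoC _);
  by apply: eq_Rintegral => x; rewrite inE /= in_itv /= => xab; rewrite FG.
Qed.

Lemma cdiff_pdiff (f : C -> C) v s t d : cdiff f (ray v s t) d ->
  pdiff (fun s t => f (ray v s t)) 1 v s t.
Proof.
move=> fd; exists d => e e0; set K := 1 + cmod v.
have K0 : 0 < K by rewrite ltr_pwDl ?cmod_ge0.
have [r r0 Hr] := fd _ (divr_gt0 e0 K0).
exists (r / (2 * K)); first by rewrite divr_gt0 ?mulr_gt0.
move=> s' t' hs ht; have E : ray v s' t' - ray v s t = 1 * RtoC (s' - s) + v * RtoC (t' - t).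
  by rewrite /ray !RtoCB; ring.
rewrite -E; have L : cmod (ray v s' t' - ray v s t) <= K * (`|s' - s| + `|t' - t|).
  rewrite E mul1r (le_trans (cmodD _ _)) // cmodM !cmod_RtoC /K.
  have -> : (1 + cmod v) * (`|s' - s| + `|t' - t|)
    = (`|s' - s| + cmod v * `|t' - t|) + (`|t' - t| + cmod v * `|s' - s|) by ring.
  by rewrite lerDl addr_ge0 ?mulr_ge0 ?cmod_ge0.
rewrite (le_trans (Hr _ _)) //.
  rewrite (le_lt_trans L) // mulrC -ltr_pdivlMr //.
  have -> : r / K = r / (2 * K) + r / (2 * K) by field; exact: lt0r_neq0.
  exact: ltrD.
rewrite (le_trans (ler_wpM2l (ltW (divr_gt0 e0 K0)) L)) // mulrA divfK //.
exact: lt0r_neq0.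
Qed.

Definition holo_on (f : C -> C) (v : C) (a b : R) :=
  forall s t, a <= s <= b -> 0 <= t <= 1 -> exists d, cdiff f (ray v s t) d.

Lemma holo_ccts f v a b s : a <= s <= b -> holo_on f v a b ->
  ccts_on 0 1 (fun t => f (ray v s t)).
Proof.
move=> sab fh t t01 e e0; have [d /cdiff_pdiff /pdiff_cts/(_ e e0)[r r0 H]] := fh s t sab t01.
by exists r => // y yt; apply: H; rewrite ?subrr ?normr0.
Qed.

(** Goursat on the two parallelograms swept by the rays. They share the side at parameter 0, and
    their sides at parameter 1 differ by 2 pi i, where a function of e^w takes equal values; so the
    boundary terms cancel in the difference. *)
Lemma Jint_const (phi : C -> C) a b : a <= b ->
  holo_on (phi \o @cexp R) dir_up a b -> holo_on (phi \o @cexp R) dir_dn a b ->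
  contour_int (phi \o @cexp R) a = contour_int (phi \o @cexp R) b.
Proof.
move=> ab; set f := phi \o _ => hu hd.
have la : a <= a <= b by rewrite lexx.
have lb : a <= b <= b by rewrite ab lexx.
have key v : holo_on f v a b ->
    v * (cint 0 1 (fun t => f (ray v b t)) - cint 0 1 (fun t => f (ray v a t)))
    = - cint a b (fun s => f (RtoC s) - f (RtoC s + v)).
  move=> hv.
  have hp s t : a <= s <= b -> 0 <= t <= 1 -> pdiff (fun s t => f (ray v s t)) 1 v s t.
    by move=> sab t01; have [d /cdiff_pdiff] := hv s t sab t01.
  have /eqP := rect_integral_eq0 ab ler01 hp.
  rewrite /rect_integral mul1r addrC addr_eq0 => /eqP.
  rewrite cintB; [|exact: (holo_ccts lb hv)|exact: (holo_ccts la hv)].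
  move=> ->; congr (- _); apply: eq_cint => s _.
  by rewrite /ray RtoC0 RtoC1 mul0r mul1r addr0.
have := key _ hd; have -> : cint a b (fun s => f (RtoC s) - f (RtoC s + dir_dn))
    = cint a b (fun s => f (RtoC s) - f (RtoC s + dir_up)).
  by apply: eq_cint => s _; rewrite /f /= (cexpD _ dir_dn) (cexpD _ dir_up) cexp_dir_up_dn.
rewrite -(key _ hu) /contour_int.
set I1 := cint _ _ _; set I2 := cint _ _ _; set I3 := cint _ _ _; set I4 := cint _ _ _.
move: (dir_dn) (dir_up) I1 I2 I3 I4 => x y I1 I2 I3 I4 /eqP; rewrite -subr_eq0 => /eqP E.
apply/eqP; rewrite -subr_eq0; apply/eqP; rewrite -E; ring.
Qed.

End ContourIntegral.

Section ContourCoefficients.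
Variable R : realType.
Local Notation C := (CC R).
Variable kp : R.
Hypothesis kp0 : 0 < kp.
Local Notation vup := (@dir_up R kp).
Local Notation vdn := (@dir_dn R kp).
Local Notation Jint := (@contour_int R kp).

Definition ray_cts (f : C -> C) (s : R) :=
  ccts_on 0 1 (fun t => f (ray vup s t)) /\ ccts_on 0 1 (fun t => f (ray vdn s t)).

Lemma JintB f g s : ray_cts f s -> ray_cts g s ->
  Jint (fun w => f w - g w) s = Jint f s - Jint g s.
Proof.
by move=> [f1 f2] [g1 g2]; rewrite /contour_int !cintB //; ring.
Qed.

Lemma JintZ c f s : ray_cts f s -> Jint (fun w => c * f w) s = c * Jint f s.
Proof. by move=> [f1 f2]; rewrite /contour_int !cintZ //; ring. Qed.

Lemma ray_ctsB f g s : ray_cts f s -> ray_cts g s -> ray_cts (fun w => f w - g w) s.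
Proof. by move=> [f1 f2] [g1 g2]; split; apply: cctsB. Qed.

Lemma ray_ctsZ c f s : ray_cts f s -> ray_cts (fun w => c * f w) s.
Proof. by move=> [f1 f2]; split; apply: cctsZ. Qed.

Lemma ray_cts_cst c s : ray_cts (fun=> c) s.
Proof. by split; apply: ccts_cst. Qed.

Lemma Jint_sum n (f : nat -> C -> C) s : (forall k, ray_cts (f k) s) ->
  ray_cts (fun w => \sum_(k < n) f k w) s /\
  Jint (fun w => \sum_(k < n) f k w) s = \sum_(k < n) Jint (f k) s.
Proof.
move=> fc; elim: n => [|n [IH1 IH2]].
  have -> : (fun w => \sum_(k < 0) f k w) = fun=> (0 - 0 : C).
    by apply/funext => w; rewrite big_ord0 subrr.
  rewrite big_ord0; split; first exact: ray_cts_cst.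
  by rewrite JintB ?subrr //; apply: ray_cts_cst.
have -> : (fun w => \sum_(k < n.+1) f k w) = fun w => \sum_(k < n) f k w - (-1) * f n w.
  by apply/funext => w; rewrite big_ord_recr mulN1r opprK.
have c1 := ray_ctsZ (-1) (fc n).
split; first exact: ray_ctsB.
by rewrite JintB // JintZ // IH2 big_ord_recr mulN1r opprK.
Qed.

Lemma Jint_le f s (g : R -> R) : {within `[(0 : R), 1], continuous g} -> ray_cts f s ->
  (forall t, 0 <= t <= 1 -> cmod (f (ray vup s t)) <= g t /\ cmod (f (ray vdn s t)) <= g t) ->
  cmod (Jint f s) <= (cmod vup + cmod vdn) * (2 * rint 0 1 g).
Proof.
move=> cg [f1 f2] fg; rewrite (le_trans (cmodB _ _)) // !cmodM [leRHS]mulrDl.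
apply: lerD; rewrite ler_wpM2l ?cmod_ge0 //; apply: cint_le => // t t01.
  exact: (fg t t01).1.
exact: (fg t t01).2.
Qed.

Definition ray_holo (f : C -> C) (a b : R) := holo_on f vup a b /\ holo_on f vdn a b.

Lemma ray_holo_cts f a b s : a <= s <= b -> ray_holo f a b -> ray_cts f s.
Proof. by move=> sab [h1 h2]; split; [apply: holo_ccts h1|apply: holo_ccts h2]. Qed.

(** This is e^((k-n) w), written as a function of e^w with natural exponents, the form that
    [Jint_const] takes. *)
Definition emono k n (w : C) : C := cexp w ^+ k / cexp w ^+ n.

Lemma cdiff_div (f g : C -> C) z d d' : g z != 0 -> cdiff f z d -> cdiff g z d' ->
  exists d'', cdiff (fun w => f w / g w) z d''.
Proof.
move=> g0 fd gd; eexists; apply: (cdiffM fd).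
exact: (cdiff_comp gd (cdiff_inv g0)).
Qed.

Lemma cdiff_cexpX n (z : C) : cdiff (fun w : C => cexp w ^+ n) z (n%:R * cexp z ^+ n.-1 * cexp z).
Proof. exact: (cdiff_comp (cdiff_cexp z) (cdiffX n (cexp z))). Qed.

Lemma emono_holo k n a b : ray_holo (emono k n) a b.
Proof.
have nz (z : C) : cexp z ^+ n != 0 by rewrite expf_neq0 // cexp_neq0.
have key z : exists d, cdiff (emono k n) z d.
  exact: (@cdiff_div (fun w => cexp w ^+ k) _ z _ _ (nz z) (cdiff_cexpX k z) (cdiff_cexpX n z)).
by split=> s t _ _; exact: key.
Qed.

Lemma Jint_emono k n s : Jint (emono k n) s = if k == n then vup - vdn else 0.
Proof.
case: eqP => [->|/eqP kn].
  have -> : emono n n = fun=> 1.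
    by apply/funext => w; rewrite /emono mulfV // expf_neq0 // cexp_neq0.
  by rewrite /contour_int !cint_cst // subr0 RtoC1 !mulr1.
have hom x : Jint (emono k n) x = emono k n (RtoC x) * Jint (emono k n) 0.
  have E v t : emono k n (ray v x t) = emono k n (RtoC x) * emono k n (ray v 0 t).
    have gen (y z : C) : (y * z) ^+ k / (y * z) ^+ n = y ^+ k / y ^+ n * (z ^+ k / z ^+ n).
      by rewrite !exprMn mulf_div.
    have -> : ray v 0 t = RtoC t * v by rewrite /ray RtoC0 add0r.
    by rewrite /emono /ray (cexpD (RtoC x)) gen.
  rewrite -JintZ; last by apply: (@ray_holo_cts _ 0 0); rewrite ?lexx //; exact: emono_holo.
  by rewrite /contour_int; congr (_ * _ - _ * _); apply: eq_cint => t _; exact: E.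
have [h1 h2] := emono_holo k n 0 1.
have := @Jint_const R kp (fun z => z ^+ k / z ^+ n) 0 1 ler01 h1 h2.
rewrite -/(emono k n) -[(_ \o _)]/(emono k n) (hom 1) => /eqP.
rewrite -subr_eq0 -{1}[Jint _ 0]mul1r -mulrBl mulf_eq0 => /orP[|/eqP J0]; last first.
  by rewrite hom J0 mulr0.
rewrite subr_eq0 eq_sym /emono cexp_RtoC -!RtoCX -RtoCV -RtoCM => /eqP.
rewrite -RtoC1 => /RtoC_inj; rewrite -!expRM_natl !mulr1 -expRN -expRD => E1.
have /expR_inj/eqP : expR (k%:R - n%:R) = expR 0 :> R by rewrite E1 expR0.
by rewrite subr_eq0 eqr_nat (negPf kn).
Qed.

(** The integral does not depend on the starting point x <= s. As x tends to -infinity both rays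
    shrink to 0 in the t-plane, where H is its Taylor polynomial up to O(t^(n+1)); divided by e^(n
    w) this error is O(e^x). *)
Lemma contour_coef (H : C -> C) c n (r s : R) : 0 < r -> s < 0 -> taylor0 H c ->
  (forall x, x <= s -> forall t, 0 <= t <= 1 ->
    (exists d, cdiff H (RtoC r * cexp (ray vup x t)) d) /\
    (exists d, cdiff H (RtoC r * cexp (ray vdn x t)) d)) ->
  Jint (fun w => H (RtoC r * cexp w) / cexp w ^+ n) s = c n * RtoC r ^+ n * (vup - vdn).
Proof.
move=> r0 s0 Hc Hd; set f := fun w => _.
have fh x y : y <= s -> ray_holo f x y.
  move=> ys; have cd z d : cdiff H (RtoC r * cexp z) d -> exists d', cdiff f z d'.
    have nz : cexp z ^+ n != 0 by rewrite expf_neq0 // cexp_neq0.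
    move=> dH; have dH' := cdiff_comp (cdiffZ (RtoC r) (cdiff_cexp z)) dH.
    exact: (@cdiff_div (fun w => H (RtoC r * cexp w)) (fun w => cexp w ^+ n) z _ _ nz dH' (cdiff_cexpX n z)).
  by split=> x' t /andP[_ x'y] t01;
    have [[d1 h1] [d2 h2]] := Hd x' (le_trans x'y ys) t t01; [apply: cd h1|apply: cd h2].
have fconst x : x <= s -> Jint f x = Jint f s.
  move=> xs; have [h1 h2] := fh x s (lexx s).
  exact: (@Jint_const R kp (fun z => H (RtoC r * z) / z ^+ n) x s xs h1 h2).
have [M [rho [rho0 HM]]] := Hc n.
pose P w := \sum_(k < n.+1) c k * RtoC r ^+ k * emono k n w.
have ec k x : ray_cts (emono k n) x.
  have xx : x <= x <= x by rewrite lexx.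
  exact: (ray_holo_cts xx (emono_holo k n x x)).
have PcJ x : ray_cts P x /\ Jint P x = c n * RtoC r ^+ n * (vup - vdn).
  have [h1 h2] := @Jint_sum n.+1 (fun k w => c k * RtoC r ^+ k * emono k n w) x
    (fun k => ray_ctsZ _ (ec k x)).
  split=> //; rewrite /P h2; under eq_bigr => k _ do rewrite JintZ // Jint_emono.
  rewrite (bigD1 ord_max) //= eqxx big1 ?addr0 // => k.
  by rewrite -val_eqE /= => /negPf ->; rewrite mulr0.
have Pc x := (PcJ x).1; have PJ x := (PcJ x).2.
apply/eqP; rewrite -subr_eq0 -cmod_eq0 eq_le cmod_ge0 andbT.
apply/ler_addgt0Pr => e e0; rewrite add0r.
set L := pi * kp; have L0 : 0 < L by rewrite mulr_gt0 ?pi_gt0.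
pose K := (cmod vup + cmod vdn) * (2 * (`|M| * r ^+ n.+1 * expR L)) + 1.
have K0 : 0 < K.
  rewrite ltr_wpDl // !mulr_ge0 ?addr_ge0 ?cmod_ge0 ?expR_ge0 //.
  by rewrite exprn_ge0 // ltW.
(* The first bound keeps the independence of x available, the second puts the rays into the disc of
   the Taylor estimate, the third makes the error at most e. *)
pose x := Num.min s (Num.min (ln (rho / 2 / r) - L) (ln (e / K))).
have xs : x <= s by rewrite ge_min lexx.
have fc : ray_cts f x by have xx : x <= x <= x; [rewrite lexx|exact: (ray_holo_cts xx (fh x x xs))].
have x1 : x <= ln (rho / 2 / r) - L by rewrite !ge_min lexx orbT.
have x2 : x <= ln (e / K) by rewrite !ge_min lexx !orbT.
rewrite -(fconst x xs) -(PJ x) -JintB; last 2 first.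
- exact: fc.
- exact: Pc.
have re (v : C) t : ReC v = L -> 0 <= t <= 1 -> cmod (cexp (ray v x t)) <= expR (x + L).
  move=> vL /andP[t0 t1]; rewrite cmod_cexp ler_expR /ray !reimE mul0r subr0 vL lerD2l.
  by rewrite ler_piMl // ltW.
have err (v : C) t : ReC v = L -> 0 <= t <= 1 ->
    cmod (f (ray v x t) - P (ray v x t)) <= `|M| * r ^+ n.+1 * expR L * expR x.
  move=> vL t01; have := re v t vL t01; move: (ray v x t) => w cw.
  have E0 : cexp w != 0 := cexp_neq0 w.
  have -> : f w - P w = (H (RtoC r * cexp w) - \sum_(k < n.+1) c k * (RtoC r * cexp w) ^+ k) / cexp w ^+ n.
    rewrite /f /P mulrBl; congr (_ - _); rewrite big_distrl; apply: eq_bigr => k _ /=.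
    by rewrite /emono [(RtoC r * _) ^+ k]exprMn !mulrA.
  have cr : cmod (RtoC r * cexp w) = r * cmod (cexp w) by rewrite cmodM cmod_RtoC gtr0_norm.
  have small : cmod (RtoC r * cexp w) < rho.
    rewrite cr; apply: (@le_lt_trans _ _ (r * expR (x + L))); first by rewrite ler_wpM2l // ltW.
    have : expR (x + L) <= rho / 2 / r.
      by rewrite -[leRHS]lnK ?posrE ?divr_gt0 // ler_expR; lra.
    by rewrite ler_pdivlMr // mulrC => h; apply: (le_lt_trans h); lra.
  rewrite cmodM cmodV cmodX ler_pdivrMr ?exprn_gt0 ?cmod_gt0 //.
  rewrite (le_trans (HM _ small)) // cr.
  apply: (@le_trans _ _ (`|M| * (r * cmod (cexp w)) ^+ n.+1)).
    by rewrite ler_wpM2r ?ler_norm // exprn_ge0 // mulr_ge0 ?cmod_ge0 // ltW.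
  rewrite exprMn; have -> : `|M| * (r ^+ n.+1 * cmod (cexp w) ^+ n.+1)
      = `|M| * r ^+ n.+1 * cmod (cexp w) ^+ n * cmod (cexp w).
    by rewrite [cmod _ ^+ n.+1]exprSr !mulrA.
  have -> : `|M| * r ^+ n.+1 * expR L * expR x * cmod (cexp w) ^+ n
     = `|M| * r ^+ n.+1 * cmod (cexp w) ^+ n * expR (x + L) by rewrite expRD; ring.
  by rewrite ler_wpM2l // !mulr_ge0 ?exprn_ge0 ?cmod_ge0 // ltW.
have rup : ReC vup = L by rewrite /dir_up !reimE /L; ring.
have rdn : ReC vdn = L by rewrite /dir_dn !reimE /L; ring.
rewrite (le_trans (@Jint_le _ _ (fun=> `|M| * r ^+ n.+1 * expR L * expR x) _ _ _)) //.
- by apply: within_cts => y _; exact: cst_continuous.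
- apply: ray_ctsB; last exact: Pc.
  exact: fc.
- by move=> t t01; split; apply: err.
rewrite rint_cst // subr0 mulr1.
have xe : expR x <= e / K by rewrite -[leRHS]lnK ?posrE ?divr_gt0 // ler_expR.
have -> : (cmod vup + cmod vdn) * (2 * (`|M| * r ^+ n.+1 * expR L * expR x)) = (K - 1) * expR x.
  by rewrite /K; ring.
apply: (@le_trans _ _ (K * (e / K))); last by rewrite mulrCA mulfV ?mulr1 // lt0r_neq0.
apply: (@le_trans _ _ (K * expR x)); last by rewrite ler_wpM2l // ltW.
by rewrite ler_wpM2r ?expR_ge0 // gerBl.
Qed.

End ContourCoefficients.

Section CoefficientBound.
Variable R : realType.
Local Notation C := (CC R).

Lemma rint_exp_le (l : R) : 0 < l -> rint 0 1 (fun t => expR (- l * t)) <= l^-1.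
Proof.
move=> l0; have lN : - l != 0 by rewrite oppr_eq0 lt0r_neq0.
have D (t : R) : is_derive t (1 : R) (fun t => expR (- l * t)) (- l * expR (- l * t)).
  have D0 : is_derive t (1 : R) (fun t : R => - l * t) (- l).
    have := @is_deriveZ R R R id (- l) t 1 1 (@is_derive_id R R t 1).
    by rewrite [_ *: 1]mulr1.
  have := is_derive1_comp (is_derive_expR (- l * t)) D0.
  by rewrite mulrC.
pose F t := (- l)^-1 * expR (- l * t).
have DF (t : R) : is_derive t (1 : R) F (expR (- l * t)).
  have := @is_deriveZ R R R _ (- l)^-1 t 1 _ (D t).
  by rewrite /GRing.scale /= mulKf.
have cE : continuous (fun t : R => expR (- l * t)).
  by move=> t; apply/differentiable_continuous/derivable1_diffP/(@ex_derive _ _ _ _ _ _ _ (D t)).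
have cF : continuous F.
  by move=> t; apply/differentiable_continuous/derivable1_diffP/(@ex_derive _ _ _ _ _ _ _ (DF t)).
have := @continuous_FTC2 R (fun t => expR (- l * t)) F 0 1 ltr01 (continuous_subspaceT cE).
have dF : derivable_oo_LRcontinuous F 0 1.
  split; first by move=> t _; exact: (@ex_derive _ _ _ _ _ _ _ (DF t)).
    exact/cvg_at_right_filter/cF.
  exact/cvg_at_left_filter/cF.
move=> /(_ dF) H; rewrite /rint /Rintegral H /=.
  rewrite /F mulr0 expR0 !invrN !mulNr mulr1 opprK mulr1 gerDr oppr_le0.
  by rewrite mulr_ge0 ?invr_ge0 ?expR_ge0 // ltW.
by move=> t _; rewrite derive1E derive_val.
Qed.

Variable kp : R.
Hypothesis kp0 : 0 < kp.
Local Notation vup := (@dir_up R kp).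
Local Notation vdn := (@dir_dn R kp).

Lemma ReC_vup : ReC vup = pi * kp. Proof. by rewrite /dir_up !reimE; ring. Qed.
Lemma ReC_vdn : ReC vdn = pi * kp. Proof. by rewrite /dir_dn !reimE; ring. Qed.
Lemma ImC_vup : ImC vup = pi. Proof. by rewrite /dir_up !reimE; ring. Qed.
Lemma ImC_vdn : ImC vdn = - pi. Proof. by rewrite /dir_dn !reimE; ring. Qed.

Lemma ReC_ray (v : C) s t : ReC (ray v s t) = s + t * ReC v.
Proof. by rewrite /ray !reimE; ring. Qed.

Lemma ImC_ray (v : C) s t : ImC (ray v s t) = t * ImC v.
Proof. by rewrite /ray !reimE; ring. Qed.

Definition contour_const : R :=
  (cmod vup + cmod vdn) * (2 * expR 1) * (2 / (pi * kp)) / (2 * pi).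

Lemma contour_const_ge0 : 0 <= contour_const.
Proof.
have P : 0 <= pi * kp by rewrite mulr_ge0 ?pi_ge0 ?(ltW kp0).
have V : 0 <= cmod vup + cmod vdn by rewrite addr_ge0 ?cmod_ge0.
rewrite /contour_const; apply: divr_ge0; last by rewrite mulr_ge0 ?pi_ge0.
by rewrite mulr_ge0 ?divr_ge0 // mulr_ge0 // mulr_ge0 ?expR_ge0.
Qed.

(** From -1/n the factor e^(-n w) has modulus e^(1 - n pi kp t). H may consume half of this decay;
    the remaining e^(-l t) with l = n pi kp / 2 integrates to at most 1 / l, which is the source of
    1 / n. *)
Lemma contour_coef_bound (H : C -> C) c n (r K : R) : 0 < r -> (0 < n)%N -> 0 <= K ->
  taylor0 H c ->
  (forall x, x < 0 -> forall t, 0 <= t <= 1 ->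
    (exists d, cdiff H (RtoC r * cexp (ray vup x t)) d) /\
    (exists d, cdiff H (RtoC r * cexp (ray vdn x t)) d)) ->
  (forall t, 0 <= t <= 1 ->
    cmod (H (RtoC r * cexp (ray vup (- n%:R^-1) t))) <= K * expR (n%:R * (pi * kp) / 2 * t) /\
    cmod (H (RtoC r * cexp (ray vdn (- n%:R^-1) t))) <= K * expR (n%:R * (pi * kp) / 2 * t)) ->
  cmod (c n) * r ^+ n <= contour_const * K / n%:R.
Proof.
move=> r0 n0 K0 Hc Hd HK; have nR : (0 : R) < n%:R by rewrite ltr0n.
set s := - n%:R^-1 in HK; have s0 : s < 0 by rewrite oppr_lt0 invr_gt0.
have pi0 : (0 : R) < pi := pi_gt0 R.
set L := pi * kp in HK *; have L0 : 0 < L by rewrite mulr_gt0.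
have Hds x : x <= s -> forall t, 0 <= t <= 1 ->
    (exists d, cdiff H (RtoC r * cexp (ray vup x t)) d) /\
    (exists d, cdiff H (RtoC r * cexp (ray vdn x t)) d).
  by move=> xs; apply: Hd; apply: le_lt_trans s0.
have E := contour_coef kp0 n r0 s0 Hc Hds.
set f := fun w => _ in E.
set l := n%:R * L / 2; have l0 : 0 < l by rewrite divr_gt0 // mulr_gt0.
pose g t := K * expR 1 * expR (- l * t).
have fle (v : C) t : ReC v = L -> cmod (H (RtoC r * cexp (ray v s t))) <= K * expR (l * t) ->
    cmod (f (ray v s t)) <= g t.
  move=> vL h; rewrite cmodM cmodV cmodX cmod_cexp ReC_ray vL -expRM_natl -expRN.
  apply: (le_trans (ler_wpM2r (expR_ge0 _) h)); rewrite /g -!mulrA -!expRD.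
  rewrite le_eqVlt; apply/orP; left; apply/eqP; congr (_ * expR _).
  by rewrite /s /l /L; field; exact: lt0r_neq0.
have fcts : ray_cts kp f s.
  have nz (z : C) : cexp z ^+ n != 0 by rewrite expf_neq0 // cexp_neq0.
  have cd (z : C) d : cdiff H (RtoC r * cexp z) d -> exists d', cdiff f z d'.
    move=> dH; have dH' := cdiff_comp (cdiffZ (RtoC r) (cdiff_cexp z)) dH.
    exact: (@cdiff_div R (fun w => H (RtoC r * cexp w)) (fun w => cexp w ^+ n) z _ _ (nz z) dH' (cdiff_cexpX n z)).
  have ss : s <= s <= s by rewrite lexx.
  apply: (@ray_holo_cts R kp f s s s ss).
  by split=> x t /andP[_ xs] t01; have [[d1 h1] [d2 h2]] := Hds x xs t t01;
    [apply: cd h1|apply: cd h2].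
have gc : {within `[(0 : R), 1], continuous g}.
  apply: within_cts => x _; apply: cvgM; first exact: cvg_cst.
  apply: continuous_comp; last exact: continuous_expR.
  by apply: cvgM; [exact: cvg_cst|exact: cvg_id].
have J1 : cmod (contour_int kp f s) <= (cmod vup + cmod vdn) * (2 * rint 0 1 g).
  apply: Jint_le => // t t01; have [h1 h2] := HK t t01.
  by split; apply: fle => //; [exact: ReC_vup|exact: ReC_vdn].
have G1 : rint 0 1 g <= K * expR 1 * l^-1.
  have -> : rint 0 1 g = K * expR 1 * rint 0 1 (fun t => expR (- l * t)).
    rewrite /rint /g RintegralZl //; apply: rint_integrable; apply: within_cts => x _.
    apply: continuous_comp; last exact: continuous_expR.
    by apply: cvgM; [exact: cvg_cst|exact: cvg_id].
  by rewrite ler_wpM2l ?rint_exp_le // mulr_ge0 ?expR_ge0.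
have E2 : cmod (contour_int kp f s) = cmod (c n) * r ^+ n * (2 * pi).
  rewrite E !cmodM cmodX cmod_RtoC (gtr0_norm r0) dir_up_sub_dn !cmodM cmod_i mulr1.
  by rewrite -RtoC_nat !cmod_RtoC (gtr0_norm pi0) ger0_norm.
rewrite E2 in J1.
have pi2 : 0 < 2 * pi :> R by rewrite mulr_gt0.
have J2 : cmod (c n) * r ^+ n * (2 * pi) <= (cmod vup + cmod vdn) * (2 * (K * expR 1 * l^-1)).
  by rewrite (le_trans J1) // ler_wpM2l ?addr_ge0 ?cmod_ge0 // ler_wpM2l.
rewrite -(ler_pM2r pi2) (le_trans J2) // le_eqVlt; apply/orP; left; apply/eqP.
have gen (x y P L' N : R) : P != 0 -> L' != 0 -> N != 0 ->
    x * (2 * (K * y * (N * L' / 2)^-1)) = x * (2 * y) * (2 / L') / P * K / N * P.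
  by move=> *; field; apply/and3P.
by apply: gen; apply: lt0r_neq0.
Qed.

End CoefficientBound.

(** * The image of the rays under the exponential lies in the indented disc *)

Section DeltaGeometry.
Variable R : realType.
Local Notation C := (CC R).

(** The derivative of sin y - y cos y is y sin y, non-negative up to pi. *)
Lemma mul_cos_le_sin (y : R) : 0 <= y <= pi -> y * cos y <= sin y.
Proof.
move=> /andP[y0 ypi].
have D (x : R) : is_derive x (1 : R) (fun x => sin x - x * cos x) (x * sin x).
  have H := is_deriveB (is_derive_sin x) (is_deriveM (is_derive_id x (1 : R)) (is_derive_cos x)).
  by apply: (is_derive_eq H); rewrite /GRing.scale /=; ring.
have [c /andP[c1 c2]] := MVT_all D 0 y.
rewrite sin0 mul0r !subr0 => E; rewrite -subr_ge0 E mulr_ge0 //.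
have c0 : 0 <= c by move: c1; rewrite min_l.
have cpi : c <= pi by apply: le_trans ypi; move: c2; rewrite max_r.
by rewrite mulr_ge0 // sin_ge0_pi // c0.
Qed.

Lemma abs_carg (z : C) : `|carg z| = acos (ReC z / cmod z).
Proof.
by rewrite /carg; case: ifP => _; rewrite ?normrN ger0_norm // acos_ge0 // cos_ratio_bounds.
Qed.

(** If x <= 0 or cos y <= 0 the real part of e^w - 1 is not positive. Otherwise it is at most cos y
    (e^x - 1) <= x e^x cos y <= kp e^x |y| cos y <= kp e^x |sin y|, and e^x |sin y| is the modulus
    of the imaginary part; kp < cos phi concludes. *)
Lemma sector_exp (kp phi : R) (w : C) : 0 < kp -> 0 < phi < pi / 2 -> kp < cos phi ->
  `|ImC w| <= pi -> ReC w <= kp * `|ImC w| -> (ReC w < 0) || (ImC w != 0) ->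
  cexp w != 1 /\ ReC (cexp w - 1) < cos phi * cmod (cexp w - 1).
Proof.
move=> kp0 /andP[ph0 ph1] kc ypi xy xy0.
set x := ReC w in xy xy0 *; set y := ImC w in ypi xy xy0 *.
have pi0 : (0 : R) < pi := pi_gt0 R.
have cph : 0 < cos phi by apply: cos_gt0_pihalf; lra.
have yabs : cos y = cos `|y| by rewrite cos_norm.
have E1 : ReC (cexp w - 1) = expR x * cos y - 1 by rewrite ReCB ReC_cexp.
have E2 : ImC (cexp w - 1) = expR x * sin y by rewrite ImCB ImC_cexp subr0.
have ne1 : cexp w != 1.
  apply/eqP => w1; have : cmod (cexp w) = 1 by rewrite w1 cmod1.
  rewrite cmod_cexp -expR0 => /expR_inj; rewrite -/x => x0.
  have : ReC (cexp w) = 1 by rewrite w1.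
  rewrite ReC_cexp -/x -/y x0 expR0 mul1r yabs -cos0 => /cos_inj.
  rewrite !in_itv /= lexx (ltW pi0) normr_ge0 ypi => /(_ isT isT) /eqP.
  by rewrite normr_eq0 => /eqP y0; move: xy0; rewrite x0 y0 ltxx eqxx.
split=> //; have m0 : 0 < cmod (cexp w - 1) by rewrite cmod_gt0 subr_eq0.
have cm : 0 < cos phi * cmod (cexp w - 1) by rewrite mulr_gt0.
have [x0|x0] := leP x 0.
  apply: le_lt_trans cm; rewrite E1 subr_le0.
  have e1 : expR x <= 1 by rewrite -expR0 ler_expR.
  by rewrite (le_trans _ e1) // ler_piMr ?expR_ge0 ?cos_le1.
have [c0|c0] := leP (cos y) 0.
  apply: lt_trans cm; rewrite E1 subr_lt0 (le_lt_trans _ ltr01) //.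
  by rewrite mulr_ge0_le0 ?expR_ge0.
have sabs : `|sin y| = sin `|y|.
  have [yy|yy] := leP 0 y.
    by rewrite (ger0_norm yy) ger0_norm // sin_ge0_pi // yy -(ger0_norm yy).
  have := ypi; rewrite (ltr0_norm yy) => yp.
  by rewrite -normrN -sinN ger0_norm // sin_ge0_pi // yp oppr_ge0 ltW.
have ys : `|y| * cos y <= `|sin y|.
  by rewrite sabs yabs mul_cos_le_sin // normr_ge0 ypi.
have ex1 : 1 <= expR x by rewrite -expR0 ler_expR ltW.
have S1 : ReC (cexp w - 1) <= kp * (expR x * `|sin y|).
  rewrite E1; apply: (@le_trans _ _ (cos y * (expR x - 1))).
    by rewrite mulrBr mulr1 mulrC lerD2l lerN2 cos_le1.
  apply: (@le_trans _ _ (cos y * (x * expR x))).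
    by rewrite ler_wpM2l ?(ltW c0) // expR_sub1_le.
  apply: (@le_trans _ _ (cos y * (kp * `|y| * expR x))).
    by rewrite ler_wpM2l ?(ltW c0) // ler_wpM2r ?expR_ge0.
  have -> : cos y * (kp * `|y| * expR x) = kp * expR x * (`|y| * cos y) by ring.
  by rewrite mulrA ler_wpM2l // mulr_ge0 ?expR_ge0 // ltW.
have S2 : expR x * `|sin y| <= cmod (cexp w - 1).
  by have := Im_le_cmod (cexp w - 1); rewrite E2 normrM (ger0_norm (expR_ge0 x)).
apply: (le_lt_trans S1); apply: (@le_lt_trans _ _ (kp * cmod (cexp w - 1))).
  by rewrite ler_wpM2l // ltW.
by rewrite ltr_pM2r.
Qed.

Lemma Delta0_exp (r Rad kp phi : R) (w : C) : 0 < r -> 0 < kp -> 0 < phi < pi / 2 ->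
  kp < cos phi -> r * expR (pi * kp) < Rad ->
  `|ImC w| <= pi -> ReC w <= kp * `|ImC w| -> (ReC w < 0) || (ImC w != 0) ->
  Delta0 r Rad phi (RtoC r * cexp w).
Proof.
move=> r0 kp0 phi0 kc rR ypi xy xy0.
have [ne lt] := sector_exp kp0 phi0 kc ypi xy xy0.
have pi0 : (0 : R) < pi := pi_gt0 R.
have m0 : 0 < cmod (cexp w - 1) by rewrite cmod_gt0 subr_eq0.
have E : RtoC r * cexp w - RtoC r = RtoC r * (cexp w - 1) by rewrite mulrBr mulr1.
have rC : RtoC r != 0 :> C by rewrite RtoC_eq0 lt0r_neq0.
split.
- rewrite cmodM cmod_RtoC (gtr0_norm r0) cmod_cexp (le_lt_trans _ rR) //.
  rewrite ler_wpM2l ?(ltW r0) // ler_expR (le_trans xy) // mulrC ler_wpM2r //.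
  exact: ltW.
- by rewrite -subr_eq0 E mulf_eq0 negb_or rC subr_eq0.
rewrite abs_carg E cmodM cmod_RtoC (gtr0_norm r0) ReCM ReC_RtoC ImC_RtoC mul0r subr0.
rewrite -mulf_div divff ?mul1r; last exact: lt0r_neq0.
set q := _ / _; have q1 : -1 <= q <= 1 := cos_ratio_bounds (cexp w - 1).
have := acos_ge0 q1 => a0; have := acos_lepi q1 => a1.
have qc : q < cos phi by rewrite ltr_pdivrMr.
move: phi0 => /andP[ph0 ph1].
have : cos (acos q) < cos phi by rewrite acosK ?in_itv.
by rewrite ltr_cos // in_itv /= ?a0 ?a1 // (ltW ph0); lra.
Qed.

(** For real t > r the argument of t - r is 0, below phi; so the cut of the logarithm lies outside
    the domain. *)
Lemma Delta0_slit (r Rad phi : R) (t : C) : 0 < phi -> Delta0 r Rad phi t ->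
  slit (RtoC r - t).
Proof.
move=> ph0 [_ tr ph]; rewrite /slit.
have [im0|//] := eqVneq (ImC (RtoC r - t)) 0; rewrite ?orbT // orbF.
have im1 : ImC (t - RtoC r) = 0 by rewrite -opprB ImCN im0 oppr0.
rewrite -opprB ReCN oppr_gt0 ltNge; apply/negP => re0.
have tr0 : t - RtoC r != 0 by rewrite subr_eq0.
have re1 : cmod (t - RtoC r) = ReC (t - RtoC r).
  by rewrite cmodE im1 expr0n addr0 sqrtr_sqr ger0_norm.
have := ph; rewrite abs_carg -re1 divff ?acos1 ?cmod_eq0 //.
by move=> /(lt_trans ph0); rewrite ltxx.
Qed.

End DeltaGeometry.

(** * Coefficients in class F *)

Section ClassF.
Variable R : realType.
Local Notation C := (CC R).
Variables (r th Rad phi kp : R) (g : C -> C) (Kc : C) (M : R).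
Hypotheses (r0 : 0 < r) (phi0 : 0 < phi < pi / 2) (kp0 : 0 < kp) (kc : kp < cos phi).
Hypothesis rR : r * expR (pi * kp) < Rad.
Hypothesis g_holo : holomorphic_on (Delta0 r Rad phi) g.
Hypothesis g_near : \forall t \near RtoC r, Delta0 r Rad phi t ->
  cmod (g t - (log_sing r th t + Kc)) <= M * cmod (t - RtoC r).

Local Notation vup := (@dir_up R kp).
Local Notation vdn := (@dir_dn R kp).

Let g0 t := g t - (log_sing r th t + Kc).

Definition is_ray (v : C) := ReC v = pi * kp /\ `|ImC v| = pi.

Lemma is_ray_up : is_ray vup.
Proof. by split; [exact: ReC_vup|rewrite ImC_vup ger0_norm ?pi_ge0]. Qed.

Lemma is_ray_dn : is_ray vdn.
Proof. by split; [exact: ReC_vdn|rewrite ImC_vdn normrN ger0_norm ?pi_ge0]. Qed.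

Lemma ray_Delta0 v x t : is_ray v -> x <= 0 -> 0 <= t <= 1 -> (x < 0) || (0 < t) ->
  Delta0 r Rad phi (RtoC r * cexp (ray v x t)).
Proof.
move=> [rv iv] x0 /andP[t0 t1] xt; have pi0 : (0 : R) < pi := pi_gt0 R.
have im : `|ImC (ray v x t)| = t * pi by rewrite ImC_ray normrM iv (ger0_norm t0).
apply: (Delta0_exp r0 kp0 phi0 kc rR).
- by rewrite im ler_piMl // ltW.
- by rewrite im ReC_ray rv; have -> : kp * (t * pi) = t * (pi * kp) by [ring]; rewrite gerDr.
- move: t0; rewrite le_eqVlt => /orP[/eqP t0|t0].
    by move: xt; rewrite -t0 ltxx orbF ReC_ray mul0r addr0 => ->.
  by rewrite -normr_gt0 im mulr_gt0 // orbT.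
Qed.

Lemma cdiff_g0 z : Delta0 r Rad phi z -> exists d, cdiff g0 z d.
Proof.
move=> Dz; have [d gd] := derivable_cdiff (g_holo Dz).
have ld := cdiff_log_sing th r0 (Delta0_slit (andP phi0).1 Dz).
by eexists; exact: (cdiffB gd (cdiffD ld (cdiff_cst Kc z))).
Qed.

Definition ray_len (v : C) : R := 1 + cmod v.

Lemma cmod_ray_le v x t : 0 <= t -> cmod (ray v x t) <= ray_len v * (`|x| + t).
Proof.
move=> t0; rewrite /ray (le_trans (cmodD _ _)) // cmodM !cmod_RtoC (ger0_norm t0) /ray_len.
have -> : (1 + cmod v) * (`|x| + t) = (`|x| + t * cmod v) + (t + cmod v * `|x|) by ring.
by rewrite lerDl addr_ge0 // mulr_ge0 ?cmod_ge0.
Qed.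

Lemma ray_len_gt0 v : 0 < ray_len v.
Proof. by rewrite ltr_pwDl ?cmod_ge0. Qed.

Lemma cexp_sub1_small (w : C) : cmod w <= 2^-1 -> cmod (cexp w - 1) <= 6 * cmod w.
Proof.
move=> w2; have H := cmod_cexp1x_le w2; have w0 := cmod_ge0 w.
have -> : cexp w - 1 = (cexp w - 1 - w) + w by ring.
rewrite (le_trans (cmodD _ _)) //.
have : 10 * cmod w ^+ 2 <= 5 * cmod w.
  by rewrite expr2 mulrA ler_wpM2r //; lra.
by lra.
Qed.

Lemma cexp_sub1_ray v : is_ray v -> exists2 C1, 0 <= C1 & forall x t,
  x <= 0 -> 0 <= t <= 1 -> cmod (cexp (ray v x t) - 1) <= C1 * (`|x| + t).
Proof.
move=> [rv iv]; have pi0 : (0 : R) < pi := pi_gt0 R.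
pose Q := expR (pi * kp) + 1; have Q0 : 0 <= Q by rewrite addr_ge0 ?expR_ge0.
exists ((6 + 2 * Q) * ray_len v).
  by rewrite mulr_ge0 ?(ltW (ray_len_gt0 v)) // addr_ge0 // mulr_ge0.
move=> x t x0 /andP[t0 t1]; have wl := cmod_ray_le v x t0.
set w := ray v x t in wl *.
suff : cmod (cexp w - 1) <= (6 + 2 * Q) * cmod w.
  move=> H; rewrite (le_trans H) // -mulrA ler_wpM2l // addr_ge0 // mulr_ge0 //.
have w0 := cmod_ge0 w; have Qw : 0 <= 2 * Q * cmod w by rewrite !mulr_ge0.
have [w2|w2] := leP (cmod w) 2^-1.
  by have := cexp_sub1_small w2; rewrite mulrDl; lra.
rewrite (le_trans (cmodB _ _)) // cmod1 cmod_cexp /w ReC_ray rv -/w.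
have : expR (x + t * (pi * kp)) <= expR (pi * kp).
  rewrite ler_expR; have : t * (pi * kp) <= pi * kp by rewrite ler_piMl // mulr_ge0 // ltW.
  by lra.
have : Q <= 2 * Q * cmod w.
  by rewrite mulrAC -[leLHS]mul1r ler_wpM2r //; lra.
rewrite /Q mulrDl; lra.
Qed.

(** Compactness: with t >= eta the rays stay in the domain even for x = 0, so the bound is uniform
    as the starting point -1/n approaches 0. *)
Lemma g0_far v (eta : R) : is_ray v -> 0 < eta -> exists B, forall x t,
  - eta <= x <= 0 -> eta <= t <= 1 -> cmod (g0 (RtoC r * cexp (ray v x t))) <= B.
Proof.
move=> iv e0; pose h (p : R * R) := cmod (g0 (RtoC r * cexp (ray v p.1 p.2))).
pose D := (`[- eta, 0] `*` `[eta, 1])%classic : set (R * R).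
have [eta1|eta1] := leP eta 1; last first.
  by exists 0 => x t _ /andP[t1 t2]; have := lt_le_trans eta1 (le_trans t1 t2); rewrite ltxx.
have cD : compact D by apply: compact_setX; exact: segment_compact.
have D0 : D !=set0.
  exists (0, 1); split => /=; rewrite in_itv /= lexx ?andbT //; first by rewrite oppr_le0 ltW.
have ch : {within D, continuous h}.
  apply: continuous_in_subspaceT => -[x t]; rewrite inE => -[/=].
  rewrite !in_itv /= => /andP[x1 x2] /andP[t1 t2].
  have t0 : 0 < t := lt_le_trans e0 t1.
  have Dz : Delta0 r Rad phi (RtoC r * cexp (ray v x t)).
    by apply: ray_Delta0 => //; rewrite ?t0 ?orbT // (ltW t0).
  have [d gd] := cdiff_g0 Dz.
  have fd := cdiff_comp (cdiffZ (RtoC r) (cdiff_cexp (ray v x t))) gd.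
  have /pdiff_cts pc := cdiff_pdiff fd.
  apply/cvgrPdist_le => e /pc[s s0 Hs].
  exists (ball x s, ball t s); first by split; exact: nbhsx_ballx.
  move=> -[x' t'] [/= bx bt]; have H := Hs x' t'; rewrite /ball /= distrC in bx; rewrite /ball /= distrC in bt.
  have {}H := H bx bt; rewrite /h /=; apply: le_trans H.
  set a := g0 _; set b := g0 _.
  have := cmod_ge_sub a b; have := cmod_ge_sub b a; rewrite (cmodC a b) => H1 H2.
  by rewrite ler_norml; apply/andP; split; lra.
have [c _ cmax] := compact_EVT_max D0 cD ch.
exists (h c) => x t xe te; apply: (cmax (x, t)).
by rewrite inE; split; rewrite /= in_itv.
Qed.

Lemma g0_ray v : is_ray v -> exists C0 d, [/\ 0 <= C0, 0 < d & forall x t,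
  - d <= x < 0 -> 0 <= t <= 1 ->
  cmod (g0 (RtoC r * cexp (ray v x t))) <= C0 * (`|x| + t)].
Proof.
move=> iv; have [d d0 Hd] := (near_CCP _ _).1 g_near.
set V := ray_len v; have V0 : 0 < V := ray_len_gt0 v.
(* For |x| and t up to eta, |x| + t < 3 eta, which makes |w| <= 1/2, so that |e^w - 1| <= 6 |w|, and
   puts r e^w within d of r. For t > eta the bound B is at most (|B| / eta) (|x| + t). *)
pose eta := Num.min (2^-1 / V) (d / (6 * r * V)) / 3.
have rV : 0 < 6 * r * V by rewrite !mulr_gt0.
have eta0 : 0 < eta by rewrite divr_gt0 // lt_min !divr_gt0.
have [B HB] := g0_far iv eta0.
exists (`|M| * (6 * r * V) + `|B| / eta), eta; split => //.
  by apply: addr_ge0; [apply: mulr_ge0|apply: divr_ge0] => //; exact: ltW.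
move=> x t /andP[x1 x2] /andP[t0 t1].
have xa : `|x| = - x by rewrite ltr0_norm.
have Dz : Delta0 r Rad phi (RtoC r * cexp (ray v x t)).
  by apply: ray_Delta0 => //; rewrite ?x2 ?t0 // ltW.
have s0 : 0 <= `|x| + t by rewrite addr_ge0.
have [te|te] := leP t eta; last first.
  have := HB x t; rewrite x1 (ltW x2) (ltW te) t1 => /(_ isT isT) H.
  rewrite (le_trans H) // (le_trans (ler_norm B)) // [leRHS]mulrDl.
  apply: (@le_trans _ _ (`|B| / eta * (`|x| + t))).
    rewrite -mulrA ler_peMr // ler_pdivlMl // mulr1.
    by have := normr_ge0 x; lra.
  by rewrite lerDr mulr_ge0 // mulr_ge0 // ltW.
have wl := cmod_ray_le v x t0; rewrite -/V in wl.
have e3 : `|x| + t < 3 * eta by rewrite xa; lra.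
have e3E : 3 * eta = Num.min (2^-1 / V) (d / (6 * r * V)) by rewrite /eta; field.
move: e3; rewrite e3E lt_min => /andP[s1 s2].
have w2 : cmod (ray v x t) <= 2^-1.
  by rewrite (le_trans wl) // mulrC -ler_pdivlMr // ltW.
have E : RtoC r * cexp (ray v x t) - RtoC r = RtoC r * (cexp (ray v x t) - 1).
  by rewrite mulrBr mulr1.
have zr : cmod (RtoC r * cexp (ray v x t) - RtoC r) <= 6 * r * V * (`|x| + t).
  rewrite E cmodM cmod_RtoC (gtr0_norm r0).
  have -> : 6 * r * V * (`|x| + t) = r * (6 * (V * (`|x| + t))) by ring.
  by rewrite ler_wpM2l ?(ltW r0) // (le_trans (cexp_sub1_small w2)) // ler_wpM2l.
have zd : cmod (RtoC r * cexp (ray v x t) - RtoC r) < d.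
  by rewrite (le_lt_trans zr) // mulrC -ltr_pdivlMr.
have := Hd _ zd Dz; rewrite -/(g0 _) => H; rewrite (le_trans H) //.
apply: (@le_trans _ _ (`|M| * (6 * r * V * (`|x| + t)))).
  apply: (@le_trans _ _ (`|M| * cmod (RtoC r * cexp (ray v x t) - RtoC r))).
    by rewrite ler_wpM2r ?cmod_ge0 ?ler_norm.
  by rewrite ler_wpM2l.
rewrite [leRHS]mulrDl [leLHS]mulrA lerDl mulr_ge0 //.
by rewrite divr_ge0 // ltW.
Qed.

End ClassF.

Section ClassFCoef.
Variable R : realType.
Local Notation C := (CC R).

Lemma sqr_le_expR (a y : R) : 0 < a -> 0 <= y ->
  (1 + y) ^+ 2 <= (1 + a^-1) ^+ 2 * expR (2 * (a * y)).
Proof.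
move=> a0 y0; have ai : 0 < a^-1 by rewrite invr_gt0.
have E : 1 + y <= (1 + a^-1) * expR (a * y).
  apply: (@le_trans _ _ ((1 + a^-1) * (1 + a * y))); last first.
    by rewrite ler_wpM2l ?expR_ge1Dx // addr_ge0 // ltW.
  have -> : (1 + a^-1) * (1 + a * y) = (1 + y) + (a * y + a^-1) by field; exact: lt0r_neq0.
  by rewrite lerDl addr_ge0 ?mulr_ge0 // ltW.
have -> : expR (2 * (a * y)) = expR (a * y) ^+ 2 by rewrite -expRM_natl.
rewrite -exprMn lerXn2r ?nnegrE //; first by rewrite addr_ge0.
by rewrite mulr_ge0 ?expR_ge0 // addr_ge0 // ltW.
Qed.

Variables (r th Rad phi kp : R) (g : C -> C) (Kc : C) (M : R).
Hypotheses (r0 : 0 < r) (phi0 : 0 < phi < pi / 2) (kp0 : 0 < kp) (kc : kp < cos phi).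
Hypothesis rR : r * expR (pi * kp) < Rad.
Hypothesis g_holo : holomorphic_on (Delta0 r Rad phi) g.
Hypothesis g_near : \forall t \near RtoC r, Delta0 r Rad phi t ->
  cmod (g t - (log_sing r th t + Kc)) <= M * cmod (t - RtoC r).

Local Notation vup := (@dir_up R kp).
Local Notation vdn := (@dir_dn R kp).

Let g0 t := g t - (log_sing r th t + Kc).

Variable b : nat -> C.
Hypothesis g0b : taylor0 g0 b.

(** At z = r e^w the factor of g0 is n - (n-1) e^w = 1 - (n-1) (e^w - 1). On the rays from -1/n it
    is O(1 + n t), not merely O(n), which gains the extra 1 / n for differences of weights. *)
Let twist n (z : C) := n%:R * g0 z + (- (n.-1%:R / RtoC r)) * (z * g0 z).

Lemma twist_taylor n : (0 < n)%N -> exists2 c, taylor0 (twist n) c &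
  c n = n%:R * b n - n.-1%:R / RtoC r * b n.-1.
Proof.
move=> n0; eexists.
  exact: (taylor0D (taylor0Z n%:R g0b) (taylor0Z (- (n.-1%:R / RtoC r)) (taylor0_mulX g0b))).
by case: n n0 => //= n _; rewrite mulNr.
Qed.

Lemma twist_cdiff n z : (exists d, cdiff g0 z d) -> exists d, cdiff (twist n) z d.
Proof.
move=> [d gd]; eexists.
exact: (cdiffD (cdiffZ n%:R gd) (cdiffZ (- (n.-1%:R / RtoC r)) (cdiffM (cdiff_id z) gd))).
Qed.

Lemma twist_le n (w : C) : cmod (twist n (RtoC r * cexp w))
  <= (1 + n%:R * cmod (cexp w - 1)) * cmod (g0 (RtoC r * cexp w)).
Proof.
have rC : RtoC r != 0 :> C by rewrite RtoC_eq0 lt0r_neq0.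
case: n => [|n].
  by rewrite /twist mul0r add0r mul0r oppr0 !mul0r cmod0 addr0 mul1r cmod_ge0.
have -> : twist n.+1 (RtoC r * cexp w)
    = (1 - n%:R * (cexp w - 1)) * g0 (RtoC r * cexp w).
  by rewrite /twist /= -(natr1 n); move: (cexp w) (g0 _) => x y; field.
rewrite cmodM ler_wpM2r ?cmod_ge0 // (le_trans (cmodB _ _)) // cmod1 lerD2l.
rewrite cmodM -RtoC_nat cmod_RtoC ger0_norm // ler_wpM2r ?cmod_ge0 //.
by rewrite ler_nat.
Qed.

Lemma class_F_decay : exists Q N, forall n, (N <= n)%N -> (0 < n)%N ->
  cmod (b n) * r ^+ n <= Q / n%:R ^+ 2 /\
  cmod (n%:R * b n - n.-1%:R / RtoC r * b n.-1) * r ^+ n <= Q / n%:R ^+ 2.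
Proof.
have pi0 : (0 : R) < pi := pi_gt0 R.
have [Cu [du [Cu0 du0 Hu]]] := g0_ray r0 phi0 kp0 kc rR g_holo g_near (is_ray_up kp).
have [Cd [dd [Cd0 dd0 Hd]]] := g0_ray r0 phi0 kp0 kc rR g_holo g_near (is_ray_dn kp).
have [Eu Eu0 HEu] := cexp_sub1_ray kp0 (is_ray_up kp).
have [Ed Ed0 HEd] := cexp_sub1_ray kp0 (is_ray_dn kp).
set C0 := Cu + Cd; set C1 := Eu + Ed.
have C00 : 0 <= C0 by rewrite addr_ge0.
have C10 : 0 <= C1 by rewrite addr_ge0.
set d := Num.min du dd; have d0 : 0 < d by rewrite lt_min du0.
(* One factor 1 + n t comes from g0 and one from the twist; each is at most (1 + 1/a) e^(a n t), so
   together they use exactly the growth e^(n pi kp t / 2) permitted to H. *)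
set a := pi * kp / 4; have a0 : 0 < a by rewrite divr_gt0 // mulr_gt0.
set P := (1 + a^-1) ^+ 2; have P0 : 0 <= P by rewrite sqr_ge0.
set cc := @contour_const R kp; have cc0 : 0 <= cc := contour_const_ge0 kp0.
exists (cc * (C0 * (1 + C1) * P)), (Num.truncn d^-1).+1 => n nN n0.
have nR : (0 : R) < n%:R by rewrite ltr0n.
have nd : n%:R^-1 <= d.
  rewrite -[leRHS]invrK lef_pV2 ?posrE ?invr_gt0 //.
  by rewrite ltW // (lt_le_trans (truncnS_gt _)) // ler_nat.
have xr : - d <= - (n%:R : R)^-1 < 0 by rewrite lerN2 nd oppr_lt0 invr_gt0.
have xa : `|- (n%:R : R)^-1| = (n%:R : R)^-1 by rewrite normrN ger0_norm // invr_ge0 ltW.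
have dle : d <= du /\ d <= dd by split; rewrite ge_min lexx ?orbT.
have nt (t : R) : 0 <= t -> n%:R^-1 + t = (1 + n%:R * t) / n%:R.
  by move=> _; field; exact: lt0r_neq0.
have expE (t : R) : expR (n%:R * (pi * kp) / 2 * t) = expR (2 * (a * (n%:R * t))).
  by congr expR; rewrite /a; field.
have cdg (v : C) : is_ray kp v -> forall x : R, x < 0 -> forall t : R, 0 <= t <= 1 ->
    exists d, cdiff g0 (RtoC r * cexp (ray v x t)) d.
  move=> iv x x0 t t01; apply: (cdiff_g0 th Kc r0 phi0 g_holo).
  by apply: (ray_Delta0 r0 phi0 kp0 kc rR iv); rewrite ?x0 // ltW.
have g0le (v : C) (t : R) : is_ray kp v -> v = vup \/ v = vdn -> 0 <= t <= 1 ->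
    cmod (g0 (RtoC r * cexp (ray v (- n%:R^-1) t))) <= C0 * (1 + n%:R * t) / n%:R /\
    cmod (cexp (ray v (- n%:R^-1) t) - 1) <= C1 * (1 + n%:R * t) / n%:R.
  move=> iv vv t01; have /andP[t0 t1] := t01; have /andP[x1 x2] := xr.
  have s0 : 0 <= (1 + n%:R * t) / n%:R by rewrite divr_ge0 ?(ltW nR) // addr_ge0 // mulr_ge0 // ltW.
  rewrite -!mulrA; case: vv => ->; split.
  - rewrite (le_trans (Hu (- n%:R^-1) t _ t01)) ?xa ?nt //.
      by rewrite x2 andbT (le_trans _ x1) // lerN2; case: dle.
    by rewrite ler_wpM2r // /C0 lerDl.
  - rewrite (le_trans (HEu (- n%:R^-1) t (ltW x2) t01)) // xa nt //.
    by rewrite ler_wpM2r // /C1 lerDl.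
  - rewrite (le_trans (Hd (- n%:R^-1) t _ t01)) ?xa ?nt //.
      by rewrite x2 andbT (le_trans _ x1) // lerN2; case: dle.
    by rewrite ler_wpM2r // /C0 lerDr.
  - rewrite (le_trans (HEd (- n%:R^-1) t (ltW x2) t01)) // xa nt //.
    by rewrite ler_wpM2r // /C1 lerDr.
have B1 (v : C) (t : R) : is_ray kp v -> v = vup \/ v = vdn -> 0 <= t <= 1 ->
    cmod (g0 (RtoC r * cexp (ray v (- n%:R^-1) t)))
      <= C0 * (1 + C1) * P / n%:R * expR (n%:R * (pi * kp) / 2 * t) /\
    cmod (twist n (RtoC r * cexp (ray v (- n%:R^-1) t)))
      <= C0 * (1 + C1) * P / n%:R * expR (n%:R * (pi * kp) / 2 * t).
  move=> iv vv t01; have [h1 h2] := g0le v t iv vv t01; have /andP[t0 t1] := t01.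
  set y := n%:R * t in h1 h2 *; have y0 : 0 <= y by rewrite mulr_ge0 // ltW.
  have S := sqr_le_expR a0 y0; rewrite -/P -expE in S.
  have -> : C0 * (1 + C1) * P / n%:R * expR (n%:R * (pi * kp) / 2 * t)
    = C0 / n%:R * (1 + C1) * (P * expR (n%:R * (pi * kp) / 2 * t)) by ring.
  have Cn : 0 <= C0 / n%:R by rewrite divr_ge0 // ltW.
  have main : C0 / n%:R * (1 + C1) * (1 + y) ^+ 2
      <= C0 / n%:R * (1 + C1) * (P * expR (n%:R * (pi * kp) / 2 * t)).
    by rewrite ler_wpM2l // mulr_ge0 // addr_ge0.
  have y1 : 1 + y <= (1 + C1) * (1 + y) ^+ 2.
    rewrite expr2 mulrA ler_peMl ?addr_ge0 //.
    by rewrite -[leLHS]mulr1 ler_pM // ?lerDl.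
  split; apply: le_trans main.
    by rewrite (le_trans h1) // mulrAC -[leRHS]mulrA ler_wpM2l.
  rewrite (le_trans (twist_le n _)) //.
  have h3 : 1 + n%:R * cmod (cexp (ray v (- n%:R^-1) t) - 1) <= (1 + C1) * (1 + y).
    have : n%:R * cmod (cexp (ray v (- n%:R^-1) t) - 1) <= C1 * (1 + y).
      by rewrite mulrC -ler_pdivlMr.
    by move=> h; rewrite [leRHS]mulrDl [1 * _]mul1r lerD // lerDl.
  have -> : C0 / n%:R * (1 + C1) * (1 + y) ^+ 2
    = ((1 + C1) * (1 + y)) * (C0 * (1 + y) / n%:R) by ring.
  by rewrite ler_pM ?cmod_ge0 // addr_ge0 // mulr_ge0 ?cmod_ge0 // ltW.
have K0 : 0 <= C0 * (1 + C1) * P / n%:R.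
  by rewrite divr_ge0 ?(ltW nR) // mulr_ge0 // mulr_ge0 // addr_ge0.
have QE : cc * (C0 * (1 + C1) * P) / n%:R ^+ 2 = cc * (C0 * (1 + C1) * P / n%:R) / n%:R.
  by field; exact: lt0r_neq0.
rewrite QE; split.
  apply: (@contour_coef_bound R kp kp0 g0 b n r _ r0 n0 K0 g0b).
    by move=> x x0 t t01; split; apply: cdg => //; [exact: is_ray_up|exact: is_ray_dn].
  move=> t t01; split.
    by have [] := B1 vup t (is_ray_up kp) (or_introl erefl) t01.
  by have [] := B1 vdn t (is_ray_dn kp) (or_intror erefl) t01.
have [c Tc <-] := twist_taylor n0.
apply: (@contour_coef_bound R kp kp0 (twist n) c n r _ r0 n0 K0 Tc).
  move=> x x0 t t01; split; apply: twist_cdiff; apply: cdg => //.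
    exact: is_ray_up.
  exact: is_ray_dn.
move=> t t01; split.
  by have [] := B1 vup t (is_ray_up kp) (or_introl erefl) t01.
by have [] := B1 vdn t (is_ray_dn kp) (or_intror erefl) t01.
Qed.

End ClassFCoef.

Lemma class_F_coef (R : realType) (Theta : nat -> R) (r th : R) :
  fps_of_class (class_F r th) (gTheta Theta) ->
  exists M M', (forall k, `|Theta k.+1 * r ^+ k.+1 - th| <= M / k.+1%:R) /\
    (forall k, `|Theta k.+2 * r ^+ k.+2 - Theta k.+1 * r ^+ k.+1| <= M' / k.+1%:R ^+ 2).
Proof.
move=> [g [gT [r0 _ [Rad [phi [rRad phi0 gh [Kc [M gn]]]]]]]].
have pi0 : (0 : R) < pi := pi_gt0 R.
have c0 : 0 < cos phi by apply: cos_gt0_pihalf; move: phi0 => /andP[]; lra.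
have Rr : 1 < Rad / r by rewrite ltr_pdivlMr ?mul1r.
(* The slope is small for two reasons: to avoid the cone of angle phi at r, and to keep |r e^w| <= r
   e^(pi kp) below the outer radius. *)
pose kp := Num.min (cos phi / 2) (ln (Rad / r) / (2 * pi)).
have kp0 : 0 < kp by rewrite lt_min !divr_gt0 ?ln_gt0 // mulr_gt0.
have kc : kp < cos phi by rewrite gt_min; apply/orP; left; lra.
have rR : r * expR (pi * kp) < Rad.
  rewrite mulrC -ltr_pdivlMr // -[ltRHS]lnK ?posrE ?(lt_trans ltr01) // ltr_expR.
  have l0 : 0 < ln (Rad / r) by rewrite ln_gt0.
  apply: (@le_lt_trans _ _ (ln (Rad / r) / 2)); last by lra.
  have : kp <= ln (Rad / r) / (2 * pi) by rewrite ge_min lexx orbT.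
  rewrite ler_pdivlMr ?mulr_gt0 // => H; lra.
pose al k := Theta k * r ^+ k.
pose b k := gTheta Theta k + (-1) * (log_coef r th k + (if k == 0%N then Kc else 0)).
have g0b : taylor0 (fun t => g t - (log_sing r th t + Kc)) b.
  have := taylor0D (taylor0_pseries gT)
    (taylor0Z (-1) (taylor0D (taylor0_log_sing th r0) (taylor0_cst Kc))).
  by congr taylor0; apply/funext => t; rewrite mulN1r.
have bE k : b k.+1 = RtoC ((al k.+1 - th) / (k.+1%:R * r ^+ k.+1)).
  by rewrite -gTheta_sub_log_coef // /b /= addr0 mulN1r.
have [Q [N HQ]] := class_F_decay r0 phi0 kp0 kc rR gh gn g0b.
have bound1 k : (N <= k)%N -> `|al k.+1 - th| * k.+1%:R <= Q.
  move=> kN; have [H _] := HQ k.+1 (leqW kN) isT.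
  have k0 : (0 : R) < k.+1%:R by rewrite ltr0n.
  have rk : 0 < r ^+ k.+1 by rewrite exprn_gt0.
  move: H; rewrite bE cmod_RtoC normrM normfV (gtr0_norm (mulr_gt0 k0 rk)) ler_pdivlMr ?exprn_gt0 //.
  rewrite [X in X <= _ -> _](_ : _ = `|al k.+1 - th| * k.+1%:R) //.
  by field; rewrite !lt0r_neq0.
have bound2 k : (N <= k)%N -> `|al k.+2 - al k.+1| * k.+1%:R ^+ 2 <= Q.
  move=> kN; have [_ H] := HQ k.+2 (leqW (leqW kN)) isT.
  have k0 : (0 : R) < k.+1%:R by rewrite ltr0n.
  have k1 : (0 : R) < k.+2%:R by rewrite ltr0n.
  have rk : r != 0 by rewrite lt0r_neq0.
  move: H; rewrite /= !bE -!RtoC_nat -RtoCV -!RtoCM -RtoCB cmod_RtoC.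
  (* The twist was designed for this: its coefficient is the difference of consecutive scaled
     weights divided by r^(k+2), with th cancelling. *)
  have -> : k.+2%:R * ((al k.+2 - th) / (k.+2%:R * r ^+ k.+2))
      - k.+1%:R / r * ((al k.+1 - th) / (k.+1%:R * r ^+ k.+1))
      = (al k.+2 - al k.+1) / r ^+ k.+2.
    rewrite !exprS; move: (r ^+ k) (expf_neq0 k rk) k0 k1 => x x0.
    move: (k.+1%:R) (k.+2%:R) => y z y0 z0.
    by field; rewrite x0 rk !lt0r_neq0.
  have rk2 : 0 < r ^+ k.+2 by rewrite exprn_gt0.
  rewrite normrM normfV (gtr0_norm rk2) divfK ?lt0r_neq0 // ler_pdivlMr ?exprn_gt0 //.
  apply: le_trans; rewrite ler_wpM2l // lerXn2r ?nnegrE ?ler0n //.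
  by rewrite ler_nat.
have [M1 HM1] := eventually_bounded bound1.
have [M2 HM2] := eventually_bounded bound2.
exists M1, M2; split=> k; rewrite ler_pdivlMr ?exprn_gt0 ?ltr0n //; [exact: HM1|exact: HM2].
Qed.

Theorem theorem3p1 (R : realType) (Theta : nat -> R)
    (Theta_ge0 : forall m : nat, (0 < m)%N -> 0 <= Theta m)
    (b : nat) (s : nat -> R) :
  [/\ (forall n : nat,
         RtoC (hnorm Theta n) * char_fun Theta b s n
         = fps_mul (fps_exp (shift_fps Theta b s)) (GTheta Theta) n),
      (forall r theta : R, 0 < theta ->
         fps_of_class (class_F r theta) (gTheta Theta) ->
         (fun n : nat => char_fun Theta b s n - char_limit Theta b s r)
           =O_\oo (fun n : nat => RtoC (1 / n%:R : R))) &
      (forall r theta gamma : R, 0 < theta ->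
         fps_of_class (class_eF r theta gamma) (gTheta Theta) ->
         (fun n : nat => char_fun Theta b s n - char_limit Theta b s r)
           =O_\oo (fun n : nat => RtoC (ln (n%:R : R) / n%:R `^ gamma)))].
Proof.
split.
- exact: char_fun_gf.
- move=> r theta th0 gF; have [M [M' [H1 H2]]] := class_F_coef gF.
  have [g [_ [r0 _ _]]] := gF.
  (* Class F gives convergence of the weights at the rate 1 / k, hence exponent 1; the rate without
     logarithm comes from the difference bound [H2]. *)
  apply: (char_fun_smooth_rate (g := 1) (M := M) Theta_ge0 b s r0 th0 ltr01 (lexx 1) _ H2).
  by move=> k; rewrite powRr1.
- move=> r theta gamma th0 geF.
  have [g [_ [r0 _ /andP[g0 g1] _]]] := geF.
  have [M HM] := class_eF_coef r0 g0 geF.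
  exact: (char_fun_log_rate Theta_ge0 b s r0 th0 g0 g1 HM).
Qed.
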